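(* Let $k$ be a field, let $H$ be a finite-dimensional Hopf algebra over $k$ with bijective antipode, and let $T$ be a left $H$-torsor. Let $A$ be a noetherian connected graded right $H$-comodule algebra. If $A$ is Artin-Schelter regular of dimension $d$, then so is $\widetilde A$.
   Context: A right (left) $H$-comodule algebra is an algebra object in the monoidal category of right (left) $H$-comodules. A left $H$-torsor is a left $H$-comodule algebra $T$, with structure map $\rho:T\to H\otimes T$ and multiplication $m$, such that (1) $T\cong H$ as left $H$-comodules; (2) the ring of coinvariants $\{t\in T: \rho(t)=1\otimes t\}$ equals $k$; (3) the map $(\mathrm{id}\otimes m)\circ(\rho\otimes \mathrm{id}):T\otimes T\to H\otimes T$ is bijective. A connected graded $H$-comodule algebra is an $\mathbb{N}$-graded algebra $A$ with $A_0=k$ that is a right $H$-comodule algebra such that every $A_i$ is a subcomodule. With $\rho_A:A\to A\otimes H$ its structure map, $\widetilde A=\{x\in A\otimes T:(\rho_A\otimes\mathrm{id})(x)=(\mathrm{id}\otimes\rho)(x)\}$, a graded subalgebra of $A\otimes T$ ($T$ in degree $0$). A connected graded $k$-algebra $A$ is Artin-Schelter Gorenstein of dimension $d$ if the left and right injective dimensions of $A$ as a graded $A$-module equal $d$ and, for some integer $\ell$, $\underline{\mathrm{Ext}}^i_A(k,A)\cong\underline{\mathrm{Ext}}^i_{A^{\circ}}(k,A)\cong\delta_{id}\,k(\ell)$ for all $i$ (that is, zero for $i\neq d$ and $k(\ell)$ for $i=d$), where $A^\circ$ is the opposite algebra and $\underline{\mathrm{Ext}}^i$ are the derived functors of $\underline{\mathrm{Hom}}(M,N)=\bigoplus_{d\in\mathbb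 Z}\mathrm{Hom}(M,N(d))$ on graded modules. It is Artin-Schelter regular of dimension $d$ if in addition its global dimension is $d<\infty$. (No growth condition is imposed.) *)

(* Defs.v *)
From HB Require Import structures.
From mathcomp Require Import all_boot all_order all_algebra all_field.
From mathcomp Require Import all_classical.

Set Implicit Arguments.
Unset Strict Implicit.
Unset Printing Implicit Defensive.

Import GRing.Theory.
Local Open Scope classical_set_scope.
Local Open Scope ring_scope.

Reserved Notation "V ⊗ W" (at level 40, left associativity).
Reserved Notation "v ⊗t w" (at level 40, left associativity).

(* V ⊗ W is the set of formal finite sums of pairs, two sums being          *)
(* identified when every bilinear map takes the same value on them.         *)

Lemma linear_fun0 (R : pzRingType) (V U : lmodType R) (f : V -> U) :
  linear f -> f 0 = 0.
Proof.
move=> /(_ 1 0 0); rewrite !scale1r addr0 => h.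
by apply: (@addrI _ (f 0)); rewrite addr0 -h.
Qed.

Section Bilinear.
Context (k : fieldType) (V W U : lmodType k).

Definition is_bilin (b : V -> W -> U) : Prop :=
  (forall w, linear (b^~ w)) /\ (forall v, linear (b v)).

Definition bsum (b : V -> W -> U) (s : seq (V * W)) : U :=
  \sum_(p <- s) b p.1 p.2.

Lemma bsum_cat b s t : bsum b (s ++ t) = bsum b s + bsum b t.
Proof. by rewrite /bsum big_cat. Qed.

Lemma bilinZl b c v w : is_bilin b -> b (c *: v) w = c *: b v w.
Proof.
move=> [hl _]; have /= := hl w c v 0; rewrite addr0 => ->.
by rewrite (linear_fun0 (hl w)) addr0.
Qed.

Lemma bilinZr b c v w : is_bilin b -> b v (c *: w) = c *: b v w.
Proof.
move=> [_ hr]; have /= := hr v c w 0; rewrite addr0 => ->.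
by rewrite (linear_fun0 (hr v)) addr0.
Qed.

Lemma bsumZ b c s : is_bilin b ->
  bsum b [seq (c *: p.1, p.2) | p <- s] = c *: bsum b s.
Proof.
move=> hb; rewrite /bsum big_map scaler_sumr; apply: eq_bigr => p _ /=.
exact: bilinZl.
Qed.

End Bilinear.

Section Tensor.
Context (k : fieldType) (V W : lmodType k).

Definition teq (s t : seq (V * W)) : bool :=
  `[< forall (U : lmodType k) (b : V -> W -> U),
        is_bilin b -> bsum b s = bsum b t >].

Lemma teq_refl : reflexive teq. Proof. by move=> s; apply/asboolP. Qed.
Lemma teq_sym : symmetric teq.
Proof.
by move=> s t; apply/idP/idP => /asboolP h; apply/asboolP => U b /h ->.
Qed.
Lemma teq_trans : transitive teq.
Proof.
move=> t s u /asboolP h1 /asboolP h2; apply/asboolP => U b hb.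
by rewrite h1 // h2.
Qed.

Canonical teq_equiv := EquivRel teq teq_refl teq_sym teq_trans.

Definition tensor : Type := {eq_quot teq}%qT.
HB.instance Definition _ := Choice.on tensor.
HB.instance Definition _ := EqQuotient.on tensor.

Definition tpi (s : seq (V * W)) : tensor := \pi_tensor%qT s.
Definition trepr (x : tensor) : seq (V * W) := repr x.

Lemma tpiK (x : tensor) : tpi (trepr x) = x. Proof. exact: reprK. Qed.

Lemma tpiP s t : (forall (U : lmodType k) (b : V -> W -> U),
  is_bilin b -> bsum b s = bsum b t) <-> tpi s = tpi t.
Proof.
split=> [h|/eqquotP/asboolP//].
by apply/eqquotP/asboolP.
Qed.

Lemma bsum_repr (U : lmodType k) (b : V -> W -> U) s :
  is_bilin b -> bsum b (trepr (tpi s)) = bsum b s.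
Proof. by move=> hb; apply/tpiP: U b hb; rewrite tpiK. Qed.

Definition tadd (x y : tensor) := tpi (trepr x ++ trepr y).
Definition tscale (c : k) (x : tensor) :=
  tpi [seq (c *: p.1, p.2) | p <- trepr x].

Lemma tens_eq (x y : tensor) : (forall (U : lmodType k) (b : V -> W -> U),
  is_bilin b -> bsum b (trepr x) = bsum b (trepr y)) -> x = y.
Proof. by move=> /tpiP; rewrite !tpiK. Qed.

Lemma bsum_add (U : lmodType k) (b : V -> W -> U) x y : is_bilin b ->
  bsum b (trepr (tadd x y)) = bsum b (trepr x) + bsum b (trepr y).
Proof. by move=> hb; rewrite bsum_repr // bsum_cat. Qed.

Lemma bsum_scale (U : lmodType k) (b : V -> W -> U) c x : is_bilin b ->
  bsum b (trepr (tscale c x)) = c *: bsum b (trepr x).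
Proof. by move=> hb; rewrite bsum_repr // bsumZ. Qed.

Lemma bsum_nil (U : lmodType k) (b : V -> W -> U) : is_bilin b ->
  bsum b (trepr (tpi [::])) = 0.
Proof. by move=> hb; rewrite bsum_repr // /bsum big_nil. Qed.

Fact taddA : associative tadd.
Proof. by move=> x y z; apply: tens_eq => U b hb; rewrite !bsum_add // addrA. Qed.
Fact taddC : commutative tadd.
Proof. by move=> x y; apply: tens_eq => U b hb; rewrite !bsum_add // addrC. Qed.
Fact tadd0 : left_id (tpi [::]) tadd.
Proof. by move=> x; apply: tens_eq => U b hb; rewrite bsum_add // bsum_nil // add0r. Qed.
Fact taddN : left_inverse (tpi [::]) (tscale (-1)) tadd.
Proof.
move=> x; apply: tens_eq => U b hb.
by rewrite bsum_add // bsum_nil // bsum_scale // scaleN1r addNr.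
Qed.

HB.instance Definition _ :=
  GRing.isZmodule.Build tensor taddA taddC tadd0 taddN.

Fact tscaleA c d x : tscale c (tscale d x) = tscale (c * d) x.
Proof. by apply: tens_eq => U b hb; rewrite !bsum_scale // scalerA. Qed.
Fact tscale1 : left_id 1 tscale.
Proof. by move=> x; apply: tens_eq => U b hb; rewrite bsum_scale // scale1r. Qed.
Fact tscaleDr : right_distributive tscale +%R.
Proof.
by move=> c x y; apply: tens_eq => U b hb; rewrite !(bsum_scale, bsum_add) // scalerDr.
Qed.
Fact tscaleDl x : {morph tscale^~ x : c d / c + d}.
Proof.
by move=> c d; apply: tens_eq => U b hb; rewrite !(bsum_scale, bsum_add) // scalerDl.
Qed.

HB.instance Definition _ :=
  GRing.Zmodule_isLmodule.Build k tensor tscaleA tscale1 tscaleDr tscaleDl.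

Definition tens (v : V) (w : W) : tensor := tpi [:: (v, w)].

(* The map induced by b; it is meaningful when b is bilinear. *)
Definition tlift (U : lmodType k) (b : V -> W -> U) (x : tensor) : U :=
  bsum b (trepr x).

Section Lift.
Context (U : lmodType k) (b : V -> W -> U) (hb : is_bilin b).

Lemma tlift_tens v w : tlift b (tens v w) = b v w.
Proof. by rewrite /tlift bsum_repr // /bsum big_seq1. Qed.

Lemma tlift_linear : linear (tlift b).
Proof. by move=> c x y; rewrite /tlift bsum_add // bsum_scale. Qed.

End Lift.

Lemma tens_bilin : is_bilin tens.
Proof.
split=> [w c v v'|v c w w']; apply: tens_eq => U b hb; rewrite bsum_add // bsum_scale //.
  rewrite !bsum_repr // /bsum !big_seq1 /=.
  by case: hb => h _; rewrite (h w).
rewrite !bsum_repr // /bsum !big_seq1 /=.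
by case: hb => _ h; rewrite (h v).
Qed.

Lemma tens_span (x : tensor) : exists s : seq (V * W), x = bsum tens s.
Proof.
exists (trepr x); rewrite -[LHS]tpiK; elim: (trepr x) => [|p s ih].
  by rewrite /bsum big_nil.
rewrite /bsum big_cons -/(bsum _ _) -ih; apply: tens_eq => U b hb.
by rewrite bsum_add // !bsum_repr // /bsum big_cons big_seq1.
Qed.

Lemma tens_ext (U : lmodType k) (f g : tensor -> U) : linear f -> linear g ->
  (forall v w, f (tens v w) = g (tens v w)) -> f =1 g.
Proof.
move=> hf hg fg x; have [s ->] := tens_span x.
elim: s => [|p s ih]; first by rewrite /bsum big_nil !linear_fun0.
rewrite /bsum big_cons -/(bsum _ _) -[tens _ _]scale1r hf hg ih.
by rewrite fg.
Qed.

End Tensor.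

Notation "V ⊗ W" := (tensor V W) : type_scope.
Notation "v ⊗t w" := (tens v w) : ring_scope.

Section LinearFun.
Context (k : fieldType).

Lemma linear_comp (V W U : lmodType k) (f : W -> U) (g : V -> W) :
  linear f -> linear g -> linear (f \o g).
Proof. by move=> hf hg c x y; rewrite /= hg hf. Qed.

Lemma bsum_linear (V W U : lmodType k) (X : lmodType k)
    (b : X -> V -> W -> U) (s : seq (V * W)) :
  (forall v w, linear (fun x => b x v w)) -> linear (fun x => bsum (b x) s).
Proof.
move=> hb c x y; rewrite /bsum scaler_sumr -big_split /=.
by apply: eq_bigr => p _; rewrite hb.
Qed.

Lemma tens_linl (V W : lmodType k) (w : W) : linear (fun v : V => v ⊗t w).
Proof. by case: (tens_bilin V W) => h _; exact: h. Qed.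

Lemma tens_linr (V W : lmodType k) (v : V) : linear (fun w : W => v ⊗t w).
Proof. by case: (tens_bilin V W) => _ h; exact: h. Qed.

End LinearFun.

(* f ⊗ g, meaningful when f and g are linear. *)
Section TensorMap.
Context (k : fieldType) (V V' W W' : lmodType k).

Definition tmap (f : V -> V') (g : W -> W') : V ⊗ W -> V' ⊗ W' :=
  tlift (fun v w => f v ⊗t g w).

Section Linear.
Context (f : {linear V -> V'}) (g : {linear W -> W'}).

Lemma tmap_bilin : is_bilin (fun v w => f v ⊗t g w).
Proof.
split=> [w|v]; first exact: (linear_comp (tens_linl _) (@linearP _ _ _ _ f)).
exact: (linear_comp (tens_linr _) (@linearP _ _ _ _ g)).
Qed.

Lemma tmap_tens v w : tmap f g (v ⊗t w) = f v ⊗t g w.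
Proof. exact: tlift_tens tmap_bilin _ _. Qed.

Lemma tmap_linear : linear (tmap f g).
Proof. exact: tlift_linear tmap_bilin. Qed.

HB.instance Definition _ :=
  GRing.isLinear.Build k (V ⊗ W) (V' ⊗ W') _ (tmap f g) tmap_linear.

End Linear.
End TensorMap.

Section Assoc.
Context (k : fieldType) (U V W : lmodType k).

Definition tassoc : (U ⊗ V) ⊗ W -> U ⊗ (V ⊗ W) :=
  tlift (fun x w => tlift (fun u v => u ⊗t (v ⊗t w)) x).

Lemma tassoc_bilin0 (w : W) : is_bilin (fun (u : U) (v : V) => u ⊗t (v ⊗t w)).
Proof.
split=> [v|u]; first exact: tens_linl.
exact: (linear_comp (g := fun v => v ⊗t w) (tens_linr u) (tens_linl w)).
Qed.

Lemma tassoc_bilin :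
  is_bilin (fun (x : U ⊗ V) (w : W) => tlift (fun u v => u ⊗t (v ⊗t w)) x).
Proof.
split=> [w|x]; first exact: tlift_linear (tassoc_bilin0 w).
by apply: bsum_linear => u v; exact: (linear_comp (tens_linr _) (tens_linr _)).
Qed.

Lemma tassoc_tens u v w : tassoc (u ⊗t v ⊗t w) = u ⊗t (v ⊗t w).
Proof.
by rewrite /tassoc (tlift_tens tassoc_bilin) (tlift_tens (tassoc_bilin0 _)).
Qed.

Lemma tassoc_linear : linear tassoc.
Proof. exact: tlift_linear tassoc_bilin. Qed.

HB.instance Definition _ :=
  GRing.isLinear.Build k ((U ⊗ V) ⊗ W) (U ⊗ (V ⊗ W)) _ tassoc tassoc_linear.

End Assoc.

Section Unitors.
Context (k : fieldType) (V : lmodType k).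

Definition lunit : k^o ⊗ V -> V := tlift (fun (c : k^o) (v : V) => c *: v).
Definition runit : V ⊗ k^o -> V := tlift (fun (v : V) (c : k^o) => c *: v).

End Unitors.

(* Linear functionals separate points, so 1 ⊗ 1 <> 0. *)
Section Functional.
Context (k : fieldType) (V : lmodType k) (v0 : V).

Let subsp (S : set V) := forall c x y, S x -> S y -> S (c *: x + y).
Let good (S : set V) := subsp S /\ ~ S v0.

Lemma exists_functional : v0 != 0 -> exists f : V -> k^o, linear f /\ f v0 = 1.
Proof.
move=> v0N0.
have [|M [[Msub Mv0] Mmax]] := @Zorn_bigcup _ good.
  move=> F FG Ftot; split; last by move=> [X FX Xv0]; case: (FG X FX).
  move=> c x y [X FX Xx] [Y FY Yy].
  case: (Ftot X Y FX FY) => sXY.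
    by exists Y => //; apply: (proj1 (FG Y FY)) => //; apply: sXY.
  by exists X => //; apply: (proj1 (FG X FX)) => //; apply: sXY.
have M0 : M 0.
  apply: contrapT => nM0; apply: (Mmax [set 0]).
    have Mempty x : ~ M x.
      by move=> Mx; apply: nM0; have := Msub (-1) x x Mx Mx; rewrite scaleN1r addNr.
    by split=> [x /Mempty|/(_ 0 erefl)].
  split=> [c x y -> ->|v00]; first by rewrite scaler0 addr0.
  by move/eqP: v0N0; apply.
have MZ c x : M x -> M (c *: x) by move=> Mx; rewrite -[_ *: _]addr0; exact: Msub.
have MD x y : M x -> M y -> M (x + y) by move=> Mx My; rewrite -[x]scale1r; exact: Msub.
have ex x : exists c, M (x - c *: v0).
  case: (pselect (M x)) => [Mx|nMx]; first by exists 0; rewrite scale0r subr0.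
  pose N : set V := [set y | exists m c, M m /\ y = m + c *: x].
  have [m [c [Mm v0E]]] : N v0.
    apply: contrapT => nNv0; apply: (Mmax N).
      split=> [y My|sNM]; first by exists y, 0; rewrite scale0r addr0.
      by apply: nMx; apply: sNM; exists 0, 1; rewrite scale1r add0r.
    split=> // d y z [m1 [c1 [Mm1 ->]]] [m2 [c2 [Mm2 ->]]].
    exists (d *: m1 + m2), (d * c1 + c2); split; first exact: Msub.
    by rewrite scalerDr scalerA scalerDl addrACA.
  have cN0 : c != 0.
    by apply/eqP => c0; apply: Mv0; rewrite v0E c0 scale0r addr0.
  exists c^-1; rewrite v0E scalerDr scalerA mulVf // scale1r opprD addrC subrK.
  by rewrite -scaleN1r; apply/MZ/MZ.
have uniqc c d x : M (x - c *: v0) -> M (x - d *: v0) -> c = d.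
  move=> Mc Md; apply: contrapT => /eqP ncd; apply: Mv0.
  have -> : v0 = (d - c)^-1 *: ((-1) *: (x - d *: v0) + (x - c *: v0)).
    rewrite scaleN1r opprB addrA subrK -scalerBl scalerA mulVf ?scale1r //.
    by rewrite subr_eq0 eq_sym.
  by apply: MZ; exact: Msub.
pose f x := sval (cid (ex x)); have fP x : M (x - f x *: v0) := svalP (cid (ex x)).
exists f; split.
  move=> c x y; apply: (uniqc _ _ _ (fP _)).
  have -> : c *: (f x : k^o) + f y = c * f x + f y by [].
  rewrite scalerDl -scalerA opprD addrACA.
  by rewrite -scalerBr; exact: Msub.
by apply: (uniqc _ _ _ (fP _)); rewrite scale1r subrr.
Qed.

End Functional.

Lemma tens_neq0 (k : fieldType) (V W : lmodType k) (v : V) (w : W) :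
  v != 0 -> w != 0 -> v ⊗t w != 0.
Proof.
move=> /exists_functional[f [hf fv]] /exists_functional[g [hg gw]].
have hb : is_bilin (fun x y => f x * g y : k^o).
  split=> [y c x x'|x c y y'].
    by rewrite /= hf mulrDl -mulrA.
  by rewrite /= hg mulrDr mulrCA.
apply/eqP => h; have := tlift_tens hb v w.
rewrite h (linear_fun0 (tlift_linear hb)) fv gw mulr1 => /eqP.
by rewrite eq_sym oner_eq0.
Qed.

Section TensorAlgebra.
Context (k : fieldType) (A B : algType k).

Definition tmul (x y : A ⊗ B) : A ⊗ B :=
  tlift (fun a b => tlift (fun a' b' => (a * a') ⊗t (b * b')) y) x.

Lemma mull_linear (C : algType k) (c : C) : linear (fun a => a * c).
Proof. by move=> d x y; rewrite mulrDl scalerAl. Qed.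
Lemma mulr_linear (C : algType k) (c : C) : linear (fun a => c * a).
Proof. by move=> d x y; rewrite mulrDr scalerAr. Qed.

Lemma tmul_bilin1 (a : A) (b : B) :
  is_bilin (fun (a' : A) (b' : B) => (a * a') ⊗t (b * b')).
Proof.
split=> [b'|a'].
  exact: (linear_comp (f := fun x => x ⊗t (b * b')) (tens_linl (b * b')) (mulr_linear a)).
exact: (linear_comp (tens_linr (a * a')) (mulr_linear b)).
Qed.

Lemma tmul_bilin2 (y : A ⊗ B) :
  is_bilin (fun a b => tlift (fun a' b' => (a * a') ⊗t (b * b')) y).
Proof.
split=> [b|a]; apply: bsum_linear => a' b'.
  exact: (linear_comp (f := fun x => x ⊗t (b * b')) (tens_linl (b * b')) (mull_linear a')).
exact: (linear_comp (tens_linr (a * a')) (mull_linear b')).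
Qed.

Lemma tmul_tens (a : A) (b : B) (a' : A) (b' : B) :
  tmul (a ⊗t b) (a' ⊗t b') = (a * a') ⊗t (b * b').
Proof.
by rewrite /tmul (tlift_tens (tmul_bilin2 _)) (tlift_tens (tmul_bilin1 _ _)).
Qed.

Lemma tmul_linl y : linear (tmul^~ y).
Proof. exact: tlift_linear (tmul_bilin2 y). Qed.

Lemma tmul_linr x : linear (tmul x).
Proof.
by apply: bsum_linear => a b; exact: tlift_linear (tmul_bilin1 a b).
Qed.

Fact tmulA : associative tmul.
Proof.
move=> x y z; move: x.
apply: tens_ext => [||a b].
- exact: tmul_linl.
- exact: (linear_comp (tmul_linl _) (tmul_linl _)).
move: y; apply: tens_ext => [||a' b'].
- exact: (linear_comp (tmul_linr _) (tmul_linl _)).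
- exact: (linear_comp (f := tmul^~ z) (tmul_linl _) (tmul_linr _)).
move: z; apply: tens_ext => [||a'' b''].
- exact: (linear_comp (tmul_linr _) (tmul_linr _)).
- exact: tmul_linr.
by rewrite !tmul_tens !mulrA.
Qed.

Fact tmul1l : left_id (1 ⊗t 1) tmul.
Proof.
apply: tens_ext => [||a b]; [exact: tmul_linr|by []|].
by rewrite tmul_tens !mul1r.
Qed.

Fact tmul1r : right_id (1 ⊗t 1) tmul.
Proof.
apply: tens_ext => [||a b]; [exact: tmul_linl|by []|].
by rewrite tmul_tens !mulr1.
Qed.

Fact tmulDl : left_distributive tmul +%R.
Proof. by move=> x y z; have := tmul_linl z 1 x y; rewrite /= !scale1r. Qed.

Fact tmulDr : right_distributive tmul +%R.
Proof. by move=> x y z; have := tmul_linr x 1 y z; rewrite !scale1r. Qed.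

Fact tone_neq0 : (1 : A) ⊗t (1 : B) != 0.
Proof. by apply: tens_neq0; exact: oner_neq0. Qed.

HB.instance Definition _ := GRing.Zmodule_isNzRing.Build (A ⊗ B)
  tmulA tmul1l tmul1r tmulDl tmulDr tone_neq0.

Fact tmulZl (c : k) (x y : A ⊗ B) : c *: (x * y) = (c *: x) * y.
Proof.
have := tmul_linl y c x 0; rewrite /= addr0 => h.
by rewrite -[RHS]/(tmul _ _) h (linear_fun0 (tmul_linl y)) addr0.
Qed.

Fact tmulZr (c : k) (x y : A ⊗ B) : c *: (x * y) = x * (c *: y).
Proof.
have := tmul_linr x c y 0; rewrite addr0 => h.
by rewrite -[RHS]/(tmul _ _) h (linear_fun0 (tmul_linr x)) addr0.
Qed.

HB.instance Definition _ := GRing.Lmodule_isLalgebra.Build k (A ⊗ B) tmulZl.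
HB.instance Definition _ := GRing.Lalgebra_isAlgebra.Build k (A ⊗ B) tmulZr.

End TensorAlgebra.

Definition mulT (k : fieldType) (A : algType k) : A ⊗ A -> A :=
  tlift (fun a b => a * b).

Lemma tens_mulE (k : fieldType) (A B : algType k) (a a' : A) (b b' : B) :
  (a ⊗t b) * (a' ⊗t b') = (a * a') ⊗t (b * b').
Proof. exact: tmul_tens. Qed.

Lemma tens_monoid_morphism (k : fieldType) (A B C : algType k)
    (F : {linear A ⊗ B -> C}) :
  F (1 ⊗t 1) = 1 ->
  (forall a b a' b', F ((a * a') ⊗t (b * b')) = F (a ⊗t b) * F (a' ⊗t b')) ->
  monoid_morphism F.
Proof.
move=> F1 FM; split=> // x y; move: x; apply: tens_ext => [||a b].
- exact: (linear_comp (f := F) (@linearP _ _ _ _ F) (mull_linear y)).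
- exact: (linear_comp (f := fun c => c * F y) (mull_linear (F y)) (@linearP _ _ _ _ F)).
move: y; apply: tens_ext => [||a' b'].
- exact: (linear_comp (f := F) (@linearP _ _ _ _ F) (mulr_linear _)).
- exact: (linear_comp (mulr_linear _) (@linearP _ _ _ _ F)).
by rewrite tens_mulE FM.
Qed.

Section TensorMorphisms.
Context (k : fieldType) (A A' B B' C : algType k).

Lemma tmap_monoid_morphism (f : {lrmorphism A -> A'}) (g : {lrmorphism B -> B'}) :
  monoid_morphism (tmap f g).
Proof.
apply: tens_monoid_morphism => [|a b a' b']; first by rewrite /= tmap_tens !rmorph1.
by rewrite /= !tmap_tens tens_mulE !rmorphM.
Qed.

Lemma tassoc_monoid_morphism : monoid_morphism (@tassoc k A B C).
Proof.
split=> [|x z]; first exact: tassoc_tens.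
have L : linear (@tassoc k A B C) := @tassoc_linear k A B C.
move: x; apply: tens_ext => [||x c].
- exact: (linear_comp L (mull_linear z)).
- exact: (linear_comp (mull_linear _) L).
move: z; apply: tens_ext => [||z c'].
- exact: (linear_comp L (mulr_linear _)).
- exact: (linear_comp (mulr_linear _) L).
have T (w : C) : linear (fun v : A ⊗ B => v ⊗t w) := tens_linl w.
rewrite tens_mulE; move: x; apply: tens_ext => [||a b].
- exact: (linear_comp L (linear_comp (T _) (mull_linear z))).
- exact: (linear_comp (mull_linear _) (linear_comp L (T c))).
move: z; apply: tens_ext => [||a' b'].
- exact: (linear_comp L (linear_comp (T _) (mulr_linear _))).
- exact: (linear_comp (mulr_linear _) (linear_comp L (T c'))).
by rewrite tens_mulE !tassoc_tens !tens_mulE.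
Qed.

End TensorMorphisms.

(* A falgType is a finite-dimensional algebra. *)
Record hopf (k : fieldType) (H : falgType k) := Hopf {
  comul : {lrmorphism H -> H ⊗ H};
  counit : {lrmorphism H -> k^o};
  antipode : {linear H -> H};
  comul_assoc : forall h,
    tassoc (tmap comul idfun (comul h)) = tmap idfun comul (comul h);
  comul_counitl : forall h, lunit (tmap counit idfun (comul h)) = h;
  comul_counitr : forall h, runit (tmap idfun counit (comul h)) = h;
  antipodel : forall h, mulT (tmap antipode idfun (comul h)) = (counit h)%:A;
  antipoder : forall h, mulT (tmap idfun antipode (comul h)) = (counit h)%:A
}.

Section Comodules.
Context (k : fieldType) (H : falgType k) (HH : hopf H).

(* A comodule algebra is an algebra whose coaction is an algebra morphism:  *)
(* this says exactly that its multiplication and unit are colinear, the     *)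
(* tensor square carrying the diagonal coaction.                            *)
Definition right_comodule_algebra (A : algType k)
    (rho : {lrmorphism A -> A ⊗ H}) : Prop :=
  (forall a, tassoc (tmap rho idfun (rho a)) = tmap idfun (comul HH) (rho a)) /\
  (forall a, runit (tmap idfun (counit HH) (rho a)) = a).

Definition left_comodule_algebra (T : algType k)
    (rho : {lrmorphism T -> H ⊗ T}) : Prop :=
  (forall t, tassoc (tmap (comul HH) idfun (rho t)) = tmap idfun rho (rho t)) /\
  (forall t, lunit (tmap (counit HH) idfun (rho t)) = t).

Record left_torsor (T : algType k) (rho : {lrmorphism T -> H ⊗ T}) : Prop := {
  torsor_comodule : left_comodule_algebra rho;
  torsor_iso : exists f : {linear T -> H},
    bijective f /\ forall t, tmap idfun f (rho t) = comul HH (f t);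
  torsor_coinv : forall t, rho t = 1 ⊗t t <-> exists c : k, t = c%:A;
  torsor_can : bijective (fun x : T ⊗ T =>
    tmap idfun (@mulT k T) (tassoc (tmap rho idfun x)))
}.

End Comodules.

(* tilde rhoA rhoT is the algebra Ã; tassoc identifies (A ⊗ H) ⊗ T with     *)
(* A ⊗ (H ⊗ T).                                                            *)
Section Tilde.
Context (k : fieldType) (H A T : algType k).
Context (rhoA : {lrmorphism A -> A ⊗ H}) (rhoT : {lrmorphism T -> H ⊗ T}).

Definition in_tilde : {pred A ⊗ T} := fun x =>
  tassoc (tmap rhoA idfun x) == tmap idfun rhoT x.

Fact in_tilde_subalg : subalg_closed in_tilde.
Proof.
have [a1 aM] := tassoc_monoid_morphism A H T.
have [l1 lM] := @tmap_monoid_morphism k A (A ⊗ H)%type T T rhoA idfun.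
have [r1 rM] := @tmap_monoid_morphism k A A T (H ⊗ T)%type idfun rhoT.
split=> [|c x y|x y]; rewrite !unfold_in.
- by rewrite l1 a1 r1.
- move=> /eqP hx /eqP hy; apply/eqP.
  have -> := @tmap_linear k A (A ⊗ H)%type T T rhoA idfun c x y.
  by rewrite tassoc_linear hx hy tmap_linear.
- by move=> /eqP hx /eqP hy; rewrite lM aM hx hy rM.
Qed.

HB.instance Definition _ :=
  GRing.isSubalgClosed.Build k (A ⊗ T)%type in_tilde in_tilde_subalg.

Record tilde : Type := Tilde { tilde_val : A ⊗ T; _ : tilde_val \in in_tilde }.

HB.instance Definition _ := [isSub for tilde_val].
HB.instance Definition _ := [Choice of tilde by <:].
HB.instance Definition _ := [SubChoice_isSubAlgebra of tilde by <:].

End Tilde.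

(* Modules are left modules; right A-modules are modules over A^c. *)

Section ConverseAlgebra.
Context (k : fieldType) (A : algType k).

HB.instance Definition _ := GRing.Lmodule.copy A^c A.

Fact converse_scalerAl (c : k) (x y : A^c) : c *: (x * y) = @GRing.mul A^c (c *: x) y.
Proof. exact: (@scalerAr k A c y x). Qed.
HB.instance Definition _ := GRing.Lmodule_isLalgebra.Build k A^c converse_scalerAl.

Fact converse_scalerAr (c : k) (x y : A^c) : c *: (x * y) = @GRing.mul A^c x (c *: y).
Proof. exact: (@scalerAl k A c y x). Qed.
HB.instance Definition _ := GRing.Lalgebra_isAlgebra.Build k A^c converse_scalerAr.

End ConverseAlgebra.

(* V is the (internal) direct sum of the additive subgroups gr i. *)
Record direct_sum (I : eqType) (V : zmodType) (gr : I -> set V) : Prop := {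
  direct_sum0 : forall i, gr i 0;
  direct_sumB : forall i x y, gr i x -> gr i y -> gr i (x - y);
  direct_sum_span : forall x, exists (s : seq I) (c : I -> V),
    (forall i, gr i (c i)) /\ x = \sum_(i <- s) c i;
  direct_sum_free : forall (s : seq I) (c : I -> V), uniq s ->
    (forall i, gr i (c i)) -> \sum_(i <- s) c i = 0 -> forall i, i \in s -> c i = 0
}.

Record connected_graded (k : fieldType) (A : algType k) (gr : nat -> set A)
    : Prop := {
  cgr_sum : direct_sum gr;
  cgr_scale : forall i (c : k) a, gr i a -> gr i (c *: a);
  cgr_mul : forall i j a b, gr i a -> gr j b -> gr (i + j)%N (a * b);
  cgr_conn : forall a, gr 0%N a <-> exists c : k, a = c%:A
}.

Definition left_noetherian (R : nzRingType) : Prop :=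
  forall I : nat -> set R,
    (forall n, I n 0 /\ (forall a x y, I n x -> I n y -> I n (a * x + y))) ->
    (forall n, I n `<=` I n.+1) ->
    exists n, forall m, (n <= m)%N -> I m = I n.

Definition noetherian (R : nzRingType) : Prop :=
  left_noetherian R /\ left_noetherian R^c.

Definition exact_at (M1 : Type) (M2 M3 : zmodType) (f : M1 -> M2) (g : M2 -> M3)
    : Prop :=
  forall y, g y = 0 <-> exists x, f x = y.

Definition surjective_fun (S S' : Type) (f : S -> S') : Prop :=
  forall y, exists x, f x = y.

Section GradedModules.
Context (k : fieldType) (A : algType k) (gr : nat -> set A).

Record graded_module (M : lmodType A) (gM : int -> set M) : Prop := {
  gmod_sum : direct_sum gM;
  gmod_act : forall (i : nat) j a x, gr i a -> gM j x -> gM (i%:Z + j) (a *: x)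
}.

(* The elements of Hom(M, N(e)), the shift being N(e)_j = N_(e + j). *)
Definition graded_hom (M N : lmodType A) (gM : int -> set M) (gN : int -> set N)
    (e : int) (f : M -> N) : Prop :=
  linear f /\ forall j x, gM j x -> gN (e + j) (f x).

Definition graded_projective (P : lmodType A) (gP : int -> set P) : Prop :=
  graded_module gP /\
  forall (M N : lmodType A) (gM : int -> set M) (gN : int -> set N)
      (g : M -> N) (f : P -> N),
    graded_module gM -> graded_module gN ->
    graded_hom gM gN 0 g -> surjective_fun g -> graded_hom gP gN 0 f ->
    exists h : P -> M, graded_hom gP gM 0 h /\ forall x, g (h x) = f x.

Definition graded_injective (E : lmodType A) (gE : int -> set E) : Prop :=
  graded_module gE /\
  forall (M N : lmodType A) (gM : int -> set M) (gN : int -> set N)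
      (g : M -> N) (f : M -> E),
    graded_module gM -> graded_module gN ->
    graded_hom gM gN 0 g -> injective g -> graded_hom gM gE 0 f ->
    exists h : N -> E, graded_hom gN gE 0 h /\ forall x, h (g x) = f x.

(* ... -> P_2 -> P_1 -> P_0 -> M -> 0 *)
Record graded_projective_resolution (M : lmodType A) (gM : int -> set M)
    (P : nat -> lmodType A) (gP : forall i, int -> set (P i))
    (d : forall i, P i.+1 -> P i) (aug : P 0%N -> M) : Prop := {
  gpr_proj : forall i, graded_projective (gP i);
  gpr_d : forall i, graded_hom (gP i.+1) (gP i) 0 (d i);
  gpr_aug : graded_hom (gP 0%N) gM 0 aug;
  gpr_surj : surjective_fun aug;
  gpr_exact0 : exact_at (d 0%N) aug;
  gpr_exact : forall i, exact_at (d i.+1) (d i)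
}.

(* 0 -> M -> E_0 -> E_1 -> E_2 -> ... *)
Record graded_injective_resolution (M : lmodType A) (gM : int -> set M)
    (E : nat -> lmodType A) (gE : forall i, int -> set (E i))
    (d : forall i, E i -> E i.+1) (coaug : M -> E 0%N) : Prop := {
  gir_inj : forall i, graded_injective (gE i);
  gir_d : forall i, graded_hom (gE i) (gE i.+1) 0 (d i);
  gir_coaug : graded_hom gM (gE 0%N) 0 coaug;
  gir_mono : injective coaug;
  gir_exact0 : exact_at coaug (d 0%N);
  gir_exact : forall i, exact_at (d i) (d i.+1)
}.

Definition graded_inj_dim_le (M : lmodType A) (gM : int -> set M) (n : nat)
    : Prop :=
  exists (E : nat -> lmodType A) (gE : forall i, int -> set (E i))
      (d : forall i, E i -> E i.+1) (coaug : M -> E 0%N),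
    graded_injective_resolution gM gE d coaug /\
    forall i, (n < i)%N -> forall x : E i, x = 0.

Definition graded_inj_dim (M : lmodType A) (gM : int -> set M) (n : nat) : Prop :=
  graded_inj_dim_le gM n /\ forall m, graded_inj_dim_le gM m -> (n <= m)%N.

Definition regular_gr (j : int) : set A^o :=
  match j with Posz n => gr n | Negz _ => [set 0] end.

End GradedModules.

(* The vector space k on which A acts through the algebra morphism eps. *)
Section TrivialModule.
Context (k : fieldType) (A : algType k).

Definition triv_mod (eps : {lrmorphism A -> k^o}) : Type := k.

Context (eps : {lrmorphism A -> k^o}).
HB.instance Definition _ := GRing.Zmodule.copy (triv_mod eps) k.

Definition triv_scale (a : A) (x : triv_mod eps) : triv_mod eps :=
  (eps a : k) * (x : k).
Fact triv_scaleA a b x : triv_scale a (triv_scale b x) = triv_scale (a * b) x.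
Proof. by rewrite /triv_scale rmorphM mulrA. Qed.
Fact triv_scale1 : left_id 1 triv_scale.
Proof. by move=> x; rewrite /triv_scale rmorph1 mul1r. Qed.
Fact triv_scaleDr : right_distributive triv_scale +%R.
Proof. by move=> a x y; rewrite /triv_scale -mulrDr. Qed.
Fact triv_scaleDl x : {morph triv_scale^~ x : a b / a + b}.
Proof. by move=> a b; rewrite /triv_scale raddfD mulrDl. Qed.

HB.instance Definition _ := GRing.Zmodule_isLmodule.Build A (triv_mod eps)
  triv_scaleA triv_scale1 triv_scaleDr triv_scaleDl.

Definition triv_gr (j : int) : set (triv_mod eps) :=
  [set x | j = 0 \/ x = 0].

End TrivialModule.

(* W is isomorphic to the quotient of the subspace Z of V by its subspace B. *)
Definition subquotient_iso (k : fieldType) (V W : lmodType k) (Z B : set V)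
    : Prop :=
  exists phi : V -> W,
    [/\ forall c x y, Z x -> Z y -> phi (c *: x + y) = c *: phi x + phi y,
        forall w, exists x, Z x /\ phi x = w
      & forall x, Z x -> (phi x = 0 <-> B x)].

Section ASconditions.
Context (k : fieldType) (A : algType k) (gr : nat -> set A).

(* Cocycles and coboundaries in degree e of the complex Hom_A(P_i, A), whose *)
(* terms are subspaces of the k-vector spaces of functions P_i -> A.         *)
Definition cocycle (P : nat -> lmodType A) (gP : forall i, int -> set (P i))
    (d : forall i, P i.+1 -> P i) (i : nat) (e : int) : set (P i -> A) :=
  [set f | graded_hom (N := A^o) (gP i) (regular_gr gr) e f /\
           forall x, f (d i x) = 0].

Definition coboundary (P : nat -> lmodType A) (gP : forall i, int -> set (P i))
    (d : forall i, P i.+1 -> P i) (i : nat) (e : int) : set (P i -> A) :=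
  match i return set (P i -> A) with
  | 0 => [set 0]
  | i'.+1 => [set f | exists g : P i' -> A,
      graded_hom (N := A^o) (gP i') (regular_gr gr) e g /\
      forall x, f x = g (d i' x)]
  end.

Arguments cocycle {P} gP d i e f.
Arguments coboundary {P} gP d i e f.

(* Ext^i_A(k, A) is 0 for i <> d and k(l) for i = d, computed degree by     *)
(* degree on a graded projective resolution of k.  A acts on k through its   *)
(* augmentation; k(l) is k placed in degree - l, and 'rV[k]_b is k or 0      *)
(* according to the boolean b.                                               *)
Definition Ext_k_A_concentrated (d : nat) (l : int) : Prop :=
  exists eps : {lrmorphism A -> k^o},
    (forall i a, (0 < i)%N -> gr i a -> eps a = 0) /\
    exists (P : nat -> lmodType A) (gP : forall i, int -> set (P i))
        (dP : forall i, P i.+1 -> P i) (aug : P 0%N -> triv_mod eps),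
      graded_projective_resolution gr (@triv_gr k A eps) gP dP aug /\
      forall i e,
        subquotient_iso 'rV[k]_((i == d) && (e + l == 0))
          (cocycle gP dP i e) (coboundary gP dP i e).

End ASconditions.

Section GlobalDimension.
Context (R : nzRingType).

Definition projective_module (P : lmodType R) : Prop :=
  forall (M N : lmodType R) (g : {linear M -> N}) (f : {linear P -> N}),
    surjective_fun g -> exists h : {linear P -> M}, forall x, g (h x) = f x.

Definition proj_dim_le (M : lmodType R) (n : nat) : Prop :=
  exists (P : nat -> lmodType R) (d : forall i, {linear P i.+1 -> P i})
      (aug : {linear P 0%N -> M}),
    [/\ forall i, projective_module (P i), surjective_fun aug,
        exact_at (d 0%N) aug, forall i, exact_at (d i.+1) (d i)
      & forall i, (n < i)%N -> forall x : P i, x = 0].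

Definition left_global_dim (n : nat) : Prop :=
  (forall M, proj_dim_le M n) /\
  forall m, (forall M, proj_dim_le M m) -> (n <= m)%N.

End GlobalDimension.

Section ASregular.
Context (k : fieldType) (A : algType k) (gr : nat -> set A) (d : nat).

Record AS_Gorenstein : Prop := {
  ASG_connected : connected_graded gr;
  ASG_left_inj_dim : graded_inj_dim gr (@regular_gr k A gr) d;
  ASG_right_inj_dim : graded_inj_dim (A := A^c) gr (@regular_gr k A^c gr) d;
  ASG_Ext : exists l : int,
    Ext_k_A_concentrated gr d l /\ Ext_k_A_concentrated (A := A^c) gr d l
}.

Record AS_regular : Prop := {
  ASR_Gorenstein : AS_Gorenstein;
  ASR_left_global_dim : left_global_dim A d;
  ASR_right_global_dim : left_global_dim A^c d
}.

End ASregular.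

(* The subspace X ⊗ W of V ⊗ W, for a subspace X of V. *)
Definition tens_sub (k : fieldType) (V W : lmodType k) (X : set V)
    : set (V ⊗ W) :=
  [set x | exists s : seq (V * W),
     (forall p, p \in s -> X p.1) /\ x = \sum_(p <- s) p.1 ⊗t p.2].

Record connected_graded_comodule_algebra (k : fieldType) (H : falgType k)
    (HH : hopf H) (A : algType k) (gr : nat -> set A)
    (rho : {lrmorphism A -> A ⊗ H}) : Prop := {
  cgca_graded : connected_graded gr;
  cgca_comodule : right_comodule_algebra HH rho;
  cgca_subcomodule : forall i a, gr i a -> tens_sub (gr i) (rho a)
}.

Definition tilde_gr (k : fieldType) (H A T : algType k)
    (rhoA : {lrmorphism A -> A ⊗ H}) (rhoT : {lrmorphism T -> H ⊗ T})
    (gr : nat -> set A) (i : nat) : set (tilde rhoA rhoT) :=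
  [set x | tens_sub (gr i) (tilde_val x)].

Arguments tilde_gr {k H A T} rhoA rhoT gr i x.

(* Main.v *)
(* Put B = A ⊗ T. Both A, embedded by a |-> a ⊗ 1, and Ã are subalgebras of B,
   and B is free over each of them, on the left and on the right, on the family
   1 ⊗ t_j for a basis t_j of T. For Ã this holds because the maps
   s ⊗ x |-> s_(-1) ⊗ s_(0) x and s ⊗ x |-> s_(-1) ⊗ x s_(0) from T ⊗ T to H ⊗ T
   are bijective (the second one because the antipode is).

   Homological information is carried from A to Ã by graded B-modules X. The
   coinduced module Hom_k(B, X) is injective over A, over Ã and over B, and the
   augmentation ideals of the three algebras kill the same elements of X; hence
   Ext_A(k, X) = Ext_Ã(k, X), both being computed by the coinduced resolution.
   Since Ext_A(k, B) = Ext_A(k, A)^n and Ext_Ã(k, B) = Ext_Ã(k, Ã)^n, taking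
   X = B gives the Ext condition for Ã. Taking X = B / B_+ gives
   Ext^(d+1)(V, X) = 0 for every trivial Ã-module V, so the minimal resolution
   of V stops at d. An arbitrary Ã-module M is a filtered deformation of the
   trivial module on the space M, and the minimal resolution deforms with it;
   hence M has projective dimension at most d. Therefore the d-th coinduced
   cosyzygy of Ã has no Ext^1 and is injective. Both dimensions are at least d
   because Ext^d(k, Ã) is not zero. Opposite algebras give the other side. *)

Require Import Defs.
From HB Require Import structures.
From mathcomp Require Import all_boot all_order all_algebra all_field.
From mathcomp Require Import all_classical.

Set Implicit Arguments.
Unset Strict Implicit.
Unset Printing Implicit Defensive.

Import GRing.Theory.
Local Open Scope ring_scope.
Local Open Scope classical_set_scope.

(** * Linear algebra *)

(** The obstacle is that global dimension concerns all modules, ungraded ones included, whereas a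
    general Ã-module has no counterpart over A. Only trivial modules compare: a map from such a
    module to X is a linear map into the elements of X killed by the positive part, a description in
    which the ring no longer appears. Filtered deformation leads back to all modules: M, placed
    entirely in filtration degree 0, has the trivial module on its underlying space as associated
    graded module. That space may have infinite dimension, so trivial modules on arbitrary spaces,
    and not only k, have to be compared. B / B_+ serves as coefficients because it is a nonzero
    B-module that stays trivial over Ã: homomorphisms into it detect the generators of a minimal
    resolution. The two kinds of freeness do different work. Freeness on the right makes coinduced
    modules injective; freeness on the left splits cohomology with values in B into n copies. The
    exponent n can be cancelled because the spaces in question have dimension at most one. *)

Section LinearFunctions.
Context (R : nzRingType).
Implicit Types M N L : lmodType R.

Lemma lin_add M N (f : M -> N) : linear f -> {morph f : x y / x + y}.
Proof. by move=> hf x y; rewrite -[x in LHS]scale1r hf scale1r. Qed.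

Lemma lin_scale M N (f : M -> N) a x : linear f -> f (a *: x) = a *: f x.
Proof. by move=> hf; rewrite -[_ *: x]addr0 hf (linear_fun0 hf) addr0. Qed.

Lemma lin_opp M N (f : M -> N) : linear f -> {morph f : x / - x}.
Proof. by move=> hf x; rewrite -!scaleN1r lin_scale. Qed.

Lemma lin_sub M N (f : M -> N) : linear f -> {morph f : x y / x - y}.
Proof. by move=> hf x y; rewrite lin_add // lin_opp. Qed.

Lemma lin_sum M N (f : M -> N) (I : Type) (r : seq I) (P : pred I) (F : I -> M) :
  linear f -> f (\sum_(i <- r | P i) F i) = \sum_(i <- r | P i) f (F i).
Proof. by move=> hf; apply: (big_morph f (lin_add hf)); apply: linear_fun0. Qed.

Lemma lin_id M : linear (@id M). Proof. by []. Qed.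

Lemma lin_comp M N L (f : N -> L) (g : M -> N) :
  linear f -> linear g -> linear (fun x => f (g x)).
Proof. by move=> hf hg a x y; rewrite hg hf. Qed.

Lemma lin_addf M N (f g : M -> N) :
  linear f -> linear g -> linear (fun x => f x + g x).
Proof. by move=> hf hg a x y; rewrite hf hg scalerDr addrACA. Qed.

Lemma lin_subf M N (f g : M -> N) :
  linear f -> linear g -> linear (fun x => f x - g x).
Proof. by move=> hf hg a x y; rewrite hf hg scalerBr opprD addrACA. Qed.

Lemma lin_zero M N : linear (fun _ : M => 0 : N).
Proof. by move=> a x y; rewrite scaler0 addr0. Qed.

Definition mklin M N (f : M -> N) (hf : linear f) : {linear M -> N} :=
  HB.pack f (GRing.isLinear.Build R M N _ f hf).

Lemma mklinE M N (f : M -> N) (hf : linear f) x : mklin hf x = f x.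
Proof. by []. Qed.

Lemma lin_inv M N (f : M -> N) (g : N -> M) :
  linear f -> cancel f g -> cancel g f -> linear g.
Proof. by move=> hf fK gK a x y; rewrite -{1}[x]gK -{1}[y]gK -hf fK. Qed.

End LinearFunctions.

Section Submodule.
Context (R : nzRingType) (M : lmodType R).

Definition submod (S : set M) : Prop :=
  S 0 /\ forall a x y, S x -> S y -> S (a *: x + y).

Section Closure.
Context (S : set M) (hS : submod S).

Lemma submod_scale a x : S x -> S (a *: x).
Proof. by case: hS => h0 h Sx; rewrite -[_ *: _]addr0; apply: h. Qed.

Lemma submod_add x y : S x -> S y -> S (x + y).
Proof. by case: hS => h0 h Sx Sy; rewrite -[x]scale1r; apply: h. Qed.

Lemma submod_opp x : S x -> S (- x).
Proof. by rewrite -scaleN1r; apply: submod_scale. Qed.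

Lemma submod_sub x y : S x -> S y -> S (x - y).
Proof. by move=> Sx Sy; apply/submod_add/submod_opp. Qed.

End Closure.

(** The proof [hS] is an argument so that the closure instance below can be attached to the
    predicate itself. *)
Definition in_smod (S : set M) (hS : submod S) : {pred M} := fun x => `[< S x >].

Context (S : set M) (hS : submod S).

Fact in_smod_closed : submod_closed (in_smod hS).
Proof.
case: hS => h0 h; split; first exact/asboolP.
by move=> a x y /asboolP Sx /asboolP Sy; apply/asboolP/h.
Qed.

HB.instance Definition _ :=
  GRing.isSubmodClosed.Build R M (in_smod hS) in_smod_closed.

Record smod : Type := Smod { smval : M; _ : smval \in in_smod hS }.

HB.instance Definition _ := [isSub for smval].
HB.instance Definition _ := [Choice of smod by <:].
HB.instance Definition _ := [SubChoice_isSubLmodule of smod by <:].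

Lemma smvalP (x : smod) : S (smval x).
Proof. by case: x => x /= /asboolP. Qed.

Definition smk (x : M) (Sx : S x) : smod := Smod (asboolT Sx : _ \in in_smod hS).

Lemma smval_inj : injective smval. Proof. exact: val_inj. Qed.

Lemma smval_linear : linear smval. Proof. by move=> a x y; reflexivity. Qed.

End Submodule.

Lemma submod_ker (R : nzRingType) (M N : lmodType R) (f : M -> N) :
  linear f -> submod [set x | f x = 0].
Proof.
move=> hf; split=> /=; first exact: linear_fun0.
by move=> a x y fx fy; rewrite hf fx fy scaler0 addr0.
Qed.

Lemma submod_im (R : nzRingType) (M N : lmodType R) (f : M -> N) :
  linear f -> submod (range f).
Proof.
move=> hf; split; first by exists 0 => //; exact: linear_fun0.
by move=> a _ _ [x _ <-] [y _ <-]; exists (a *: x + y) => //; apply: hf.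
Qed.

Lemma smod_lift (R : nzRingType) (M N : lmodType R) (S : set N)
    (hS : submod S) (f : M -> N) : linear f -> (forall x, S (f x)) ->
  exists g : M -> smod hS, linear g /\ forall x, smval (g x) = f x.
Proof.
move=> hf Sf; exists (fun x => smk hS (Sf x)); split=> // a x y.
by apply: smval_inj; rewrite /= hf.
Qed.

(** * Restriction of scalars *)

Section Restriction.
Context (R S : nzRingType).

(** The carrier is M itself and the morphism a phantom argument, so that one function or one grading
    serves, by conversion, for M and for all its restrictions. *)
Definition restr (_ : {rmorphism R -> S}) (M : lmodType S) : Type := M.

Context (phi : {rmorphism R -> S}) (M : lmodType S).
HB.instance Definition _ := GRing.Zmodule.copy (restr phi M) M.

Definition restr_scale (a : R) (x : restr phi M) : restr phi M := phi a *: (x : M).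
Fact restr_scaleA a b x : restr_scale a (restr_scale b x) = restr_scale (a * b) x.
Proof. by rewrite /restr_scale scalerA rmorphM. Qed.
Fact restr_scale1 : left_id 1 restr_scale.
Proof. by move=> x; rewrite /restr_scale rmorph1 scale1r. Qed.
Fact restr_scaleDr : right_distributive restr_scale +%R.
Proof. by move=> a x y; rewrite /restr_scale scalerDr. Qed.
Fact restr_scaleDl x : {morph restr_scale^~ x : a b / a + b}.
Proof. by move=> a b; rewrite /restr_scale rmorphD scalerDl. Qed.
HB.instance Definition _ := GRing.Zmodule_isLmodule.Build R (restr phi M)
  restr_scaleA restr_scale1 restr_scaleDr restr_scaleDl.

Lemma restrE (a : R) (x : restr phi M) : a *: x = phi a *: (x : M) :> M.
Proof. by []. Qed.

End Restriction.

(** The vector space underlying a module over a k-algebra: such a module carries no k-structure of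
    its own, and c acts as [c%:A]. *)
Notation kres M := (restr (GRing.in_alg _) M).

Lemma restr_linear (R S : nzRingType) (phi : {rmorphism R -> S})
    (M N : lmodType S) (f : M -> N) :
  linear f -> linear (f : restr phi M -> restr phi N).
Proof. by move=> hf a x y; rewrite !restrE; apply: hf. Qed.

(* The quotient of M by the kernel of e, realised on the image of e. *)
Section Quotient.
Context (R : nzRingType) (M : lmodType R).

(** Only the kernel of [e] is a submodule. Its image is a mere additive complement, on which a
    scalar acts by acting in M and projecting back; [e] itself need not be R-linear. *)
Record quotient_proj (e : M -> M) : Prop := {
  qproj_add : {morph e : x y / x + y};
  qproj_idem : forall x, e (e x) = e x;
  qproj_ker : forall a x, e x = 0 -> e (a *: x) = 0
}.

Context (e : M -> M) (he : quotient_proj e).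

Lemma qproj0 : e 0 = 0.
Proof. by apply: (@addrI _ (e 0)); rewrite -(qproj_add he) !addr0. Qed.
Lemma qprojN : {morph e : x / - x}.
Proof.
by move=> x; apply/eqP; rewrite -addr_eq0 -(qproj_add he) addNr qproj0.
Qed.
Lemma qprojB : {morph e : x y / x - y}.
Proof. by move=> x y; rewrite (qproj_add he) qprojN. Qed.
Lemma qproj_scale a x : e (a *: e x) = e (a *: x).
Proof.
apply/eqP; rewrite -subr_eq0 -qprojB -scalerBr; apply/eqP/(qproj_ker he).
by rewrite qprojB (qproj_idem he) subrr.
Qed.

Definition in_qmod (_ : quotient_proj e) : {pred M} := fun x => e x == x.

Fact in_qmod_closed : zmod_closed (in_qmod he).
Proof.
split; first by rewrite unfold_in qproj0.
by move=> x y; rewrite !unfold_in qprojB => /eqP-> /eqP->.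
Qed.
HB.instance Definition _ :=
  GRing.isZmodClosed.Build M (in_qmod he) in_qmod_closed.

Record qmod : Type := Qmod { qval : M; _ : qval \in in_qmod he }.
HB.instance Definition _ := [isSub for qval].
HB.instance Definition _ := [Choice of qmod by <:].
HB.instance Definition _ := [SubChoice_isSubZmodule of qmod by <:].

Fact qpi_subproof x : e x \in in_qmod he.
Proof. by rewrite unfold_in (qproj_idem he). Qed.
Definition qpi (x : M) : qmod := Qmod (qpi_subproof x).

Lemma qvalE (x : qmod) : e (qval x) = qval x.
Proof. by case: x => x /= /eqP. Qed.

Lemma qval_inj : injective qval. Proof. exact: val_inj. Qed.

Lemma qvalK : cancel qval qpi.
Proof. by move=> x; apply: qval_inj; rewrite /= qvalE. Qed.

Definition qscale a (x : qmod) : qmod := qpi (a *: qval x).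
Fact qscaleA a b x : qscale a (qscale b x) = qscale (a * b) x.
Proof. by apply: qval_inj; rewrite /= qproj_scale scalerA. Qed.
Fact qscale1 : left_id 1 qscale.
Proof. by move=> x; rewrite /qscale scale1r qvalK. Qed.
Fact qscaleDr : right_distributive qscale +%R.
Proof.
by move=> a x y; apply: qval_inj; rewrite /= scalerDr (qproj_add he).
Qed.
Fact qscaleDl x : {morph qscale^~ x : a b / a + b}.
Proof.
by move=> a b; apply: qval_inj; rewrite /= scalerDl (qproj_add he).
Qed.
HB.instance Definition _ := GRing.Zmodule_isLmodule.Build R qmod
  qscaleA qscale1 qscaleDr qscaleDl.

Lemma qpi_linear : linear qpi.
Proof.
move=> a x y; apply: qval_inj; rewrite /= (qproj_add he).
by rewrite qproj_scale.
Qed.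

Lemma qpi_eq0 x : qpi x = 0 <-> e x = 0.
Proof.
by split=> [/(congr1 qval)//|ex0]; apply: qval_inj.
Qed.

End Quotient.

(** * Complements of subspaces *)

Section Projections.
Context (k : fieldType) (V : lmodType k).

(* Zorn's lemma, applied to the subspaces meeting S trivially. *)
Lemma subspace_proj (S : set V) : submod S ->
  exists e : V -> V,
    [/\ linear e, forall x, e x = 0 <-> S x & forall x, S (x - e x)].
Proof.
move=> hS.
(* Membership of 0 is left out of [good] because the union of the empty chain is empty; it is
   recovered for the maximal M by comparison with {0}. *)
pose good (M : set V) := (forall c x y, M x -> M y -> M (c *: x + y)) /\
  forall x, M x -> S x -> x = 0.
have [|M [[Msub MS] Mmax]] := @Zorn_bigcup _ good.
  move=> F FG Ftot; split; last by move=> x [X FX Xx] Sx; case: (FG X FX) => _; apply.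
  move=> c x y [X FX Xx] [Y FY Yy].
  case: (Ftot X Y FX FY) => sXY.
    by exists Y => //; apply: (proj1 (FG Y FY)) => //; apply: sXY.
  by exists X => //; apply: (proj1 (FG X FX)) => //; apply: sXY.
have M0 : M 0.
  apply: contrapT => nM0; apply: (Mmax [set 0]).
    have Mempty x : ~ M x.
      by move=> Mx; apply: nM0; have := Msub (-1) x x Mx Mx; rewrite scaleN1r addNr.
    by split=> [x /Mempty|/(_ 0 erefl)].
  by split=> [c x y -> ->|x -> //] /=; rewrite scaler0 addr0.
have Mm : submod M by [].
have ex x : exists m, M m /\ S (x - m).
  have [Mx|nMx] := pselect (M x).
    by exists x; rewrite subrr; split=> //; case: hS.
  pose N : set V := [set y | exists m c, M m /\ y = m + c *: x].
  (* By maximality M + kx contains a nonzero vector of S. Its coefficient at x cannot vanish, and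
     dividing by it places x in M + S. *)
  have [m [c [Mm1 [Sy y0]]]] : exists m c, M m /\ S (m + c *: x) /\ m + c *: x <> 0.
    apply: contrapT => nex; apply: (Mmax N).
      split=> [y My|sNM]; first by exists y, 0; rewrite scale0r addr0.
      by apply: nMx; apply: sNM; exists 0, 1; rewrite scale1r add0r.
    split=> [d y z [m1 [c1 [Mm1 ->]]] [m2 [c2 [Mm2 ->]]]|y [m [c [Mm1 ->]]] Sy].
      exists (d *: m1 + m2), (d * c1 + c2); split; first exact: Msub.
      by rewrite scalerDr scalerA scalerDl addrACA.
    by apply: contrapT => y0; apply: nex; exists m, c.
  have cN0 : c != 0.
    apply/eqP => c0; apply: y0; move: Sy; rewrite c0 scale0r addr0; exact: MS.
  exists (- (c^-1 *: m)); split; first exact/(submod_opp Mm)/(submod_scale Mm).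
  have -> : x - - (c^-1 *: m) = c^-1 *: (m + c *: x).
    by rewrite opprK scalerDr scalerA mulVf // scale1r addrC.
  exact: submod_scale.
pose e x := sval (cid (ex x)).
have eM x : M (e x) := (proj1 (svalP (cid (ex x)))).
have eS x : S (x - e x) := (proj2 (svalP (cid (ex x)))).
have uniq x m : M m -> S (x - m) -> e x = m.
  move=> Mm1 Sm; apply/eqP; rewrite -subr_eq0; apply/eqP/MS.
    exact: submod_sub.
  have -> : e x - m = (x - m) - (x - e x) by rewrite opprB [RHS]addrC addrA subrK.
  exact: submod_sub.
exists e; split=> //.
  move=> c x y; apply: uniq; first exact: Msub.
  have -> : c *: x + y - (c *: e x + e y) = c *: (x - e x) + (y - e y).
    by rewrite scalerBr opprD addrACA.
  by case: hS => _; apply.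
move=> x; split=> [ex0|Sx]; first by have := eS x; rewrite ex0 subr0.
by apply: uniq => //; rewrite subr0.
Qed.

End Projections.

(** * Gradings *)

Section Gradings.
Context (I : eqType).

Lemma sum_subseq_eq (V : nmodType) (s t : seq I) (c : I -> V) :
  uniq s -> uniq t -> {subset s <= t} -> (forall i, i \notin s -> c i = 0) ->
  \sum_(i <- s) c i = \sum_(i <- t) c i.
Proof.
move=> us ut st c0; rewrite [RHS](bigID (mem s)) /= [X in _ + X]big1 ?addr0 //.
rewrite -[RHS]big_filter; apply: perm_big; apply: uniq_perm => //.
  exact: filter_uniq.
move=> i; rewrite mem_filter; apply/idP/andP => [si|[]//].
by split=> //; apply: st.
Qed.

Section Components.
Context (V : zmodType) (gr : I -> set V).

Definition decomp (x : V) (s : seq I) (c : I -> V) : Prop :=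
  [/\ uniq s, forall i, gr i (c i), forall i, i \notin s -> c i = 0
    & x = \sum_(i <- s) c i].

(* Junk value: 0 when x has no decomposition. *)
Definition cmp (j : I) (x : V) : V :=
  xget 0 [set y | exists s c, decomp x s c /\ y = c j].

Context (h : direct_sum gr).

Lemma gr0 i : gr i 0. Proof. by case: h. Qed.
Lemma grB i x y : gr i x -> gr i y -> gr i (x - y). Proof. by case: h => _ + _ _; apply. Qed.
Lemma grN i x : gr i x -> gr i (- x).
Proof. by move=> gx; rewrite -sub0r; apply: grB => //; exact: gr0. Qed.
Lemma grD i x y : gr i x -> gr i y -> gr i (x + y).
Proof. by move=> gx gy; rewrite -[y]opprK; apply: grB => //; exact: grN. Qed.
Lemma gr_sum i (J : Type) (r : seq J) (P : pred J) (F : J -> V) :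
  (forall j, P j -> gr i (F j)) -> gr i (\sum_(j <- r | P j) F j).
Proof. by move=> hF; apply: (big_ind (gr i)) => //; [exact: gr0|exact: grD]. Qed.
Lemma gr_mulrn i x n : gr i x -> gr i (x *+ n).
Proof. by move=> gx; elim: n => [|n ih]; rewrite ?mulr0n ?mulrS; [exact: gr0|exact: grD]. Qed.

Lemma decomp_ex x : exists s c, decomp x s c.
Proof.
case: h => _ _ + _ => /(_ x)[s [c [gc ->]]].
exists (undup s), (fun i => c i *+ count_mem i s); split.
- exact: undup_uniq.
- by move=> i; apply: gr_mulrn.
- by move=> i; rewrite mem_undup => /count_memPn ->; rewrite mulr0n.
by rewrite -big_undup_iterop_count.
Qed.

Lemma decomp_catl x s t c : decomp x s c -> x = \sum_(i <- undup (s ++ t)) c i.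
Proof.
move=> [us _ c0 ->]; apply: sum_subseq_eq => //; first exact: undup_uniq.
by move=> j sj; rewrite mem_undup mem_cat sj.
Qed.

Lemma decomp_catr x s t c : decomp x t c -> x = \sum_(i <- undup (s ++ t)) c i.
Proof.
move=> [us _ c0 ->]; apply: sum_subseq_eq => //; first exact: undup_uniq.
by move=> j sj; rewrite mem_undup mem_cat sj orbT.
Qed.

Lemma decomp_uniq x s c t d : decomp x s c -> decomp x t d -> c =1 d.
Proof.
move=> hs ht i; have [_ gc c0 _] := hs; have [_ gd d0 _] := ht.
have := direct_sum_free h (undup_uniq (s ++ t)) (fun i => grB (gc i) (gd i)).
rewrite sumrB -(decomp_catl t hs) -(decomp_catr s ht) subrr => /(_ erefl i); rewrite mem_undup mem_cat.
case: (boolP (i \in s)) => [_|si]; first by move=> /(_ isT)/eqP; rewrite subr_eq0 => /eqP.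
case: (boolP (i \in t)) => [_|ti]; first by move=> /(_ isT)/eqP; rewrite subr_eq0 => /eqP.
by rewrite c0 // d0.
Qed.

Lemma cmpE x s c j : decomp x s c -> cmp j x = c j.
Proof.
move=> hx; have : exists y, [set y | exists s c, decomp x s c /\ y = c j] y.
  by exists (c j), s, c.
move=> /(xgetPex 0); rewrite -/(cmp j x) => -[t [d [hd ->]]].
exact: decomp_uniq hd hx j.
Qed.

Lemma cmp_decomp x : exists s, decomp x s (cmp^~ x).
Proof.
have [s [c hx]] := decomp_ex x; exists s.
by have -> : cmp^~ x = c by apply: funext => j; exact: cmpE hx.
Qed.

Lemma cmp_in j x : gr j (cmp j x).
Proof. by have [s []] := cmp_decomp x. Qed.

Lemma cmp_gr i j x : gr i x -> cmp j x = if j == i then x else 0.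
Proof.
move=> gx; apply: (@cmpE x [:: i] (fun j => if j == i then x else 0)); split=> //.
- by move=> l; case: eqP => [->//|_]; exact: gr0.
- by move=> l; rewrite inE => /negPf ->.
- by rewrite big_seq1 eqxx.
Qed.

Lemma cmp_id j x : gr j x -> cmp j x = x.
Proof. by move=> /(cmp_gr j); rewrite eqxx. Qed.

Lemma cmp_ne i j x : gr i x -> j != i -> cmp j x = 0.
Proof. by move=> /(cmp_gr j) -> /negPf ->. Qed.

Lemma cmp_idem i j x : cmp j (cmp i x) = if j == i then cmp i x else 0.
Proof. exact/cmp_gr/cmp_in. Qed.

Lemma cmpB j : {morph cmp j : x y / x - y}.
Proof.
move=> x y; have [s hs] := cmp_decomp x; have [t ht] := cmp_decomp y.
have [_ gs s0 _] := hs; have [_ gt t0 _] := ht.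
apply: (@cmpE _ (undup (s ++ t)) (fun j => cmp j x - cmp j y)); split.
- exact: undup_uniq.
- by move=> i; apply: grB.
- by move=> i; rewrite mem_undup mem_cat negb_or => /andP[/s0 -> /t0 ->]; rewrite subr0.
by rewrite sumrB -(decomp_catl t hs) -(decomp_catr s ht).
Qed.

Lemma cmp0 j : cmp j 0 = 0. Proof. by rewrite -[X in cmp j X](subrr 0) cmpB subrr. Qed.
Lemma cmpN j : {morph cmp j : x / - x}.
Proof. by move=> x; rewrite -sub0r cmpB cmp0 sub0r. Qed.
Lemma cmpD j : {morph cmp j : x y / x + y}.
Proof. by move=> x y; rewrite -{1}[y]opprK cmpB cmpN opprK. Qed.
Lemma cmp_sum j (J : Type) (r : seq J) (P : pred J) (F : J -> V) :
  cmp j (\sum_(i <- r | P i) F i) = \sum_(i <- r | P i) cmp j (F i).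
Proof. by apply: (big_morph _ (cmpD j)); exact: cmp0. Qed.

Lemma cmp_ext x y : (forall j, cmp j x = cmp j y) -> x = y.
Proof.
move=> e; apply/eqP; rewrite -subr_eq0; apply/eqP.
have [s [_ _ _ ->]] := cmp_decomp (x - y).
by rewrite big1 // => j _; rewrite cmpB e subrr.
Qed.

Lemma gr_ind (P : set V) : P 0 -> (forall x y, P x -> P y -> P (x + y)) ->
  (forall j x, gr j x -> P x) -> forall x, P x.
Proof.
move=> P0 PD Ph x; have [s [_ _ _ ->]] := cmp_decomp x.
by apply: big_ind => // j _; apply: (Ph j); exact: cmp_in.
Qed.

Lemma cmp_closed (P : set V) : P 0 -> (forall x y, P x -> P y -> P (x + y)) ->
  forall x, (forall j, P (cmp j x)) -> P x.
Proof.
by move=> P0 PD x Px; have [s [_ _ _ ->]] := cmp_decomp x; apply: big_ind.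
Qed.

End Components.

Lemma decompD (V : zmodType) (gr : I -> set V) x s c y t d :
  (forall i x y, gr i x -> gr i y -> gr i (x + y)) ->
  decomp gr x s c -> decomp gr y t d ->
  decomp gr (x + y) (undup (s ++ t)) (fun i => c i + d i).
Proof.
move=> hD hx hy; have [_ gc c0 _] := hx; have [_ gd d0 _] := hy; split.
- exact: undup_uniq.
- by move=> i; apply: hD.
- by move=> i; rewrite mem_undup mem_cat negb_or => /andP[/c0 -> /d0 ->]; rewrite addr0.
by rewrite big_split /= -(decomp_catl t hx) -(decomp_catr s hy).
Qed.

(* The maps D t detect the homogeneous components of degree deg t. *)
Lemma direct_sum_intro (V : zmodType) (gr : I -> set V)
    (J : Type) (deg : J -> I) (W : J -> zmodType) (D : forall t, V -> W t) :
  (forall i, gr i 0) -> (forall i x y, gr i x -> gr i y -> gr i (x - y)) ->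
  (forall P : set V, P 0 -> (forall x y, P x -> P y -> P (x + y)) ->
    (forall j x, gr j x -> P x) -> forall x, P x) ->
  (forall t, {morph D t : x y / x + y}) ->
  (forall t i x, gr i x -> deg t != i -> D t x = 0) ->
  (forall x, (forall t, D t x = 0) -> x = 0) -> direct_sum gr.
Proof.
move=> h0 hB hspan hD hne hdet.
have hDb i x y : gr i x -> gr i y -> gr i (x + y).
  by move=> gx gy; rewrite -[y]opprK -[- y]sub0r; apply: (hB) => //; apply: hB.
have D0 t : D t 0 = 0 by apply: (@addrI _ (D t 0)); rewrite -hD !addr0.
split=> //.
  have hspan' : forall x, exists s c, decomp gr x s c.
    apply: hspan => [|x y [s [c hx]] [t [d hy]]|j x gx].
    - by exists [::], (fun=> 0); split; rewrite ?big_nil.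
    - by exists (undup (s ++ t)), (fun i => c i + d i); apply: decompD.
    - exists [:: j], (fun i => if i == j then x else 0); split=> //.
      + by move=> i; case: eqP => [->|].
      + by move=> i; rewrite inE => /negPf ->.
      + by rewrite big_seq1 eqxx.
  by move=> x; have [s [c [_ gc _ ->]]] := hspan' x; exists s, c.
move=> s c us gc sc0 i si; apply: hdet => t.
have [et|ne] := eqVneq (deg t) i; last exact: hne (gc i) ne.
rewrite -et in si *; have := congr1 (D t) sc0; rewrite D0 (big_morph _ (hD t) (D0 t)).
rewrite (bigD1_seq (deg t)) //= big1 ?addr0 // => l lt.
by apply: (hne _ l) => //; rewrite eq_sym.
Qed.

(** The grading of a homogeneous subgroup, pulled back along an additive injection. It serves
    submodules, quotients realised on a complement, and Ã inside A ⊗ T. *)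
Lemma direct_sum_sub (V W : zmodType) (gW : I -> set W) (f : V -> W) :
  direct_sum gW -> {morph f : x y / x - y} -> injective f ->
  (forall x j, exists y, f y = cmp gW j (f x)) ->
  direct_sum (fun j => [set x | gW j (f x)]).
Proof.
move=> h fB finj fst.
have f0 : f 0 = 0 by rewrite -[X in f X](subrr 0) fB subrr.
have fN : {morph f : x / - x} by move=> x; rewrite -sub0r fB f0 sub0r.
have fD : {morph f : x y / x + y} by move=> x y; rewrite -{1}[y]opprK fB fN opprK.
apply: (@direct_sum_intro _ _ I id (fun=> W) (fun j x => cmp gW j (f x))) => /=.
- by move=> i; rewrite f0; exact: gr0.
- by move=> i x y fx fy; rewrite fB; exact: grB.
- move=> P P0 PD Ph x; have [s [_ _ _ xs]] := cmp_decomp h (f x).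
  have [p pE] := choice (fst x).
  have -> : x = \sum_(i <- s) p i.
    apply: finj; rewrite {1}xs (big_morph f fD f0).
    by apply: eq_bigr => m _; rewrite pE.
  by apply: big_ind => // i _; apply: (Ph i); rewrite pE; exact: cmp_in.
- by move=> t x y; rewrite fD cmpD.
- by move=> t i x gx ti; exact: cmp_ne gx ti.
- move=> x hx; apply: finj; apply: (cmp_ext h) => j; rewrite hx f0 cmp0 //.
Qed.

Lemma cmp_glue (V : Type) (W : zmodType) (gW : I -> set W) (f : I -> V -> W) :
  direct_sum gW -> (forall j x, gW j (f j x)) ->
  (forall x, exists s : seq I, forall j, j \notin s -> f j x = 0) ->
  exists F : V -> W, forall x j, cmp gW j (F x) = f j x.
Proof.
move=> h gf fin; have [s sP] := choice fin.
exists (fun x => \sum_(j <- undup (s x)) f j x) => x j.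
apply: (cmpE h (c := f^~ x) (s := undup (s x))); split=> //.
  exact: undup_uniq.
by move=> i; rewrite mem_undup; exact: sP.
Qed.

Lemma cmp_fin (V : zmodType) (gV : I -> set V) x : direct_sum gV ->
  exists s : seq I, forall j, j \notin s -> cmp gV j x = 0.
Proof. by move=> h; have [s [_ _ s0 _]] := cmp_decomp h x; exists s. Qed.

End Gradings.

Section GradedMaps.
Context (I : eqType).

(** Injectivity of the degree map [s] keeps two components of x from landing in the same degree. *)
Lemma cmp_morph (J : eqType) (V W : zmodType) (gV : J -> set V) (gW : I -> set W)
    (s : J -> I) (f : V -> W) j x :
  direct_sum gV -> direct_sum gW -> injective s -> {morph f : x y / x + y} ->
  (forall j x, gV j x -> gW (s j) (f x)) ->
  cmp gW (s j) (f x) = f (cmp gV j x).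
Proof.
move=> hV hW si fD fg.
have f0 : f 0 = 0 by apply: (@addrI _ (f 0)); rewrite -fD !addr0.
move: x; apply: (gr_ind hV).
- by rewrite f0 !cmp0 // f0.
- by move=> x y ex ey; rewrite fD !cmpD // fD ex ey.
move=> i x gx; rewrite (cmp_gr hV _ gx) (cmp_gr hW _ (fg _ _ gx)) (inj_eq si).
by case: eqP.
Qed.

Lemma cmp_linear (k : fieldType) (V : lmodType k) (gV : I -> set V) :
  direct_sum gV -> (forall j (c : k) x, gV j x -> gV j (c *: x)) ->
  forall j, linear (cmp gV j).
Proof.
move=> h gZ j c x y; rewrite cmpD //; congr (_ + _).
by apply: (@cmp_morph I V V gV gV id ( *:%R c)) => // [u v|i u]; [exact: scalerDr|exact: gZ].
Qed.

(** An arbitrary projection p with kernel S is replaced by its degree-preserving part, which sends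
    the component x_j to (p x_j)_j; as S is homogeneous, this still has kernel S. *)
Lemma graded_proj (k : fieldType) (V : lmodType k) (gV : I -> set V) (S : set V) :
  direct_sum gV -> (forall j (c : k) x, gV j x -> gV j (c *: x)) ->
  submod S -> (forall j x, S x -> S (cmp gV j x)) ->
  exists e : V -> V, [/\ linear e, forall x, e x = 0 <-> S x,
    forall x, S (x - e x) & forall j x, gV j x -> gV j (e x)].
Proof.
move=> h gZ hS Scmp; have [p [plin p0 pS]] := subspace_proj hS.
have cmpZ j c x := lin_scale c x (cmp_linear h gZ j).
have [|//|e eE] := cmp_glue (f := fun j x => cmp gV j (p (cmp gV j x))) h.
- by move=> j x; exact: cmp_in.
- move=> x; have [s sP] := cmp_fin x h; exists s => j /sP ->.
  by rewrite (linear_fun0 plin) cmp0.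
have eS x : S (x - e x).
  have [S0 SD] := hS; apply: (cmp_closed h S0) => [y z|j]; first exact: submod_add.
  have -> : cmp gV j (x - e x) = cmp gV j (cmp gV j x - p (cmp gV j x)).
    by rewrite !cmpB // eE cmp_idem // eqxx.
  exact: Scmp.
have elin : linear e.
  move=> c x y; apply: (cmp_ext h) => j.
  by rewrite cmpD // cmpZ !eE cmpD // cmpZ plin cmpD // cmpZ.
exists e; split=> // [x|j x gx]; last first.
  have -> : e x = cmp gV j (e x); last exact: cmp_in.
  apply: (cmp_ext h) => i; rewrite cmp_idem // eE.
  case: eqP => [->|/eqP ne]; first by rewrite eE.
  by rewrite (cmp_ne h gx ne) (linear_fun0 plin) cmp0.
split=> [ex0|Sx]; first by have := eS x; rewrite ex0 subr0.
apply: (cmp_ext h) => j; rewrite eE cmp0 //.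
by have /p0 -> := Scmp j _ Sx; rewrite cmp0.
Qed.

(** A graded generalised inverse: s is a section of f over its range. Lifts and extensions over an
    algebra are built from it, since over a field they always exist. *)
Lemma graded_pinv (k : fieldType) (V W : lmodType k) (gV : I -> set V)
    (gW : I -> set W) (f : V -> W) :
  direct_sum gV -> (forall j (c : k) x, gV j x -> gV j (c *: x)) ->
  direct_sum gW -> (forall j (c : k) x, gW j x -> gW j (c *: x)) ->
  linear f -> (forall j x, gV j x -> gW j (f x)) ->
  exists s : W -> V, [/\ linear s, forall j x, gW j x -> gV j (s x)
    & forall x, f (s (f x)) = f x].
Proof.
move=> hV ZV hW ZW flin fg.
have fcmp j x : cmp gW j (f x) = f (cmp gV j x).
  by have := @cmp_morph I V W gV gW id f j x hV hW; apply=> //; exact: lin_add.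
have [|eV [eVl eV0 eVS eVg]] := graded_proj hV ZV (submod_ker flin).
  by move=> j x /= fx; rewrite -fcmp fx cmp0.
have [|eW [eWl eW0 eWS eWg]] := graded_proj hW ZW (submod_im flin).
  by move=> j _ [x _ <-]; exists (cmp gV j x).
have ex w : exists v, f v = w - eW w by have [v _ ?] := eWS w; exists v.
pose p w := sval (cid (ex w)); have pE w : f (p w) = w - eW w := svalP (cid (ex w)).
have uni v w : f v = w - eW w -> eV v = eV (p w).
  move=> fv; apply/eqP; rewrite -subr_eq0 -(lin_sub eVl); apply/eqP/eV0.
  by rewrite /= (lin_sub flin) fv pE subrr.
(* [w - eW w] projects onto the range of f, and [p] chooses preimages of it arbitrarily; [eV]
   removes the kernel part, which makes the choice unique and hence linear and graded. *)
exists (fun w => eV (p w)); split.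
- move=> c x y; rewrite -eVl; apply/esym/uni.
  by rewrite flin !pE eWl scalerBr opprD addrACA.
- move=> j x gx; rewrite -(uni (cmp gV j (p x))); first exact/eVg/(cmp_in hV).
  rewrite -fcmp pE cmpB // (cmp_id hW gx) cmp_id //; exact: eWg.
move=> x; have e0 : eW (f x) = 0 by apply/eW0; exists x.
rewrite -(uni x) ?e0 ?subr0 //; have /= := eVS x; rewrite (lin_sub flin).
by move=> /eqP; rewrite subr_eq0 => /eqP.
Qed.

End GradedMaps.

(** * Free and coinduced graded modules *)

Section FreeModule.
Context (k : fieldType) (R : algType k) (V : lmodType k).

(** A separate copy of the tensor product, because R ⊗ V is already a module over k and the action
    of R would compete with that structure. *)
Definition fmod : Type := R ⊗ V.
HB.instance Definition _ := GRing.Zmodule.copy fmod (R ⊗ V).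

Definition fscale (a : R) (x : fmod) : fmod :=
  tmap (mklin (mulr_linear a)) idfun (x : R ⊗ V).

Lemma fscale_klinear a : linear (fscale a : R ⊗ V -> R ⊗ V).
Proof. exact: tmap_linear. Qed.

Lemma fscale_tens a b (v : V) : fscale a (b ⊗t v) = (a * b) ⊗t v.
Proof. exact: tmap_tens. Qed.

Lemma fscale_klinear_l x : linear (fun a => fscale a x : R ⊗ V).
Proof.
move=> c a b; move: x; apply: tens_ext => [||d v].
- exact: fscale_klinear.
- have lc : linear (fun y : R ⊗ V => c *: y) by move=> e y z; rewrite scalerDr !scalerA mulrC.
  exact: (lin_addf (lin_comp lc (fscale_klinear a)) (fscale_klinear b)).
by rewrite !fscale_tens mulrDl -scalerAl (tens_linl v).
Qed.

Fact fscaleA a b x : fscale a (fscale b x) = fscale (a * b) x.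
Proof.
move: x; apply: tens_ext => [||c v].
- exact: lin_comp (fscale_klinear a) (fscale_klinear b).
- exact: fscale_klinear.
by rewrite !fscale_tens mulrA.
Qed.
Fact fscale1 : left_id 1 fscale.
Proof.
apply: tens_ext => [||c v]; [exact: fscale_klinear|exact: lin_id|].
by rewrite !fscale_tens mul1r.
Qed.
Fact fscaleDr : right_distributive fscale +%R.
Proof. by move=> a; exact: lin_add (fscale_klinear a). Qed.
Fact fscaleDl x : {morph fscale^~ x : a b / a + b}.
Proof. exact: lin_add (fscale_klinear_l x). Qed.
HB.instance Definition _ := GRing.Zmodule_isLmodule.Build R fmod
  fscaleA fscale1 fscaleDr fscaleDl.

Definition ftens (a : R) (v : V) : fmod := a ⊗t v.

Lemma ftensZ a b v : a *: ftens b v = ftens (a * b) v.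
Proof. exact: fscale_tens. Qed.

Lemma ftens1 a v : ftens a v = a *: ftens 1 v.
Proof. by rewrite ftensZ mulr1. Qed.

Lemma fmod_kscale (c : k) (x : fmod) : c%:A *: x = c *: (x : R ⊗ V) :> (R ⊗ V).
Proof.
have lc : linear (fun y : R ⊗ V => c *: y) by move=> e y z; rewrite scalerDr !scalerA mulrC.
move: x; apply: tens_ext => [||a v]; [exact: fscale_klinear|exact: lc|].
by rewrite [LHS]fscale_tens -scalerAl mul1r (lin_scale _ _ (tens_linl v)).
Qed.

Lemma ftens_linear a : linear (ftens a : V -> kres fmod).
Proof.
by move=> c v w; rewrite restrE fmod_kscale; exact: (tens_linr a).
Qed.

Lemma ftens_linear_l v : linear (ftens^~ v : R -> kres fmod).
Proof.
by move=> c a b; rewrite restrE fmod_kscale; exact: (tens_linl v).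
Qed.

Lemma fmod_ind (P : set fmod) : P 0 -> (forall x y, P x -> P y -> P (x + y)) ->
  (forall a v, P (ftens a v)) -> forall x, P x.
Proof.
move=> P0 PD Pt x; have [s ->] := tens_span x.
by rewrite /bsum; elim: s => [|p s ih]; rewrite ?big_nil // big_cons; apply: PD.
Qed.

Lemma fmod_ext (M : lmodType R) (f g : fmod -> M) : linear f -> linear g ->
  (forall v, f (ftens 1 v) = g (ftens 1 v)) -> f =1 g.
Proof.
move=> hf hg fg; apply: fmod_ind => [|x y ex ey|a v].
- by rewrite !linear_fun0.
- by rewrite !lin_add // ex ey.
- by rewrite ftens1 !lin_scale // fg.
Qed.

Section Lift.
Context (M : lmodType R) (g : V -> M) (hg : linear (g : V -> kres M)).

Definition flift : fmod -> M :=
  tlift (U := kres M) (fun (a : R) (v : V) => (a *: g v : M)).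

Let flift_bilin : is_bilin (fun (a : R) (v : V) => (a *: g v : M) : kres M).
Proof.
split=> [v c a b|a c v w] /=.
  by rewrite restrE scalerA -scalerAl mul1r scalerDl.
rewrite hg !restrE scalerDr; congr (_ + _).
by rewrite !scalerA -scalerAr mulr1 -scalerAl mul1r.
Qed.

Lemma flift_tens a v : flift (ftens a v) = a *: g v.
Proof. exact: tlift_tens flift_bilin _ _. Qed.

Lemma flift_linear : linear flift.
Proof.
have kl : linear (flift : R ⊗ V -> kres M) := tlift_linear flift_bilin.
have lD : {morph flift : x y / x + y} := lin_add kl.
have lZ a x : flift (a *: x) = a *: flift x.
  move: x; apply: fmod_ind => [|x y ex ey|b v].
  - by rewrite scaler0 (linear_fun0 kl) scaler0.
  - by rewrite scalerDr !lD ex ey scalerDr.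
  - by rewrite ftensZ !flift_tens scalerA.
by move=> a x y; rewrite lD lZ.
Qed.

End Lift.
End FreeModule.

(** * Graded algebras, graded modules and their maps *)

Section GradedAlgebras.
Context (k : fieldType) (A : algType k) (gr : nat -> set A).

Record graded_algebra : Prop := {
  galg_sum : direct_sum gr;
  galg_scale : forall i (c : k) a, gr i a -> gr i (c *: a);
  galg_mul : forall i j a b, gr i a -> gr j b -> gr (i + j)%N (a * b);
  galg_one : gr 0%N 1
}.

Lemma connected_graded_algebra : connected_graded gr -> graded_algebra.
Proof.
case=> h hs hm h0; split=> //; apply/h0; exists 1; by rewrite scale1r.
Qed.

Context (hA : graded_algebra).

Lemma regular_sum : direct_sum (regular_gr gr : int -> set A^o).
Proof.
have hs := galg_sum hA.
have h0 i : regular_gr gr i (0 : A^o) by case: i => n //=; exact: gr0.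
apply: (@direct_sum_intro _ _ _ int id (fun=> A) (fun j x => if j is Posz n then cmp gr n x else 0)) => //.
- by case=> [n|n] x y /=; [exact: grB|move=> -> ->; rewrite subr0].
- by move=> P P0 PD Ph; apply: (gr_ind hs) => // n x; exact: (Ph (Posz n)).
- by case=> [n|n] x y /=; [exact: cmpD|rewrite addr0].
- by case=> [n|n] [m|m] x //= gx ne; [exact: (cmp_ne hs gx)|rewrite gx cmp0].
- by move=> x hx; apply: (cmp_ext hs) => n; rewrite (hx (Posz n)) cmp0.
Qed.

Lemma regular_gmod : graded_module gr (regular_gr gr : int -> set A^o).
Proof.
split; first exact: regular_sum.
move=> i [j|j] a x ga /=; first exact: (galg_mul hA).
move=> ->; rewrite scaler0; case: (_ + _) => n //=; exact: (gr0 (galg_sum hA)).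
Qed.

End GradedAlgebras.

Section GradedModules.
Context (k : fieldType) (A : algType k) (gr : nat -> set A).
Context (hA : graded_algebra gr).

Lemma gr_scalar (c : k) : gr 0%N c%:A.
Proof. exact/(galg_scale hA)/(galg_one hA). Qed.

Section OneModule.
Context (M : lmodType A) (gM : int -> set M) (hM : graded_module gr gM).

Lemma gmod_kscale j (c : k) (x : kres M) : gM j x -> gM j (c *: x).
Proof. by move=> gx; have := gmod_act hM (gr_scalar c) gx; rewrite add0r. Qed.

Lemma cmp_act i l a x : gr i a -> cmp gM l (a *: x) = a *: cmp gM (l - i%:Z) x.
Proof.
move=> ga; have hs := gmod_sum hM.
have := @cmp_morph _ _ M M gM gM (fun j => i%:Z + j) ( *:%R a) (l - i%:Z) x hs hs.
rewrite addrC subrK; apply.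
- exact: addrI.
- exact: scalerDr.
- by move=> j y; exact: (gmod_act hM).
Qed.

Lemma gsub (S : set M) (hS : submod S) : (forall j x, S x -> S (cmp gM j x)) ->
  graded_module gr (fun j => [set x : smod hS | gM j (smval x)]).
Proof.
move=> Scmp; split.
  apply: (direct_sum_sub (gmod_sum hM) _ (@smval_inj _ _ _ hS)) => [x y //|x j].
  by exists (smk hS (Scmp j _ (smvalP x))).
by move=> i j a x ga /= gx; exact: (gmod_act hM).
Qed.

Lemma gquot (e : M -> M) (he : quotient_proj e) : (forall j x, gM j x -> gM j (e x)) ->
  graded_module gr (fun j => [set x : qmod he | gM j (qval x)]).
Proof.
move=> eg; have hs := gmod_sum hM; split.
  apply: (direct_sum_sub hs _ (@qval_inj _ _ _ he)) => [x y //|x j].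
  exists (qpi he (cmp gM j (qval x))) => /=.
  have := @cmp_morph _ _ M M gM gM id e j (qval x) hs hs.
  by rewrite qvalE => E; apply/esym/E => //; exact: (qproj_add he).
move=> i j a x ga /= gx; apply: (eg _ (a *: qval x)); exact: (gmod_act hM).
Qed.

End OneModule.

Section Homs.
Context (M N L : lmodType A) (gM : int -> set M) (gN : int -> set N) (gL : int -> set L).
Context (hM : graded_module gr gM) (hN : graded_module gr gN) (hL : graded_module gr gL).

Lemma ghom_lin e f : graded_hom gM gN e f -> linear f. Proof. by case. Qed.

Lemma ghom_gr e f j x : graded_hom gM gN e f -> gM j x -> gN (e + j) (f x).
Proof. by case=> _; apply. Qed.

Lemma ghom_cmp e f l x : graded_hom gM gN e f ->
  cmp gN l (f x) = f (cmp gM (l - e) x).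
Proof.
move=> [flin fg].
have := @cmp_morph _ _ M N gM gN (fun j => e + j) f (l - e) x (gmod_sum hM) (gmod_sum hN).
by rewrite addrC subrK; apply=> //; do ?[exact: addrI | exact: lin_add].
Qed.

Lemma ghom_ker e f : graded_hom gM gN e f -> forall j x, f x = 0 -> f (cmp gM j x) = 0.
Proof.
move=> hf j x fx; have := ghom_cmp (j + e) x hf.
by rewrite addrK fx cmp0 //; exact: gmod_sum hN.
Qed.

Lemma ghom_range e f : graded_hom gM gN e f ->
  forall j x, range f x -> range f (cmp gN j x).
Proof. by move=> hf j _ [x _ <-]; rewrite (ghom_cmp _ _ hf); exists (cmp gM (j - e) x). Qed.

Lemma ghom_comp e e' f g : graded_hom gN gL e' g -> graded_hom gM gN e f ->
  graded_hom gM gL (e' + e) (fun x => g (f x)).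
Proof.
move=> [gl gg] [fl fg]; split; first exact: lin_comp.
by move=> j x /fg/gg; rewrite addrA.
Qed.

Lemma ghom_sub e f g : graded_hom gM gN e f -> graded_hom gM gN e g ->
  graded_hom gM gN e (fun x => f x - g x).
Proof.
move=> [fl fg] [gl gg]; split; first exact: lin_subf.
by move=> j x gx; apply: (grB (gmod_sum hN)); auto.
Qed.

Lemma ghom_zero e : graded_hom gM gN e (fun=> 0).
Proof. by split=> [|j x _]; [exact: lin_zero | exact: gr0 (gmod_sum hN) _]. Qed.

(** The part of degree e of an ungraded linear map, sending x_j to the component of f x_j in degree
    e + j. It turns ungraded coboundaries into graded ones. *)
Lemma ghom_part e (f : M -> N) : linear f -> exists g : M -> N,
  graded_hom gM gN e g /\ forall l x, cmp gN l (g x) = cmp gN l (f (cmp gM (l - e) x)).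
Proof.
move=> fl; have hsN := gmod_sum hN; have hsM := gmod_sum hM.
have [||g gE] := cmp_glue (f := fun l x => cmp gN l (f (cmp gM (l - e) x))) hsN.
- by move=> j x; exact: (cmp_in hsN).
- move=> x; have [s sP] := cmp_fin x hsM; exists [seq j + e | j <- s] => j js.
  rewrite sP ?(linear_fun0 fl) ?cmp0 //; apply: contra js => js.
  by apply/mapP; exists (j - e); rewrite ?subrK.
exists g; split=> //; split.
  have gD : {morph g : x y / x + y}.
    by move=> x y; apply: (cmp_ext hsN) => l; rewrite cmpD // !gE cmpD // lin_add // cmpD.
  have g0 : g 0 = 0 by apply: (@addrI _ (g 0)); rewrite -gD !addr0.
  move=> a x y; rewrite gD; congr (_ + _); move: a.
  apply: (gr_ind (galg_sum hA)) => [|a b ea eb|i a ga].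
  - by rewrite !scale0r g0.
  - by rewrite !scalerDl gD ea eb.
  apply: (cmp_ext hsN) => l.
  rewrite gE (cmp_act hM _ _ ga) (cmp_act hN _ _ ga) gE lin_scale //.
  by rewrite (cmp_act hN _ _ ga) -!addrA [- e - _]addrC.
move=> j x gx; have -> : g x = cmp gN (e + j) (g x); last exact: (cmp_in hsN).
apply: (cmp_ext hsN) => l; rewrite cmp_idem // gE.
case: eqP => [->|/eqP ne]; first by rewrite gE.
rewrite (cmp_ne hsM gx) ?(linear_fun0 fl) ?cmp0 //.
by apply: contra ne => /eqP <-; rewrite addrC subrK.
Qed.

Lemma gmod_pinv (f : M -> N) : linear (f : kres M -> kres N) ->
  (forall j x, gM j x -> gN j (f x)) ->
  exists s : N -> M, [/\ linear (s : kres N -> kres M), forall j x, gN j x -> gM j (s x)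
    & forall x, f (s (f x)) = f x].
Proof.
move=> fl fg; apply: (@graded_pinv _ k (kres M) (kres N)) => //.
- exact: gmod_sum hM.
- by move=> j c x; exact: (gmod_kscale hM).
- exact: gmod_sum hN.
- by move=> j c x; exact: (gmod_kscale hN).
Qed.

End Homs.

Definition zmod_gr : int -> set 'rV[A]_0 := fun=> setT.

Lemma rV0_eq (x y : 'rV[A]_0) : x = y. Proof. by apply/rowP => -[]. Qed.

Lemma gzero : graded_module gr zmod_gr.
Proof.
split=> //; split=> //.
- by move=> x; exists [::], (fun=> 0); split; rewrite ?big_nil //; exact: rV0_eq.
- by move=> *; exact: rV0_eq.
Qed.

End GradedModules.

Section RestrictGraded.
Context (k : fieldType) (A B : algType k) (gA : nat -> set A) (gB : nat -> set B).
Context (beta : {rmorphism A -> B}) (hb : forall i a, gA i a -> gB i (beta a)).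

Lemma grestr (M : lmodType B) (gM : int -> set M) :
  graded_module gB gM -> graded_module gA (gM : int -> set (restr beta M)).
Proof.
case=> h hact; split; first exact: h.
by move=> i j a x ga gx; apply: hact => //; apply: hb.
Qed.

Lemma ghom_restr (M N : lmodType B) (gM : int -> set M) (gN : int -> set N) e f :
  graded_hom gM gN e f ->
  graded_hom (gM : int -> set (restr beta M)) (gN : int -> set (restr beta N)) e f.
Proof. by case=> fl fg; split=> //; exact: restr_linear. Qed.

End RestrictGraded.

Section GradedFree.
Context (k : fieldType) (A : algType k) (gr : nat -> set A).
Context (hA : graded_algebra gr).

Record graded_space (V : lmodType k) (gV : int -> set V) : Prop := {
  gsp_sum : direct_sum gV;
  gsp_scale : forall j (c : k) x, gV j x -> gV j (c *: x)
}.

Lemma gspace_kres (M : lmodType A) (gM : int -> set M) : graded_module gr gM ->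
  graded_space (gM : int -> set (kres M)).
Proof. by move=> hM; split; [exact: gmod_sum hM | move=> j c x; exact: (gmod_kscale hA hM)]. Qed.

Context (V : lmodType k) (gV : int -> set V) (hV : graded_space gV).

(** The additive subgroup generated by the tensors of total degree n, defined as the intersection of
    all subgroups containing them; membership is then an induction principle. *)
Definition fgr (n : int) : set (fmod A V) := [set x | forall S : set (fmod A V),
  S 0 -> (forall x y, S x -> S y -> S (x - y)) ->
  (forall i j a v, gr i a -> gV j v -> i%:Z + j = n -> S (ftens a v)) -> S x].

Lemma fgr_tens i j a v : gr i a -> gV j v -> fgr (i%:Z + j) (ftens a v).
Proof. by move=> ga gv S S0 SB; apply; eauto. Qed.

Lemma fgr0 n : fgr n 0. Proof. by move=> S S0. Qed.

Lemma fgrB n x y : fgr n x -> fgr n y -> fgr n (x - y).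
Proof. by move=> hx hy S S0 SB St; apply: (SB); [exact: hx | exact: hy]. Qed.

Let gV_klin j : linear (cmp gV j).
Proof. exact: cmp_linear (gsp_sum hV) (gsp_scale hV) j. Qed.

Let gA_klin j : linear (cmp gr j).
Proof. exact: cmp_linear (galg_sum hA) (galg_scale hA) j. Qed.

Definition fdet (t : nat * int) : fmod A V -> fmod A V :=
  tmap (mklin (gA_klin t.1)) (mklin (gV_klin t.2)).

Lemma fdet_tens t a v : fdet t (ftens a v) = ftens (cmp gr t.1 a) (cmp gV t.2 v).
Proof. exact: tmap_tens. Qed.

Let fdetL t : linear (fdet t : A ⊗ V -> A ⊗ V). Proof. exact: tmap_linear. Qed.

Let fdetD t : {morph fdet t : x y / x + y}. Proof. exact: (lin_add (fdetL t)). Qed.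
Let fdet0 t : fdet t 0 = 0. Proof. exact: (linear_fun0 (fdetL t)). Qed.
Let fdetB t : {morph fdet t : x y / x - y}. Proof. exact: (lin_sub (fdetL t)). Qed.

Lemma fgr_span (P : set (fmod A V)) : P 0 -> (forall x y, P x -> P y -> P (x + y)) ->
  (forall i j a v, gr i a -> gV j v -> P (ftens a v)) -> forall x, P x.
Proof.
move=> P0 PD Ph; apply: fmod_ind => // a v; move: a.
apply: (gr_ind (galg_sum hA)) => [|a b Pa Pb|i a ga].
- by have /linear_fun0 -> := @ftens_linear_l _ A V v.
- by have /lin_add -> := @ftens_linear_l _ A V v; exact: PD.
move: v; apply: (gr_ind (gsp_sum hV)) => [|x y Px Py|j x gx].
- by have /linear_fun0 -> := @ftens_linear _ A V a.
- by have /lin_add -> := @ftens_linear _ A V a; exact: PD.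
exact: Ph ga gx.
Qed.

Lemma fgr_sum : direct_sum fgr.
Proof.
apply: (@direct_sum_intro _ _ _ (nat * int)%type (fun t => t.1%:Z + t.2) (fun=> fmod A V) fdet).
- exact: fgr0.
- exact: fgrB.
- move=> P P0 PD Ph; apply: fgr_span => // i j a v ga gv.
  exact: (Ph _ _ (fgr_tens ga gv)).
- exact: fdetD.
- move=> t n x hx ne; apply: (hx (fun x => fdet t x = 0)) => [//|y z ey ez|i j a v ga gv ijn].
    by rewrite fdetB ey ez subr0.
  rewrite fdet_tens (cmp_gr (galg_sum hA) _ ga) (cmp_gr (gsp_sum hV) _ gv).
  case: eqP => [e1|_]; last by have /linear_fun0 -> := @ftens_linear_l _ A V (if t.2 == j then v else 0).
  case: eqP => [e2|_]; last by have /linear_fun0 -> := @ftens_linear _ A V a.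
  by move: ne; rewrite e1 e2 ijn eqxx.
(* The maps [fdet] are the projections to the bidegrees, and every x is the finite sum of its
   bihomogeneous parts; so they detect 0. *)
have dec x : exists s c, decomp (fun t => [set y | fdet t y = y]) x s c /\ forall t, c t = fdet t x.
  move: x; apply: fgr_span => [|x y [s [c [hx cx]]] [t [d [hy dy]]]|i j a v ga gv].
  - exists [::], (fun=> 0); split; first by split; rewrite ?big_nil //= => t; rewrite fdet0.
    by move=> t; rewrite fdet0.
  - exists (undup (s ++ t)), (fun i => c i + d i); split; last by move=> l; rewrite fdetD cx dy.
    by apply: decompD => // l z w /= ez ew; rewrite fdetD ez ew.
  have fE t : fdet t (ftens a v) = if t == (i, j) then ftens a v else 0.
    rewrite fdet_tens (cmp_gr (galg_sum hA) _ ga) (cmp_gr (gsp_sum hV) _ gv).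
    case: t => t1 t2 /=; rewrite xpair_eqE; case: eqP => _ //=.
      by case: eqP => // _; have /linear_fun0 -> := @ftens_linear _ A V a.
    by have /linear_fun0 -> := @ftens_linear_l _ A V (if t2 == j then v else 0).
  exists [:: (i, j)], (fun t => if t == (i, j) then ftens a v else 0); split=> //.
  split=> //.
  - by move=> t /=; case: eqP => [->|_]; rewrite ?fdet0 // fE eqxx.
  - by move=> t; rewrite inE => /negPf ->.
  - by rewrite big_seq1 eqxx.
move=> x hx; have [s [c [[_ _ _ xs] cE]]] := dec x.
by rewrite xs big1 // => t _; rewrite cE hx.
Qed.

Lemma gfree : graded_module gr fgr.
Proof.
split; first exact: fgr_sum.
move=> i j a x ga gx; apply: (gx (fun x => fgr (i%:Z + j) (a *: x))) => [|y z hy hz|l m b v gb gv e].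
- by rewrite scaler0.
- by rewrite scalerBr; exact: fgrB.
- by rewrite ftensZ -e addrA -PoszD; apply: fgr_tens => //; exact: (galg_mul hA).
Qed.

Lemma ftens1_gr j v : gV j v -> fgr j (ftens 1 v).
Proof. by move=> gv; rewrite -[j]add0r; apply: fgr_tens gv; exact: (galg_one hA). Qed.

Lemma flift_graded (M : lmodType A) (gM : int -> set M) e (g : V -> M)
    (hg : linear (g : V -> kres M)) : graded_module gr gM ->
  (forall j v, gV j v -> gM (e + j) (g v)) -> graded_hom fgr gM e (flift g).
Proof.
move=> hM gg; split; first exact: flift_linear.
move=> n x hx; have hs := gmod_sum hM.
apply: (hx (fun x => gM (e + n) (flift g x))) => [|y z hy hz|i j a v ga gv <-].
- by rewrite (linear_fun0 (flift_linear hg)); exact: (gr0 hs).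
- by rewrite (lin_sub (flift_linear hg)); exact: (grB hs).
- by rewrite flift_tens // addrCA; apply: (gmod_act hM) => //; apply: gg.
Qed.

End GradedFree.

Record gmod (k : fieldType) (A : algType k) (gr : nat -> set A) := Gmod {
  gcar :> lmodType A;
  ggr : int -> set gcar;
  gprf : graded_module gr ggr
}.

(* The graded dual of B with values in X: sums of homogeneous k-linear maps. *)
Section Coinduced.
Context (k : fieldType) (B : algType k) (gB : nat -> set B).
Context (hB : graded_algebra gB) (X : gmod gB).

Definition hmap (e : int) (f : B -> X) : Prop :=
  linear (f : B -> kres X) /\
  forall i b, gB i b -> ggr (e + i%:Z) (f b).

Definition coind_set : set (B -> X) := [set f | forall S : set (B -> X),
  S 0 -> (forall f g, S f -> S g -> S (f + g)) ->
  (forall e f, hmap e f -> S f) -> S f].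

Let hX := gmod_sum (gprf X).

Lemma coind_set_ind (P : (B -> X) -> Prop) f : coind_set f -> P 0 ->
  (forall f g, P f -> P g -> P (f + g)) -> (forall e f, hmap e f -> P f) -> P f.
Proof. by move=> hf; exact: (hf P). Qed.

Lemma hmap_coind e f : hmap e f -> coind_set f.
Proof. by move=> hf S S0 SD; apply; exact: hf. Qed.

Lemma coind_set0 : coind_set 0. Proof. by move=> S S0. Qed.

Lemma coind_setD f g : coind_set f -> coind_set g -> coind_set (f + g).
Proof. by move=> hf hg S S0 SD Sh; apply: (SD); [exact: hf | exact: hg]. Qed.

Lemma hmapN e f : hmap e f -> hmap e (- f).
Proof.
move=> [fl fg]; split=> [c x y|i b gb].
  by have := congr1 (-%R : kres X -> kres X) (fl c x y); rewrite opprD -scalerN.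
by apply: (grN hX); apply: fg.
Qed.

Lemma coind_setN f : coind_set f -> coind_set (- f).
Proof.
move=> hf; apply: (@coind_set_ind (fun f => coind_set (- f)) _ hf) => [|g h hg hh|e g hg].
- by rewrite oppr0; exact: coind_set0.
- by rewrite opprD; exact: coind_setD.
- exact: hmap_coind (hmapN hg).
Qed.

Definition in_coind : {pred (B -> X)} := fun f => `[< coind_set f >].

Fact in_coind_closed : zmod_closed in_coind.
Proof.
split; first by apply/asboolP; exact: coind_set0.
move=> f g /asboolP hf /asboolP hg; apply/asboolP.
by apply: coind_setD => //; exact: coind_setN.
Qed.
HB.instance Definition _ := GRing.isZmodClosed.Build (B -> X) in_coind in_coind_closed.

Record coind : Type := Coind { cval : B -> X; _ : cval \in in_coind }.
HB.instance Definition _ := [isSub for cval].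
HB.instance Definition _ := [Choice of coind by <:].
HB.instance Definition _ := [SubChoice_isSubZmodule of coind by <:].

Definition cmk f (hf : coind_set f) : coind := Coind (asboolT hf : _ \in in_coind).

Lemma cvalP (f : coind) : coind_set (cval f).
Proof. by case: f => f /= /asboolP. Qed.

Lemma cval_inj : injective cval. Proof. exact: val_inj. Qed.

Lemma coind_eq (f g : coind) : (forall b, cval f b = cval g b) -> f = g.
Proof. by move=> e; apply: cval_inj; apply: funext. Qed.

Lemma cvalD (f g : coind) b : cval (f + g) b = cval f b + cval g b.
Proof. by []. Qed.
Lemma cvalB (f g : coind) b : cval (f - g) b = cval f b - cval g b.
Proof. by []. Qed.

Lemma cval_lin (f : coind) : linear (cval f : B -> kres X).
Proof.
apply: (@coind_set_ind (fun f : B -> X => linear (f : B -> kres X)) _ (cvalP f)).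
- exact: lin_zero.
- by move=> g h gl hl; exact: (lin_addf gl hl).
- by move=> e g [].
Qed.

Lemma cvalDr (f : coind) b c : cval f (b + c) = cval f b + cval f c.
Proof. exact: (lin_add (cval_lin f)). Qed.

Lemma coind_set_act f b : coind_set f -> coind_set (fun c => f (c * b)).
Proof.
move=> hf; apply: (@coind_set_ind (fun f => coind_set (fun c => f (c * b))) _ hf).
- exact: coind_set0.
- by move=> g h; exact: coind_setD.
move=> e g [gl gg]; move: b; apply: (gr_ind (galg_sum hB)) => [|b c hb hc|i b hb].
- have -> : (fun c : B => g (c * 0)) = 0.
    by apply: funext => c; rewrite mulr0 (linear_fun0 gl).
  exact: coind_set0.
- have -> : (fun d : B => g (d * (b + c))) = (fun d => g (d * b)) + (fun d => g (d * c)).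
    by apply: funext => d; rewrite mulrDr [LHS](lin_add gl).
  exact: coind_setD.
apply: (@hmap_coind (e + i%:Z)); split; first exact: (lin_comp gl (mull_linear b)).
move=> j c gc; rewrite -addrA -PoszD addnC; apply: gg; exact: (galg_mul hB).
Qed.

Definition cscale (b : B) (f : coind) : coind := cmk (coind_set_act b (cvalP f)).
Fact cscaleA b c f : cscale b (cscale c f) = cscale (b * c) f.
Proof. by apply: coind_eq => d; rewrite /= mulrA. Qed.
Fact cscale1 : left_id 1 cscale.
Proof. by move=> f; apply: coind_eq => d; rewrite /= mulr1. Qed.
Fact cscaleDr : right_distributive cscale +%R.
Proof. by move=> b f g; apply: coind_eq => d. Qed.
Fact cscaleDl f : {morph cscale^~ f : b c / b + c}.
Proof. by move=> b c; apply: coind_eq => d; rewrite /= mulrDr cvalDr. Qed.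
HB.instance Definition _ := GRing.Zmodule_isLmodule.Build B coind
  cscaleA cscale1 cscaleDr cscaleDl.

Lemma cvalZ b (f : coind) c : cval (b *: f) c = cval f (c * b).
Proof. by []. Qed.

Definition coind_gr (e : int) : set coind :=
  [set f | forall i b, gB i b -> ggr (e + i%:Z) (cval f b)].

Lemma coind_gmod : graded_module gB coind_gr.
Proof.
split; last first.
  move=> i j b f gb gf l c gc; rewrite cvalZ [i%:Z + j]addrC -addrA -PoszD addnC.
  by apply: gf; exact: (galg_mul hB).
(* The detector with index (i, l, b) reads the component of degree l of the value of f at the
   degree-i part of b. It sees only the part of f of degree l - i. *)
apply: (@direct_sum_intro _ _ _ (nat * int * B)%type (fun t => t.1.2 - t.1.1%:Z)
  (fun=> X) (fun t f => cmp (@ggr _ _ _ X) t.1.2 (cval f (cmp gB t.1.1 t.2)))).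
- by move=> e i b gb; exact: (gr0 hX).
- by move=> e f g hf hg i b gb; rewrite cvalB; apply: (grB hX); [exact: hf|exact: hg].
- move=> P P0 PD Ph [f hf]; have := asboolW hf.
  move=> /(@coind_set_ind (fun f => exists h : coind_set f, P (cmk h))) -[||e g hg|h Ph'].
  + exists coind_set0; suff -> : cmk coind_set0 = 0 by []; exact: coind_eq.
  + move=> g l [hg Pg] [hl Pl]; exists (coind_setD hg hl).
    suff -> : cmk (coind_setD hg hl) = cmk hg + cmk hl by apply: PD.
    exact: coind_eq.
  + by exists (hmap_coind hg); apply: (Ph e); case: hg.
  by have -> : Coind hf = cmk h by exact: cval_inj.
- by move=> t f g; rewrite cvalD cmpD.
- move=> t e f gf ne; have gi := cmp_in (galg_sum hB) t.1.1 t.2.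
  apply: (cmp_ne hX (gf _ _ gi)); apply: contra ne => /eqP ->.
  by rewrite addrK.
move=> f hf; apply: coind_eq; apply: (gr_ind (galg_sum hB)) => [|b c eb ec|i b gb].
- exact: (linear_fun0 (cval_lin f)).
- by rewrite [LHS]cvalDr eb ec; exact: addr0.
by apply: (cmp_ext hX) => l; have := hf (i, l, b); rewrite /= (cmp_id (galg_sum hB) gb) => ->; rewrite cmp0.
Qed.

Definition coindG : gmod gB := Gmod coind_gmod.

Lemma coemb_set (x : X) : coind_set (fun b => b *: x).
Proof.
move: x; apply: (gr_ind hX) => [|x y hx hy|j x gx].
- have -> : (fun b : B => b *: (0 : X)) = 0 by apply: funext => b; rewrite scaler0.
  exact: coind_set0.
- have -> : (fun b : B => b *: (x + y)) = (fun b => b *: x) + (fun b => b *: y).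
    by apply: funext => b; rewrite scalerDr.
  exact: coind_setD.
apply: (@hmap_coind j); split.
  by move=> c a b; rewrite restrE /= scalerDl scalerA -scalerAl mul1r.
by move=> i b gb; rewrite addrC; exact: (gmod_act (gprf X)).
Qed.

Definition coemb (x : X) : coindG := cmk (coemb_set x).

Lemma coembE x b : cval (coemb x) b = b *: x. Proof. by []. Qed.

Lemma coemb_linear : linear coemb.
Proof.
by move=> b x y; apply: coind_eq => c; rewrite cvalD cvalZ !coembE scalerDr scalerA.
Qed.

Lemma coemb_graded : graded_hom (@ggr _ _ _ X) (@ggr _ _ _ coindG) 0 coemb.
Proof.
split; first exact: coemb_linear.
move=> j x gx i b gb; rewrite add0r coembE addrC; exact: (gmod_act (gprf X)).
Qed.

Lemma coemb_inj : injective coemb.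
Proof. by move=> x y /(congr1 (fun f : coind => cval f 1)); rewrite !coembE !scale1r. Qed.

(** Evaluation at 1 is an additive left inverse of [coemb]. This is therefore a projection with
    kernel exactly the image of X, and the cosyzygy requires no choice of a complement. *)
Definition coproj (f : coindG) : coindG := f - coemb (cval f 1).

Lemma coproj_emb x : coproj (coemb x) = 0.
Proof. by rewrite /coproj coembE scale1r subrr. Qed.

Lemma coproj0 f : coproj f = 0 -> f = coemb (cval f 1).
Proof. by move=> /eqP; rewrite subr_eq0 => /eqP. Qed.

Lemma coproj_qp : quotient_proj coproj.
Proof.
split.
- move=> f g; rewrite /coproj cvalD (lin_add coemb_linear).
  by rewrite opprD addrACA.
- move=> f; rewrite {1}/coproj [X in coemb X](_ : _ = 0) ?(linear_fun0 coemb_linear) ?subr0 //.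
  by rewrite cvalB coembE scale1r subrr.
- by move=> b f /coproj0 ->; rewrite -(lin_scale _ _ coemb_linear) coproj_emb.
Qed.

Lemma coproj_gr j f : coind_gr j f -> coind_gr j (coproj f).
Proof.
move=> gf; apply: (grB (gmod_sum coind_gmod)) => //.
have := ghom_gr coemb_graded (gf 0%N 1 (galg_one hB)).
by rewrite add0r addr0.
Qed.

Definition cosyz : gmod gB := Gmod (gquot coind_gmod coproj_qp coproj_gr).

Definition coquo (f : coindG) : cosyz := qpi coproj_qp f.

Lemma coquo_graded : graded_hom (@ggr _ _ _ coindG) (@ggr _ _ _ cosyz) 0 coquo.
Proof.
split; first exact: qpi_linear.
by move=> j f gf; rewrite add0r /=; exact: coproj_gr.
Qed.

Lemma coquo_surj : surjective_fun coquo.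
Proof. by move=> f; exists (qval f); exact: qvalK. Qed.

Lemma coquo_exact : exact_at coemb coquo.
Proof.
move=> f; rewrite qpi_eq0; split=> [/coproj0 ->|[x <-]]; last exact: coproj_emb.
by exists (cval f 1).
Qed.

End Coinduced.

Section RelativelyFree.
Context (k : fieldType) (R B : algType k) (gR : nat -> set R) (gB : nat -> set B).
Context (beta : {lrmorphism R -> B}).

(** A finite basis of B as a right R-module, in degree 0. The coordinates are data, and uniqueness
    of the expansion makes them linear and homogeneous. *)
Record right_free (n : nat) (t : 'I_n -> B) (r : 'I_n -> B -> R) : Prop := {
  rfree_dec : forall b, b = \sum_j t j * beta (r j b);
  rfree_coord : forall (c : 'I_n -> R) j, r j (\sum_i t i * beta (c i)) = c j;
  rfree_deg : forall j, gB 0%N (t j)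
}.

Context (hR : graded_algebra gR) (hB : graded_algebra gB).
Context (hb : forall i a, gR i a -> gB i (beta a)).
Context (n : nat) (t : 'I_n -> B) (r : 'I_n -> B -> R) (hf : right_free t r).

Lemma rfree_lin j : linear (r j).
Proof.
move=> c x y; rewrite {1}(rfree_dec hf x) {1}(rfree_dec hf y) scaler_sumr -big_split /=.
rewrite -[RHS](rfree_coord hf (fun j => c *: r j x + r j y) j).
by congr (r j _); apply: eq_bigr => i _; rewrite linearP /= mulrDr scalerAr.
Qed.

Lemma rfree_mul j b a : r j (b * beta a) = r j b * a.
Proof.
rewrite {1}(rfree_dec hf b) mulr_suml -[RHS](rfree_coord hf (fun j => r j b * a) j).
by congr (r j _); apply: eq_bigr => i _; rewrite rmorphM mulrA.
Qed.

(** Replacing the coefficients of b by their degree-i parts still gives an expansion of b, because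
    the basis lies in degree 0; uniqueness concludes. *)
Lemma rfree_gr j i b : gB i b -> gR i (r j b).
Proof.
move=> gb; have hsR := galg_sum hR; have hsB := galg_sum hB.
suff -> : r j b = cmp gR i (r j b) by exact: (cmp_in hsR).
rewrite -[RHS](rfree_coord hf (fun j => cmp gR i (r j b)) j); congr (r j _).
rewrite -{1}(cmp_id hsB gb) {1}(rfree_dec hf b) cmp_sum //; apply: eq_bigr => l _.
have := @cmp_morph _ _ R B gR gB id (fun a => t l * beta a) i (r l b) hsR hsB.
apply=> // [x y|m a ga]; first by rewrite rmorphD mulrDr.
by rewrite -[m]add0n; apply: (galg_mul hB); [exact: (rfree_deg hf)|exact: hb].
Qed.

End RelativelyFree.

(** * Projectivity and injectivity in shifted degrees *)

Section Lifting.
Context (k : fieldType) (A : algType k) (gr : nat -> set A).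

(** Stronger than the defining property in two ways: the degree e is arbitrary, and g need only
    cover the image of f. Free modules have it, hence so do their retracts, the graded
    projectives. *)
Definition gproj (P : lmodType A) (gP : int -> set P) : Prop :=
  forall (M N : lmodType A) (gM : int -> set M) (gN : int -> set N)
      (g : M -> N) (f : P -> N) e,
    graded_module gr gM -> graded_module gr gN ->
    graded_hom gM gN 0 g -> graded_hom gP gN e f -> (forall x, range g (f x)) ->
    exists h : P -> M, graded_hom gP gM e h /\ forall x, g (h x) = f x.

(** The dual strengthening: arbitrary degree, and g need not be injective as long as f kills its
    kernel. *)
Definition ginj (E : lmodType A) (gE : int -> set E) : Prop :=
  forall (M N : lmodType A) (gM : int -> set M) (gN : int -> set N)
      (g : M -> N) (f : M -> E) e,
    graded_module gr gM -> graded_module gr gN ->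
    graded_hom gM gN 0 g -> graded_hom gM gE e f -> (forall x, g x = 0 -> f x = 0) ->
    exists h : N -> E, graded_hom gN gE e h /\ forall x, h (g x) = f x.

Context (hA : graded_algebra gr).

Lemma klin_restr (M N : lmodType A) (f : M -> N) : linear f -> linear (f : kres M -> kres N).
Proof. exact: restr_linear. Qed.

Lemma free_gproj (V : lmodType k) (gV : int -> set V) :
  graded_space gV -> gproj (fgr gr gV).
Proof.
move=> hV M N gM gN g f e hM hN hg hf fim.
have gg j x : gM j x -> gN j (g x) by move=> gx; rewrite -[j]add0r; apply: (ghom_gr hg).
have [s [sl sg gs]] := gmod_pinv hA hM hN (klin_restr (ghom_lin hg)) gg.
have ul : linear ((fun v => s (f (ftens 1 v))) : V -> kres M).
  exact: (lin_comp sl (lin_comp (klin_restr (ghom_lin hf)) (@ftens_linear _ A V 1))).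
exists (flift (fun v => s (f (ftens 1 v)))).
have hh : graded_hom (fgr gr gV) gM e (flift (fun v => s (f (ftens 1 v)))).
  apply: flift_graded => // j v gv; apply: sg; apply: (ghom_gr hf).
  exact: ftens1_gr.
split=> //; apply: fmod_ext.
- exact: (lin_comp (ghom_lin hg) (ghom_lin hh)).
- exact: (ghom_lin hf).
by move=> v; rewrite flift_tens // scale1r; have [x _ <-] := fim (ftens 1 v).
Qed.

Lemma free_graded_projective (V : lmodType k) (gV : int -> set V) :
  graded_space gV -> graded_projective gr (fgr gr gV).
Proof.
move=> hV; split; first exact: gfree.
move=> M N gM gN g f hM hN hg gs hf; apply: (free_gproj hV hM hN hg hf) => x.
by have [y <-] := gs (f x); exists y.
Qed.

Lemma flift_id_linear (M : lmodType A) : linear (id : kres M -> kres M).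
Proof. by []. Qed.

Lemma flift_id_graded (M : lmodType A) (gM : int -> set M) : graded_module gr gM ->
  graded_hom (fgr gr (gM : int -> set (kres M))) gM 0 (flift (V := kres M) (M := M) id).
Proof.
move=> hM; apply: flift_graded => // j v; by rewrite add0r.
Qed.

(** P is a retract of the free module on its own underlying space. *)
Lemma graded_projective_section (P : lmodType A) (gP : int -> set P) :
  graded_projective gr gP ->
  exists s, graded_hom gP (fgr gr (gP : int -> set (kres P))) 0 s /\
    forall x, flift (V := kres P) (M := P) id (s x) = x.
Proof.
move=> [hP proj]; apply: proj => //.
- exact/(gfree hA)/(gspace_kres hA).
- exact: hP.
- exact: (flift_id_graded hP).
- by move=> x; exists (ftens 1 (x : kres P)); rewrite flift_tens // scale1r.
- by split=> // j x; rewrite add0r.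
Qed.

Lemma graded_projective_gproj (P : lmodType A) (gP : int -> set P) :
  graded_projective gr gP -> gproj gP.
Proof.
move=> hP M N gM gN g f e hM hN hg hf fim.
have [s [hs sK]] := graded_projective_section hP.
have hF := gspace_kres hA (proj1 hP).
have hfm := ghom_comp hf (flift_id_graded (proj1 hP)).
have [|h [hh hE]] := free_gproj hF hM hN hg hfm; first by move=> x; exact: fim.
exists (fun x => h (s x)); split; last by move=> x; rewrite hE sK.
by have := ghom_comp hh hs; rewrite !addr0.
Qed.

(** With a single degree, graded linear algebra specialises to the ungraded one. *)
Lemma trivial_grading (V : zmodType) : direct_sum (fun _ : unit => [set: V]).
Proof.
split=> [//|//|x|s c us _ sc i si].
  by exists [:: tt], (fun=> x); rewrite big_seq1.
case: s us si sc => [//|[] s /= /andP[ns _] _]; rewrite big_cons.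
by case: i s ns => -[|[] s] //= _; rewrite big_nil addr0.
Qed.

Lemma klinear_pinv (V W : lmodType k) (f : V -> W) : linear f ->
  exists s : W -> V, linear s /\ forall x, f (s (f x)) = f x.
Proof.
move=> fl; have [|||s [sl _ sf]] // :=
  @graded_pinv unit k V W _ _ f (trivial_grading V) _ (trivial_grading W) _ fl.
by exists s.
Qed.

Lemma free_lift (V : lmodType k) (M N : lmodType A) (g : M -> N) (f : fmod A V -> N) :
  linear g -> linear f -> (forall x, range g (f x)) ->
  exists h : fmod A V -> M, linear h /\ forall x, g (h x) = f x.
Proof.
move=> gl fl fim; have [s [sl gs]] := klinear_pinv (klin_restr gl).
have ul : linear ((fun v => s (f (ftens 1 v))) : V -> kres M).
  exact: (lin_comp sl (lin_comp (klin_restr fl) (@ftens_linear _ A V 1))).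
exists (flift (fun v => s (f (ftens 1 v)))); split; first exact: flift_linear.
apply: fmod_ext => //; first exact: (lin_comp gl (flift_linear ul)).
by move=> v; rewrite flift_tens // scale1r; have [x _ <-] := fim (ftens 1 v).
Qed.

Lemma free_projective (V : lmodType k) : projective_module (fmod A V : lmodType A).
Proof.
move=> M N g f gs.
have [|h [hl hE]] := @free_lift V M N g f (linearP g) (linearP f).
  by move=> x; have [y <-] := gs (f x); exists y.
by exists (mklin hl).
Qed.

Lemma projective_section (P : lmodType A) : projective_module P ->
  exists s : P -> fmod A (kres P), linear s /\
    forall x, flift (V := kres P) (M := P) id (s x) = x.
Proof.
move=> /(_ (fmod A (kres P)) P (mklin (flift_linear (@flift_id_linear P))) idfun) [|h hE].
  by move=> x; exists (ftens 1 (x : kres P)); rewrite mklinE flift_tens // scale1r.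
by exists h; split; [exact: linearP|].
Qed.

Lemma section_projective (P : lmodType A) (V : lmodType k)
    (p : fmod A V -> P) (s : P -> fmod A V) :
  linear p -> linear s -> (forall x, p (s x) = x) -> projective_module P.
Proof.
move=> pl sl ps M N g f gs.
have [|h [hl hE]] := @free_lift V M N g (fun x => f (p x)) (linearP g) (lin_comp (linearP f) pl).
  by move=> x; have [y <-] := gs (f (p x)); exists y.
by exists (mklin (lin_comp hl sl)) => x; rewrite mklinE hE ps.
Qed.

Lemma projective_lift (P M N : lmodType A) (g : M -> N) (f : P -> N) :
  projective_module P -> linear g -> linear f -> (forall x, range g (f x)) ->
  exists h : P -> M, linear h /\ forall x, g (h x) = f x.
Proof.
move=> /projective_section[s [sl sK]] gl fl fim.
have pl := flift_linear (@flift_id_linear P).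
have [|h [hl hE]] := free_lift gl (lin_comp fl pl); first by move=> x; exact: fim.
by exists (fun x => h (s x)); split=> [|x]; [exact: lin_comp | rewrite hE sK].
Qed.

Lemma graded_projective_projective (P : lmodType A) (gP : int -> set P) :
  graded_projective gr gP -> projective_module P.
Proof.
move=> /graded_projective_section[s [[sl _] sK]].
exact: (section_projective (flift_linear (@flift_id_linear P)) sl sK).
Qed.

End Lifting.

Section CoinducedInjective.
Context (k : fieldType) (R B : algType k) (gR : nat -> set R) (gB : nat -> set B).
Context (beta : {lrmorphism R -> B}).
Context (hR : graded_algebra gR) (hB : graded_algebra gB).
Context (hb : forall i a, gR i a -> gB i (beta a)).
Context (n : nat) (t : 'I_n -> B) (r : 'I_n -> B -> R).
Context (hf : right_free gB beta t r).

(* Hom_R(M, Hom_k(B, X)) = Hom_k(M, X)^n, as B is free over R on the right. *)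
Lemma coind_ginj (X : gmod gB) :
  ginj gR (@ggr _ _ _ (coindG hB X) : int -> set (restr beta (coindG hB X))).
Proof.
move=> M N gM gN g f e hM hN hg hfe fker.
have hX := gmod_sum (gprf X).
have gg j x : gM j x -> gN j (g x) by move=> gx; rewrite -[j]add0r; apply: (ghom_gr hg).
have [s [sl sg gs]] := gmod_pinv hR hM hN (klin_restr (ghom_lin hg)) gg.
have fl := ghom_lin hfe.
have fsg x : f (s (g x)) = f x.
  apply/eqP; rewrite -subr_eq0 -(lin_sub fl); apply/eqP/fker.
  by rewrite (lin_sub (ghom_lin hg)) gs subrr.
pose fv (x : M) (b : B) : X := cval (f x : coind X) b.
have fvD x y b : fv (x + y) b = fv x b + fv y b by rewrite /fv (lin_add fl).
have fvZ a x b : fv (a *: x) b = fv x (b * beta a) by rewrite /fv (lin_scale _ _ fl).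
(* Under this identification f becomes the family of k-linear maps sending x to the value of f x at
   t_j. Each is extended along [s], and the result is translated back through b = sum of t_j β(r_j
   b). *)
pose hv (y : N) (b : B) : X := \sum_j fv (s (r j b *: y)) (t j).
have fsD y z b : fv (s (y + z)) b = fv (s y) b + fv (s z) b.
  by rewrite -fvD; congr fv; exact: (lin_add sl).
have fs0 b : fv (s 0) b = 0 by apply: (@addrI _ (fv (s 0) b)); rewrite -fsD !addr0.
have fsZ c y b : fv (s (c%:A *: y)) b = c%:A *: fv (s y) b.
  have -> : s (c%:A *: y) = c%:A *: s y by exact: (@lin_scale _ _ _ (s : kres N -> kres M)).
  rewrite fvZ (_ : b * beta c%:A = c *: b); last by rewrite linearZ /= rmorph1 -scalerAr mulr1.
  exact: (lin_scale _ _ (cval_lin (f (s y)))).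
have hvD y z b : hv (y + z) b = hv y b + hv z b.
  by rewrite /hv -big_split; apply: eq_bigr => j _; rewrite scalerDr fsD.
have fvg m i x b : gM m x -> gB i b -> ggr (e + m + i%:Z) (fv x b).
  by move=> gx; exact: (ghom_gr hfe gx).
have hvg l y : gN l y -> forall i b, gB i b -> ggr (e + l + i%:Z) (hv y b).
  move=> gy i b gb; apply: (gr_sum hX) => j _; rewrite -[e + l + _]addr0.
  rewrite -[e + l + _]addrA [l + _]addrC; apply: fvg (rfree_deg hf j).
  by apply/sg/(gmod_act hN) => //; exact: (rfree_gr hR hB hb hf).
have hv_set y : coind_set (X := X) (hv y).
  move: y; apply: (gr_ind (gmod_sum hN)) => [|y z hy hz|l y gy].
  - have -> : hv 0 = 0.
      by apply: funext => b; rewrite /hv big1 // => j _; rewrite scaler0 fs0.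
    exact: coind_set0.
  - have -> : hv (y + z) = hv y + hv z by apply: funext => b; rewrite hvD.
    exact: coind_setD.
  apply: (@hmap_coind _ _ _ _ (e + l)); split.
    move=> c a b; rewrite /hv restrE scaler_sumr -big_split; apply: eq_bigr => j _ /=.
    by rewrite (rfree_lin hf) scalerDl fsD -fsZ !scalerA -scalerAl mul1r.
  exact: hvg.
pose h y : coindG hB X := cmk (hv_set y).
exists h; split; last first.
  move=> x; apply: coind_eq => b.
  have -> : cval (h (g x) : coind X) b = hv (g x) b by [].
  rewrite /hv; under eq_bigr => j _.
    have -> : fv (s (r j b *: g x)) (t j) = fv x (t j * beta (r j b)).
      by rewrite /fv -(lin_scale _ _ (ghom_lin hg)) fsg -/(fv _ _) fvZ.
    over.
  by rewrite {2}(rfree_dec hf b) /fv (lin_sum _ _ _ (cval_lin (f x))).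
split; last first.
  by move=> l y gy; exact: (hvg l y gy).
move=> a x y; apply: coind_eq => b.
have -> : cval (h (a *: x + y) : coind X) b = hv (a *: x + y) b by [].
rewrite hvD; congr (_ + _); rewrite /hv /=; apply: eq_bigr => j _.
by rewrite (rfree_mul hf) scalerA.
Qed.

End CoinducedInjective.

(** * Dimension shifting *)

Section Subquotients.
Context (k : fieldType).

(** As [subquotient_iso], with the linear combination as a parameter, because functions into a
    module over an algebra carry no k-module structure here. *)
Definition subquotient_onto (V : Type) (lc : k -> V -> V -> V) (W : lmodType k)
    (Z B : set V) : Prop :=
  exists phi : V -> W,
    [/\ forall c x y, Z x -> Z y -> phi (lc c x y) = c *: phi x + phi y,
        forall w, exists x, Z x /\ phi x = w
      & forall x, Z x -> (phi x = 0 <-> B x)].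

(* A linear relation inducing an isomorphism Z / B -> Z' / B'. *)
Definition sqcorr (V V' : Type) (lc : k -> V -> V -> V) (lc' : k -> V' -> V' -> V')
    (Z B : set V) (Z' B' : set V') : Prop :=
  exists rho : V -> V' -> Prop,
    [/\ forall c x y x' y', rho x x' -> rho y y' -> rho (lc c x y) (lc' c x' y'),
        forall x x', rho x x' -> Z x /\ Z' x',
        forall x, Z x -> exists x', rho x x',
        forall x', Z' x' -> exists x, rho x x'
      & forall x x', rho x x' -> (B x <-> B' x')].

Section Corr.
Context (V V' V'' : Type) (lc : k -> V -> V -> V) (lc' : k -> V' -> V' -> V').
Context (lc'' : k -> V'' -> V'' -> V'').
Context (Z B : set V) (Z' B' : set V') (Z'' B'' : set V'').

Lemma sqcorr_sym : sqcorr lc lc' Z B Z' B' -> sqcorr lc' lc Z' B' Z B.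
Proof.
move=> [rho [h1 h2 h3 h4 h5]]; exists (fun x' x => rho x x'); split=> //.
- by move=> c x y x' y'; apply: h1.
- by move=> x x' /h2[].
- by move=> x x' /h5; tauto.
Qed.

Lemma sqcorr_trans : sqcorr lc lc' Z B Z' B' -> sqcorr lc' lc'' Z' B' Z'' B'' ->
  sqcorr lc lc'' Z B Z'' B''.
Proof.
move=> [r [h1 h2 h3 h4 h5]] [s [g1 g2 g3 g4 g5]].
exists (fun x z => exists y, r x y /\ s y z); split.
- move=> c x y x' y' [x1 [rx sx]] [y1 [ry sy]]; exists (lc' c x1 y1).
  by split; [exact: h1|exact: g1].
- by move=> x z [y [/h2[Zx _] /g2[_ Zz]]].
- by move=> x /h3[y rxy]; have [_ /g3[z syz]] := h2 _ _ rxy; exists z, y.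
- by move=> z /g4[y syz]; have [/h4[x rxy] _] := g2 _ _ syz; exists x, y.
- by move=> x z [y [/h5 e1 /g5 e2]]; rewrite e1.
Qed.

Lemma sqcorr_iso W : sqcorr lc lc' Z B Z' B' -> (forall x, Z' x -> B' (lc' (-1) x x)) ->
  subquotient_onto lc W Z B -> subquotient_onto lc' W Z' B'.
Proof.
(* Two elements related to the same x' have a difference related to x' - x', which lies in B' by
   [B0]; so phi takes the same value on both. *)
move=> [rho [h1 h2 h3 h4 h5]] B0 [phi [p1 p2 p3]].
have uni x y x' : rho x x' -> rho y x' -> phi x = phi y.
  move=> rx ry; have [Zx Zx'] := h2 _ _ rx; have [Zy _] := h2 _ _ ry.
  have r := h1 (-1) _ _ _ _ ry rx; have [Zl _] := h2 _ _ r.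
  have /(h5 _ _ r)/(p3 _ Zl) := B0 _ Zx'.
  by rewrite p1 // scaleN1r addrC => /eqP; rewrite subr_eq0 => /eqP.
have ex x' : exists x, Z' x' -> rho x x'.
  have [/h4[x rx]|nZ] := pselect (Z' x'); first by exists x.
  have [x _] := p2 0; by exists x.
pose q x' := sval (cid (ex x')); have qP x' : Z' x' -> rho (q x') x' := svalP (cid (ex x')).
have qE x x' : rho x x' -> phi (q x') = phi x.
  by move=> r; have [_ /qP r'] := h2 _ _ r; exact: uni r' r.
exists (fun x' => phi (q x')); split.
- move=> c x y /qP rx /qP ry; rewrite (qE _ _ (h1 c _ _ _ _ rx ry)).
  by have [Zx _] := h2 _ _ rx; have [Zy _] := h2 _ _ ry; rewrite p1.
- move=> w; have [x [Zx <-]] := p2 w; have [x' r] := h3 _ Zx.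
  by exists x'; rewrite (qE _ _ r); have [_ ?] := h2 _ _ r.
- move=> x' /qP r; have [Zx _] := h2 _ _ r; rewrite (p3 _ Zx); exact: h5.
Qed.

Lemma sqcorr_vanish : sqcorr lc lc' Z B Z' B' -> (forall x, Z x -> B x) ->
  forall x, Z' x -> B' x.
Proof.
move=> [rho [h1 h2 h3 h4 h5]] ZB x' /h4[x r].
by have [/ZB Bx _] := h2 _ _ r; apply/(h5 _ _ r).
Qed.

End Corr.
End Subquotients.

Definition flc (k : fieldType) (A : algType k) (S : Type) (X : lmodType A)
  (c : k) (f g : S -> X) : S -> X := fun x => c%:A *: f x + g x.

Lemma scalar_comm (k : fieldType) (A : algType k) (X : lmodType A) (c : k) (a : A)
  (x : X) : c%:A *: (a *: x) = a *: (c%:A *: x).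
Proof. by rewrite !scalerA -scalerAl mul1r -scalerAr mulr1. Qed.

Lemma flc_ghom (k : fieldType) (A : algType k) (gr : nat -> set A)
    (hA : graded_algebra gr) (M N : lmodType A) (gM : int -> set M)
    (gN : int -> set N) e c f g : graded_module gr gN ->
  graded_hom gM gN e f -> graded_hom gM gN e g -> graded_hom gM gN e (flc c f g).
Proof.
move=> hN [fl fg] [gl gg]; split.
  by move=> a x y; rewrite /flc fl gl scalerDr addrACA scalar_comm -scalerDr.
move=> j x gx; apply: (grD (gmod_sum hN)); last exact: gg.
exact: (gmod_kscale hA hN c (fg _ _ gx)).
Qed.

Section Shift.
Context (k : fieldType) (A : algType k) (gr : nat -> set A).
Context (hA : graded_algebra gr).

Lemma ghom_factor (P X I : lmodType A) (gP : int -> set P) (gX : int -> set X)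
    (gI : int -> set I) (iota : X -> I) (h : P -> I) e :
  graded_module gr gX -> graded_module gr gI ->
  graded_hom gX gI 0 iota -> injective iota -> graded_hom gP gI e h ->
  (forall x, range iota (h x)) ->
  exists f : P -> X, graded_hom gP gX e f /\ forall x, iota (f x) = h x.
Proof.
move=> hX hI hi ii hh him; have il := ghom_lin hi.
have ex x : exists y, iota y = h x by have [y _ e1] := him x; exists y.
have [f fE] := choice ex.
exists f; split=> //; split.
  by move=> a x y; apply: ii; rewrite il !fE (ghom_lin hh).
move=> j x gx; have -> : f x = cmp gX (e + j) (f x); last exact: (cmp_in (gmod_sum hX)).
apply: ii; have := ghom_cmp hX hI (e + j) (f x) hi; rewrite subr0 => <-.
by rewrite fE (cmp_id (gmod_sum hI)) //; exact: (ghom_gr hh).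
Qed.

Section Cohomology.
Context (P : nat -> lmodType A) (gP : forall i, int -> set (P i)).
Context (d : forall i, P i.+1 -> P i) (X : lmodType A) (gX : int -> set X).

Definition gcoc (i : nat) (e : int) : set (P i -> X) :=
  [set f | graded_hom (@gP i) gX e f /\ forall x, f (d x) = 0].

Definition gcob (i : nat) (e : int) : set (P i -> X) :=
  match i return set (P i -> X) with
  | 0 => [set 0]
  | i'.+1 => [set f | exists g : P i' -> X,
      graded_hom (@gP i') gX e g /\ forall x, f x = g (d x)]
  end.

Arguments gcoc i e f : clear implicits.
Arguments gcob i e f : clear implicits.

Lemma gcob_sub i e f : graded_module gr gX -> gcoc i e f -> gcob i e (flc (-1) f f).
Proof.
move=> hX [hf _]; have e0 x : flc (-1) f f x = 0 by rewrite /flc !scaleN1r addNr.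
case: i f hf e0 => [|i] f hf e0; first exact: funext.
by exists (fun=> 0); split=> [|x]; [exact: (ghom_zero _ hX) | exact: e0].
Qed.

End Cohomology.

Arguments gcoc {P} gP d {X} gX i e f.
Arguments gcob {P} gP d {X} gX i e f.

Section Core.
Context (P2 P1 P0 X I Y : lmodType A).
Context (gP2 : int -> set P2) (gP1 : int -> set P1) (gP0 : int -> set P0).
Context (gX : int -> set X) (gI : int -> set I) (gY : int -> set Y).
Context (hX : graded_module gr gX) (hI : graded_module gr gI) (hY : graded_module gr gY).
Context (iota : X -> I) (pi : I -> Y).
Context (hiota : graded_hom gX gI 0 iota) (hpi : graded_hom gI gY 0 pi).
Context (iinj : injective iota) (psurj : surjective_fun pi) (ipex : exact_at iota pi).
Context (hP1 : graded_module gr gP1) (hP0 : graded_module gr gP0).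
Context (d1 : P2 -> P1) (d0 : P1 -> P0) (hd0 : graded_hom gP1 gP0 0 d0).
Context (dex : exact_at d1 d0) (pP0 : gproj gr gP0) (jI : ginj gr gI).

Let pi_lin := ghom_lin hpi.
Let iota_lin := ghom_lin hiota.
Let pi_iota x : pi (iota x) = 0. Proof. by apply/ipex; exists x. Qed.
Let d0d1 x : d0 (d1 x) = 0. Proof. by apply/dex; exists x. Qed.

(** The connecting relation of 0 -> X -> I -> Y -> 0: f and g are related when some h : P0 -> I
    satisfies iota f = h d0 and g = pi h. Injectivity of I finds h from f, projectivity of P0 finds
    it from g. On the side of Y, the coboundaries are the cocycles that lift to I-valued cocycles;
    this form also covers the bottom of the complex, where there is no preceding term. *)
Lemma dimension_shift e :
  sqcorr (@flc k A P1 X) (@flc k A P0 Y)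
    [set f | graded_hom gP1 gX e f /\ forall x, f (d1 x) = 0]
    [set f | exists f', graded_hom gP0 gX e f' /\ forall x, f x = f' (d0 x)]
    [set g | graded_hom gP0 gY e g /\ forall x, g (d0 x) = 0]
    [set g | exists h, [/\ graded_hom gP0 gI e h, forall x, h (d0 x) = 0
      & forall x, g x = pi (h x)]].
Proof.
have comp0 (N1 N2 N3 : lmodType A) (g1 : int -> set N1) (g2 : int -> set N2)
  (g3 : int -> set N3) u v : graded_hom g2 g3 0 u -> graded_hom g1 g2 e v ->
  graded_hom g1 g3 e (fun x => u (v x)).
  by move=> hu hv; have := ghom_comp hu hv; rewrite add0r.
have comp1 (N1 N2 N3 : lmodType A) (g1 : int -> set N1) (g2 : int -> set N2)
  (g3 : int -> set N3) u v : graded_hom g2 g3 e u -> graded_hom g1 g2 0 v ->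
  graded_hom g1 g3 e (fun x => u (v x)).
  by move=> hu hv; have := ghom_comp hu hv; rewrite addr0.
exists (fun f g => exists h, [/\ graded_hom gP0 gI e h,
  graded_hom gP1 gX e f, forall x, iota (f x) = h (d0 x) & forall x, g x = pi (h x)]).
split.
- move=> c f g f' g' [h [hh hf ih ph]] [l [hl hg il pl]].
  exists (flc c h l); split.
  + exact: (flc_ghom hA).
  + exact: (flc_ghom hA).
  + by move=> x; rewrite /flc iota_lin ih il.
  + by move=> x; rewrite /flc pi_lin ph pl.
- move=> f g [h [hh hf ih ph]]; split; split=> //.
  + by move=> x; apply: iinj; rewrite ih d0d1 (linear_fun0 (ghom_lin hh)) linear_fun0.
  + have -> : g = fun x => pi (h x) by apply: funext.
    exact: (comp0 _ _ _ _ _ _ _ _ hpi hh).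
  + by move=> x; rewrite ph -ih pi_iota.
- move=> f [hf fd]; have [|h [hh hE]] := jI hP1 hP0 hd0 (comp0 _ _ _ _ _ _ _ _ hiota hf).
    by move=> x /dex[y <-]; rewrite fd linear_fun0.
  by exists (fun x => pi (h x)), h; split=> // x; rewrite hE.
- move=> g [hg gd]; have [|h [hh hE]] := pP0 hI hY hpi hg.
    by move=> x; have [y <-] := psurj (g x); exists y.
  have [|f [hf fE]] := ghom_factor hX hI hiota iinj (comp1 _ _ _ _ _ _ _ _ hh hd0).
    by move=> x; have /ipex[y <-] : pi (h (d0 x)) = 0; [rewrite hE gd|exists y].
  by exists f, h; split.
move=> f g [h [hh hf ih ph]]; split=> [[f' [hf' fE]]|[h' [hh' hd ph']]].
  exists (fun x => h x - iota (f' x)); split.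
  - by apply: (ghom_sub hI) => //; exact: (comp0 _ _ _ _ _ _ _ _ hiota hf').
  - by move=> x; rewrite -ih fE subrr.
  - by move=> x; rewrite (lin_sub pi_lin) pi_iota subr0 ph.
have [|f' [hf' fE]] := ghom_factor hX hI hiota iinj (ghom_sub hI hh hh').
  move=> x; have /ipex[y <-] : pi (h x - h' x) = 0; last by exists y.
  by rewrite (lin_sub pi_lin) -ph ph' subrr.
by exists f'; split=> // x; apply: iinj; rewrite ih fE hd subr0.
Qed.

Context (P' : lmodType A) (gP' : int -> set P') (hP' : graded_module gr gP').
Context (d' : P0 -> P') (hd' : graded_hom gP0 gP' 0 d').
Context (dex' : exact_at d0 d') (pP' : gproj gr gP').

(** An I-valued cocycle on P0 extends along d' because I is injective, so it is a coboundary;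
    conversely a Y-valued map on P' lifts to I because P' is projective. *)
Lemma lifted_coboundaries e : [set g | exists h, [/\ graded_hom gP0 gI e h,
    forall x, h (d0 x) = 0 & forall x, g x = pi (h x)]] =
  [set g | exists g', graded_hom gP' gY e g' /\ forall x, g x = g' (d' x)].
Proof.
apply/seteqP; split=> g.
  move=> [h [hh hd ph]]; have [|h' [hh' hE]] := jI hP0 hP' hd' hh.
    by move=> x /dex'[y <-].
  exists (fun x => pi (h' x)); split=> [|x]; last by rewrite hE.
  by have := ghom_comp hpi hh'; rewrite add0r.
move=> [g' [hg' gE]]; have [|h [hh hE]] := pP' hI hY hpi hg'.
  by move=> x; have [y <-] := psurj (g' x); exists y.
exists (fun x => h (d' x)); split.
- by have := ghom_comp hh hd'; rewrite addr0.
- move=> x; have -> : d' (d0 x) = 0 by apply/dex'; exists x.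
  exact: (linear_fun0 (ghom_lin hh)).
- by move=> x; rewrite hE gE.
Qed.

End Core.
End Shift.

Arguments gcoc {k A P} gP d {X} gX i e f.
Arguments gcob {k A P} gP d {X} gX i e f.

Section InjectiveGinj.
Context (k : fieldType) (A : algType k) (gr : nat -> set A) (hA : graded_algebra gr).

Lemma right_free_id : right_free gr (idfun : {lrmorphism A -> A})
  (fun _ : 'I_1 => 1) (fun _ a => a).
Proof.
split=> [b|c j|_]; last exact: galg_one.
  by rewrite big_ord1 mul1r.
by rewrite big_ord1 mul1r [j]ord1.
Qed.

Lemma coind_ginj_id (X : gmod gr) : ginj gr (@ggr _ _ _ (coindG hA X)).
Proof.
move=> M N gM gN g f e hM hN hg hf fker.
have := coind_ginj hA (beta := idfun) (fun _ _ h => h) right_free_id.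
by move=> /(_ hA X M N gM gN g f e hM hN hg hf fker).
Qed.

(** E is a retract of its coinduced module, which has the extension property in every degree. *)
Lemma graded_injective_ginj (E : lmodType A) (gE : int -> set E) :
  graded_injective gr gE -> ginj gr gE.
Proof.
move=> [hE inj]; pose X := Gmod hE.
have hid : graded_hom gE gE 0 id by split=> // j x; rewrite add0r.
have [rho [hrho rhoK]] := inj _ _ _ _ (coemb hA (X := X)) id hE (gprf (coindG hA X))
  (coemb_graded hA X) (@coemb_inj _ _ _ hA X) hid.
move=> M N gM gN g f e hM hN hg hf fker.
have hf' := ghom_comp (coemb_graded hA X) hf.
have [|h [hh hE']] := coind_ginj_id hM hN hg hf'.
  by move=> x /fker /= ->; rewrite (linear_fun0 (coemb_linear hA (X := X))).
exists (fun x => rho (h x)); split; last by move=> x; rewrite hE' rhoK.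
by have := ghom_comp hrho hh; rewrite !add0r.
Qed.

Lemma ginj_graded_injective (E : lmodType A) (gE : int -> set E) :
  graded_module gr gE -> ginj gr gE -> graded_injective gr gE.
Proof.
move=> hE inj; split=> // M N gM gN g f hM hN hg gi hf.
apply: (inj _ _ _ _ _ _ _ hM hN hg hf) => x gx.
have -> : x = 0 by apply: gi; rewrite gx (linear_fun0 (ghom_lin hg)).
exact: (linear_fun0 (ghom_lin hf)).
Qed.

End InjectiveGinj.

(* Maps into the elements of degree e killed by the augmentation ideal. *)
Definition socle_maps (k : fieldType) (A : algType k) (gr : nat -> set A)
    (U : lmodType k) (Y : lmodType A) (gY : int -> set Y) (e : int) : set (U -> Y) :=
  [set phi | [/\ linear (phi : U -> kres Y), forall x, gY e (phi x)
    & forall i a x, (0 < i)%N -> gr i a -> a *: phi x = 0]].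

Section TrivialHom.
Context (k : fieldType) (A : algType k) (gr : nat -> set A).
Context (hc : connected_graded gr).
Context (P1 P0 M Y : lmodType A) (gP1 : int -> set P1) (gP0 : int -> set P0)
  (gM : int -> set M) (gY : int -> set Y).
Context (hP0 : graded_module gr gP0) (hM : graded_module gr gM) (hY : graded_module gr gY).
Context (hM0 : forall j x, gM j x -> j != 0 -> x = 0).
Context (d0 : P1 -> P0) (aug : P0 -> M) (haug : graded_hom gP0 gM 0 aug).
Context (aex : exact_at d0 aug) (asurj : surjective_fun aug).
Context (U : lmodType k) (u : U -> M) (v : M -> U).
Context (ul : linear (u : U -> kres M)) (uK : cancel u v) (vK : cancel v u).

Let hA := connected_graded_algebra hc.

Lemma concentrated_gr x : gM 0 x.
Proof.
have -> : x = cmp gM 0 x; last exact: (cmp_in (gmod_sum hM)).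
apply: (cmp_ext (gmod_sum hM)) => j; rewrite cmp_idem; last exact: gmod_sum hM.
case: eqP => [->//|/eqP ne]; apply: (hM0 _ ne); exact: (cmp_in (gmod_sum hM)).
Qed.

Lemma concentrated_act i a x : (0 < i)%N -> gr i a -> a *: (x : M) = 0.
Proof.
move=> i0 ga; have := gmod_act hM ga (concentrated_gr x).
by rewrite addr0 => /hM0; apply; rewrite -lt0n.
Qed.

(** Such a g factors through M, which is trivial and sits in degree 0. M is described through a
    bijection with a vector space U, so that modules over different algebras can be compared on the
    same U. *)
Lemma trivial_hom_socle e g : graded_hom gP0 gY e g -> (forall x, g (d0 x) = 0) ->
  exists phi : U -> Y, socle_maps gr gY e phi /\ forall p, g p = phi (v (aug p)).
Proof.
move=> hg gd; have [p pE] : exists p : U -> P0, forall x, aug (p x) = u x.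
  have ex x : exists p, aug p = u x by have [y <-] := asurj (u x); exists y.
  by have [p pE] := choice ex; exists p.
have gl := ghom_lin hg; have al := ghom_lin haug.
have uni q q' : aug q = aug q' -> g q = g q'.
  move=> e1; apply/eqP; rewrite -subr_eq0 -(lin_sub gl); apply/eqP.
  have /aex[y <-] : aug (q - q') = 0 by rewrite (lin_sub al) e1 subrr.
  exact: gd.
exists (fun x => g (p x)); split; last by move=> q; apply: uni; rewrite pE vK.
split.
- move=> c x y; have := uni (p (c *: x + y)) (c%:A *: p x + p y).
  rewrite pE al !pE ul => -> //; exact: gl.
- move=> x; have -> : g (p x) = g (cmp gP0 0 (p x)).
    apply: uni; have := ghom_cmp hP0 hM 0 (p x) haug; rewrite subr0 => <-.
    by rewrite (cmp_id (gmod_sum hM)) //; exact: concentrated_gr.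
  by rewrite -[e]addr0; apply: (ghom_gr hg); exact: (cmp_in (gmod_sum hP0)).
move=> i a x i0 ga; rewrite -(lin_scale _ _ gl) -[RHS](linear_fun0 gl).
by apply: uni; rewrite (lin_scale _ _ al) (linear_fun0 al) (concentrated_act _ i0 ga).
Qed.

Lemma socle_trivial_hom e phi : socle_maps gr gY e phi ->
  graded_hom gP0 gY e (fun p => phi (v (aug p))) /\ forall x, phi (v (aug (d0 x))) = 0.
Proof.
move=> [pl pg ps]; have al := ghom_lin haug.
have vl : linear (v : kres M -> U) := lin_inv ul uK vK.
have p0 : phi 0 = 0 := linear_fun0 pl.
have v0 : v 0 = 0 := linear_fun0 vl.
split; last first.
  move=> x; have -> : aug (d0 x) = 0 by apply/aex; exists x.
  by rewrite v0 p0.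
have pvD : {morph (fun m => phi (v m)) : x y / x + y}.
  by move=> x y; rewrite [v _](lin_add vl) [LHS](lin_add pl).
split.
  move=> a x y; rewrite (lin_add al) pvD; congr (_ + _); rewrite (lin_scale _ _ al); move: a.
  apply: (gr_ind (galg_sum hA)) => [|a b ea eb|i a ga].
  - by rewrite !scale0r v0 p0.
  - by rewrite !scalerDl pvD ea eb.
  case: i ga => [/(cgr_conn hc)[c ->]|i ga].
    by rewrite [v _](lin_scale _ _ vl) [LHS](lin_scale _ _ pl).
  by rewrite (concentrated_act _ _ ga) // v0 p0 (ps _ _ _ _ ga).
move=> j x gx; have [->|ne] := eqVneq j 0; first by rewrite addr0; exact: pg.
rewrite (_ : aug x = 0) ?v0 ?p0; first exact: (gr0 (gmod_sum hY)).
by apply: (hM0 _ ne); rewrite -[j]add0r; exact: (ghom_gr haug).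
Qed.

Lemma socle_flc e c phi psi : socle_maps gr gY e phi -> socle_maps gr gY e psi ->
  socle_maps gr gY e (flc c phi psi : U -> Y).
Proof.
move=> [pl pg ps] [ql qg qs]; split.
- move=> b x y; rewrite /flc pl ql !restrE scalerDr addrACA; congr (_ + _).
  by rewrite [RHS]scalerDr; congr (_ + _); exact: scalar_comm.
- move=> x; apply: (grD (gmod_sum hY)); last exact: qg.
  exact: (gmod_kscale hA hY c (pg x)).
- move=> i a x i0 ga; rewrite /flc scalerDr (qs _ _ _ i0 ga) addr0 -scalar_comm.
  by rewrite (ps _ _ _ i0 ga) scaler0.
Qed.

Lemma trivial_sqcorr e (Bg : set (P0 -> Y)) (Bphi : set (U -> Y)) :
  (forall g phi, graded_hom gP0 gY e g -> (forall x, g (d0 x) = 0) ->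
    socle_maps gr gY e phi -> (forall p, g p = phi (v (aug p))) -> (Bg g <-> Bphi phi)) ->
  sqcorr (@flc k A P0 Y) (@flc k A U Y)
    [set g | graded_hom gP0 gY e g /\ forall x, g (d0 x) = 0] Bg
    (socle_maps gr gY e) Bphi.
Proof.
move=> hB; exists (fun g phi => [/\ graded_hom gP0 gY e g, forall x, g (d0 x) = 0,
  socle_maps gr gY e phi & forall p, g p = phi (v (aug p))]); split.
- move=> c g g' phi phi' [h1 h2 h3 h4] [l1 l2 l3 l4]; split.
  + exact: (flc_ghom hA).
  + by move=> x; rewrite /flc h2 l2 scaler0 addr0.
  + exact: socle_flc.
  + by move=> p; rewrite /flc h4 l4.
- by move=> g phi [].
- by move=> g [hg gd]; have [phi [hp gE]] := trivial_hom_socle hg gd; exists phi.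
- move=> phi hp; exists (fun p => phi (v (aug p))).
  by have [] := socle_trivial_hom hp.
- by move=> g phi [h1 h2 h3 h4]; exact: hB.
Qed.

End TrivialHom.

(** * Ext read from the coinduced resolution *)

Section Balance.
Context (k : fieldType) (B : algType k) (gB : nat -> set B) (hB : graded_algebra gB).

(** The cosyzygy is taken of X first, so that dimension shifting is an induction on i with X varying
    and the types agree by conversion. *)
Fixpoint cosyzn (i : nat) (X : gmod gB) : gmod gB :=
  if i is i'.+1 then cosyzn i' (cosyz hB X) else X.

(* Ext^i(U, X) in degree e, as computed by the coinduced resolution of X. *)
Definition ext_cocycle (U : lmodType k) (X : gmod gB) (i : nat) (e : int) :
    set (U -> cosyzn i X) :=
  socle_maps gB (@ggr _ _ _ (cosyzn i X)) e.

(** These are the coboundaries of Ext^(i+1): the maps into the last cosyzygy that lift to the last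
    coinduced module. Only U and the B-module X enter, not the algebra over which Ext is taken. *)
Fixpoint ext_coboundary1 (U : lmodType k) (X : gmod gB) (i : nat) (e : int)
    {struct i} : set (U -> cosyzn i (cosyz hB X)) :=
  match i return set (U -> cosyzn i (cosyz hB X)) with
  | 0 => [set phi | exists psi : U -> coindG hB X,
      socle_maps gB (@ggr _ _ _ (coindG hB X)) e psi /\
      forall x, phi x = coquo (psi x)]
  | i'.+1 => @ext_coboundary1 U (cosyz hB X) i' e
  end.

Arguments ext_coboundary1 U X i e _ : clear implicits.

Definition ext_coboundary (U : lmodType k) (X : gmod gB) (i : nat) (e : int) :
    set (U -> cosyzn i X) :=
  match i return set (U -> cosyzn i X) with
  | 0 => [set 0]
  | i'.+1 => ext_coboundary1 U X i' e
  end.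

Arguments ext_cocycle U X i e _ : clear implicits.
Arguments ext_coboundary U X i e _ : clear implicits.

Record rel_free (R : algType k) (gR : nat -> set R) (beta : {lrmorphism R -> B}) : Prop := {
  rfe_conn : connected_graded gR;
  rfe_gr : forall i a, gR i a -> gB i (beta a);
  rfe_right : exists n (t : 'I_n -> B) r, right_free gB beta t r
}.

Section OneRing.
Context (R : algType k) (gR : nat -> set R) (beta : {lrmorphism R -> B}).
Context (hf : rel_free gR beta).
Let hR := connected_graded_algebra (rfe_conn hf).
Let hb := rfe_gr hf.

Definition rgr (X : gmod gB) : int -> set (restr beta X) := @ggr _ _ _ X.

Lemma rgr_gmod (X : gmod gB) : graded_module gR (rgr (X := X)).
Proof. exact: (grestr hb (gprf X)). Qed.

Let beta_scalar (c : k) : (beta : {rmorphism R -> B}) c%:A = c%:A.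
Proof. by have := linearZ_LR beta c 1; rewrite rmorph1. Qed.

Lemma kres_restr (X : gmod gB) (U : lmodType k) (f : U -> X) :
  linear (f : U -> kres X) <-> linear (f : U -> kres (restr beta X)).
Proof.
have E c (x : X) : c%:A *: (x : restr beta X) = c%:A *: x :> X.
  by rewrite restrE beta_scalar.
by split=> fl c x y; rewrite [LHS]fl; congr (_ + _); [exact/esym/E | exact: E].
Qed.

(** An element b of degree i > 0 is the sum of the t_j β(r_j b), with r_j b again of degree i; so
    whatever the positive part of R kills, b kills too. *)
Lemma socle_restr (X : gmod gB) (U : lmodType k) e :
  socle_maps gR (rgr (X := X)) e = socle_maps gB (@ggr _ _ _ X) e :> set (U -> X).
Proof.
have [n [t [r rf]]] := rfe_right hf.
apply/seteqP; split=> phi [pl pg ps]; split=> //.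
- exact/kres_restr.
- move=> i b x i0 gb; rewrite (rfree_dec rf b) scaler_suml big1 // => j _.
  have gr_j := rfree_gr hR hB hb rf j gb.
  by rewrite -scalerA; have := ps _ _ x i0 gr_j; rewrite restrE => ->; rewrite scaler0.
- exact/kres_restr.
- by move=> i a x i0 ga; rewrite restrE; exact: (ps _ _ _ i0 (hb ga)).
Qed.

Context (M : lmodType R) (gM : int -> set M) (hM : graded_module gR gM).
Context (hM0 : forall j x, gM j x -> j != 0 -> x = 0).
Context (P : nat -> lmodType R) (gP : forall i, int -> set (P i)).
Context (d : forall i, P i.+1 -> P i) (aug : P 0%N -> M).
Context (res : graded_projective_resolution gR gM gP d aug).
Context (U : lmodType k) (u : U -> M) (v : M -> U).
Context (ul : linear (u : U -> kres M)) (uK : cancel u v) (vK : cancel v u).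

Let hP i : graded_module gR (@gP i) := proj1 (gpr_proj res i).
Let pP i : gproj gR (@gP i) := graded_projective_gproj hR (gpr_proj res i).
Let jI X : ginj gR (rgr (X := coindG hB X)).
Proof. by have [n [t [r rf]]] := rfe_right hf; exact: (coind_ginj hR hb rf). Qed.

Let flcE (S : Type) (X : gmod gB) c (f g : S -> X) :
  @flc k R S (restr beta X) c f g = @flc k B S X c f g.
Proof. by apply: funext => x; rewrite /flc restrE beta_scalar. Qed.

(** Coinduced modules are injective over R, so each shift replaces X by its cosyzygy and lowers the
    degree by one, until maps out of M itself remain. *)
Lemma balance (i : nat) (X : gmod gB) (e : int) :
  sqcorr (@flc k R (P i) (restr beta X)) (@flc k B U (cosyzn i X))
    (gcoc gP d (rgr (X := X)) i e) (gcob gP d (rgr (X := X)) i e)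
    (ext_cocycle U X i e)
    (ext_coboundary U X i e).
Proof.
have flcEf S (X' : gmod gB) : @flc k B S X' = @flc k R S (restr beta X').
  by apply: funext => c; apply: funext => f; apply: funext => g; rewrite flcE.
have triv := trivial_sqcorr (rfe_conn hf) (hP 0) hM _ hM0 (gpr_aug res)
  (gpr_exact0 res) (gpr_surj res) ul uK vK.
have shift i' (X' : gmod gB) := dimension_shift hR (rgr_gmod X') (rgr_gmod (coindG hB X'))
  (rgr_gmod (cosyz hB X')) (ghom_restr beta (coemb_graded hB X'))
  (ghom_restr beta (coquo_graded hB X')) (@coemb_inj _ _ _ hB X')
  (@coquo_surj _ _ _ hB X') (@coquo_exact _ _ _ hB X') (hP i'.+1) (hP i') (gpr_d res i')
  (gpr_exact res (i := i')) (pP (i := i')) (jI (X := X')) e.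
(* Degrees 0 and 1 are read off from maps out of the trivial module; degree 1 needs its own argument
   because its coboundaries are the maps that lift to the coinduced module. Above that
   [lifted_coboundaries] applies. *)
case: i => [|i]; last elim: i X => [|i ih] X.
- rewrite flcEf /ext_cocycle -socle_restr; apply: (triv _ _ (rgr_gmod X)) => g phi hg gd hp gE.
  split=> [g0|p0]; last by apply: funext => p; rewrite gE p0.
  apply: funext => w; have [p e1] := gpr_surj res (u w).
  by rewrite -[w]uK -e1 -gE g0.
- apply: sqcorr_trans (shift 0%N X) _.
  rewrite flcEf /ext_cocycle -socle_restr; apply: (triv _ _ (rgr_gmod (cosyz hB X))).
  move=> g phi hg gd hp gE; split=> [[h [hh hd hE]]|[psi [hpsi pE]]].
    have [psi [hpsi hE']] := trivial_hom_socle (hP 0) hM hM0 (gpr_aug res)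
      (gpr_exact0 res) (gpr_surj res) ul vK hh hd.
    exists psi; rewrite -socle_restr; split=> // w.
    have [p e1] := gpr_surj res (u w).
    by rewrite -[w]uK -e1 -gE hE hE'.
  rewrite -socle_restr in hpsi.
  have [hh hd] := socle_trivial_hom (rfe_conn hf) hM (rgr_gmod (coindG hB X)) hM0 (gpr_aug res)
    (gpr_exact0 res) ul uK vK hpsi.
  by exists (fun p => psi (v (aug p))); split=> // p; rewrite gE pE.
apply: sqcorr_trans (shift i.+1 X) _.
rewrite (lifted_coboundaries (rgr_gmod (coindG hB X)) (rgr_gmod (cosyz hB X))
  (ghom_restr beta (coquo_graded hB X)) (@coquo_surj _ _ _ hB X) (hP i.+1)
  (jI (X := X)) (hP i) (gpr_d res i) (gpr_exact res (i := i)) (pP (i := i))).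
exact: ih.
Qed.

End OneRing.
End Balance.

Import Order.TTheory Num.Theory.

(** * Minimal resolutions *)

Section MinimalResolution.
Context (k : fieldType) (R : algType k) (gR : nat -> set R).
Context (hc : connected_graded gR).
Let hR := connected_graded_algebra hc.

Definition Rplus (M : lmodType R) : set M := [set x | forall S : set M, S 0 ->
  (forall x y, S x -> S y -> S (x - y)) ->
  (forall i a y, (0 < i)%N -> gR i a -> S (a *: y)) -> S x].

Section Rplus.
Context (M : lmodType R).

Lemma Rplus_ind (S : M -> Prop) x : Rplus x -> S 0 ->
  (forall x y, S x -> S y -> S (x - y)) ->
  (forall i a y, (0 < i)%N -> gR i a -> S (a *: y)) -> S x.
Proof. by move=> h; exact: (h S). Qed.

Lemma Rplus0 : Rplus (0 : M). Proof. by move=> S S0. Qed.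

Lemma RplusB (x y : M) : Rplus x -> Rplus y -> Rplus (x - y).
Proof. by move=> hx hy S S0 SB Sa; apply: (SB); [exact: hx | exact: hy]. Qed.

Lemma RplusN (x : M) : Rplus x -> Rplus (- x).
Proof. by move=> hx; rewrite -sub0r; apply: RplusB => //; exact: Rplus0. Qed.

Lemma RplusD (x y : M) : Rplus x -> Rplus y -> Rplus (x + y).
Proof. by move=> hx hy; rewrite -[y]opprK; apply: RplusB => //; exact: RplusN. Qed.

Lemma Rplus_act i a (y : M) : (0 < i)%N -> gR i a -> Rplus (a *: y).
Proof. by move=> i0 ga S S0 SB; apply; eauto. Qed.

Lemma Rplus_scale (c : k) (x : M) : Rplus x -> Rplus (c%:A *: x).
Proof.
move=> hx; apply: (Rplus_ind (S := fun x => Rplus (c%:A *: x)) hx) => [|y z hy hz|i a y i0 ga].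
- by rewrite scaler0; exact: Rplus0.
- by rewrite scalerBr; exact: RplusB.
- rewrite scalerA -scalerAl mul1r; exact: (Rplus_act _ i0 (cgr_scale hc c ga)).
Qed.

Lemma Rplus_submod : submod (@Rplus M : set (kres M)).
Proof.
split; first exact: Rplus0.
by move=> c x y hx hy; apply: RplusD => //; exact: Rplus_scale.
Qed.

Lemma Rplus_cmp (gM : int -> set M) : graded_module gR gM ->
  forall j x, Rplus x -> Rplus (cmp gM j x).
Proof.
move=> hM j x hx; have hs := gmod_sum hM; apply: (Rplus_ind (S := fun x => Rplus (cmp gM j x)) hx) => [|y z hy hz|i a y i0 ga].
- by rewrite cmp0 //; exact: Rplus0.
- by rewrite cmpB //; exact: RplusB.
- by rewrite (cmp_act hM _ _ ga); exact: (Rplus_act _ i0 ga).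
Qed.

End Rplus.

Lemma Rplus_map (M N : lmodType R) (f : M -> N) x : linear f -> Rplus x -> Rplus (f x).
Proof.
move=> fl hx; apply: (Rplus_ind (S := fun x => Rplus (f x)) hx) => [|y z hy hz|i a y i0 ga].
- by rewrite linear_fun0 //; exact: Rplus0.
- by rewrite (lin_sub fl); exact: RplusB.
- by rewrite (lin_scale _ _ fl); exact: (Rplus_act _ i0 ga).
Qed.

Definition bounded_below (V : zmodType) (gV : int -> set V) : Prop :=
  forall j x, gV j x -> j < 0 -> x = 0.

Section Cover.
Context (K : gmod gR).
Let gK := @ggr _ _ _ K.
Let hK : graded_module gR gK := gprf K.

(** Graded Nakayama requires a bound from below. Without one, the whole of K serves as space of
    generators, so that every graded module still has a free resolution, though not a minimal
    one. *)
Definition cov_set : set K := if pselect (bounded_below gK) then @Rplus K else [set 0].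

Lemma cov_set_submod : submod (cov_set : set (kres K)).
Proof.
rewrite /cov_set; case: pselect => ?; first exact: Rplus_submod.
by split=> // c x y /= x0 y0; rewrite x0 y0 scaler0 addr0.
Qed.

Lemma cov_set_cmp j x : cov_set x -> cov_set (cmp gK j x).
Proof.
rewrite /cov_set; case: pselect => ?; first exact: Rplus_cmp.
by move=> x0; rewrite [x]x0 /= cmp0 //; exact: (gmod_sum hK).
Qed.

Fact cov_proj_ex : exists e : K -> K,
  [/\ linear (e : kres K -> kres K), forall x, e x = 0 <-> cov_set x,
    forall x, cov_set (x - e x) & forall j x, gK j x -> gK j (e x)].
Proof.
apply: (@graded_proj _ k (kres K) gK cov_set) => //.
- exact: (gmod_sum hK).
- by move=> j c x; exact: (gmod_kscale hR hK).
- exact: cov_set_submod.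
- by move=> j x; exact: cov_set_cmp.
Qed.

Definition cov_proj : K -> K := sval (cid cov_proj_ex).
Let cov_projP := svalP (cid cov_proj_ex).
Let pl : linear (cov_proj : kres K -> kres K). Proof. by case: cov_projP. Qed.
Let el : linear (cov_proj : kres K -> kres K) := pl.
Let e0 x : cov_proj x = 0 <-> cov_set x. Proof. by case: cov_projP. Qed.
Let es x : cov_set (x - cov_proj x). Proof. by case: cov_projP. Qed.
Let eg j x : gK j x -> gK j (cov_proj x). Proof. by case: cov_projP => ? ? ?; apply. Qed.

Lemma cov_fix_submod :
  submod ([set x | cov_proj x - x = 0] : set (kres K)).
Proof. exact: (@submod_ker _ (kres K) (kres K) _ (lin_subf pl (@lin_id _ (kres K)))). Qed.

(* A graded complement of R_+ K, when K is bounded below; of 0 otherwise. *)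
Definition cov_gen : lmodType k := smod cov_fix_submod.
Definition gen_val (x : cov_gen) : K := smval (x : smod cov_fix_submod).
Definition cov_gen_gr : int -> set cov_gen := fun j => [set x | gK j (gen_val x)].

Lemma cov_gen_space : graded_space cov_gen_gr.
Proof.
have hs := gmod_sum hK; split; last first.
  by move=> j c x gx; exact: (gmod_kscale hR hK c gx).
apply: (@direct_sum_sub _ cov_gen K gK gen_val hs) => [x y //||x j].
  exact: (@smval_inj _ _ _ cov_fix_submod).
suff h : [set x : K | cov_proj x - x = 0] (cmp gK j (gen_val x)) by exists (smk cov_fix_submod h).
have h : cov_proj (gen_val x) - gen_val x = 0 := smvalP x.
have := @cmp_morph _ _ K K gK gK id cov_proj j (gen_val x) hs hs.
move=> /= <- //; last exact: (lin_add el).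
by rewrite -cmpB // h cmp0.
Qed.

Definition cov : gmod gR := Gmod (gfree hR cov_gen_space).
Definition cov_map : cov -> K :=
  flift (R := R) (V := cov_gen) (M := K) gen_val.

Let gen_lin : linear (gen_val : cov_gen -> kres K).
Proof. by move=> c x y; reflexivity. Qed.

Lemma cov_map_linear : linear cov_map. Proof. exact: (flift_linear gen_lin). Qed.

Lemma cov_map_graded : graded_hom (@ggr _ _ _ cov) gK 0 cov_map.
Proof. by apply: flift_graded => // j v; rewrite add0r. Qed.

Lemma cov_map_tens a (v : cov_gen) : cov_map (ftens a v) = a *: gen_val v.
Proof. exact: flift_tens. Qed.

Lemma cov_gen_range x : range cov_map (cov_proj x).
Proof.
suff h : [set x : K | cov_proj x - x = 0] (cov_proj x).
  by exists (ftens 1 (smk cov_fix_submod h)) => //; rewrite cov_map_tens scale1r.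
have /e0 : cov_set (x - cov_proj x) by exact: es.
by rewrite [LHS](lin_sub el) => e1; rewrite /= -opprB e1 oppr0.
Qed.

Lemma cov_surj : surjective_fun cov_map.
Proof.
have hs := gmod_sum hK.
have rsub := submod_im cov_map_linear.
suff h x : range cov_map x by move=> x; have [y _ <-] := h x; exists y.
have esx := es x; have [bd|nbd] := pselect (bounded_below gK); last first.
  move: esx; rewrite /cov_set; case: pselect => // ? /eqP; rewrite subr_eq0 => /eqP ->.
  exact: cov_gen_range.
have csE : cov_set = @Rplus K by rewrite /cov_set; case: pselect.
(* Graded Nakayama: y differs from its generator part by an element of R_+ K, whose component in
   degree j is a combination of a z with z of smaller degree, already in the range. *)
have main (m : nat) j y : gK j y -> j < m%:Z -> range cov_map y.
  elim: m j y => [|m ih] j y gy jm.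
    by rewrite (bd _ _ gy jm); case: rsub.
  have -> : y = cov_proj y + (y - cov_proj y) by rewrite addrC subrK.
  apply: (submod_add rsub); first exact: cov_gen_range.
  have -> : y - cov_proj y = cmp gK j (y - cov_proj y).
    by rewrite cmp_id //; apply: (grB hs) => //; exact: eg.
  have := es y; rewrite csE => hy; apply: (Rplus_ind (S := fun y => range cov_map (cmp gK j y)) hy) => [|z w hz hw|i a z i0 ga].
  - by rewrite cmp0 //; case: rsub.
  - by rewrite cmpB //; exact: submod_sub.
  rewrite (cmp_act hK _ _ ga); apply: (submod_scale rsub); apply: (ih (j - i%:Z)).
    exact: (cmp_in hs).
  by rewrite ltrBlDr -PoszD; apply: (lt_le_trans jm); rewrite lez_nat -addn1 leq_add2l.
move: x {esx}; apply: (gr_ind hs) => [|y z hy hz|j y gy]; first by case: rsub.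
  exact: submod_add.
case: j gy => j gy; first by apply: (main j.+1 _ _ gy); rewrite ltz_nat.
exact: (main 0%N _ _ gy).
Qed.

(** R is k plus its positive part, by connectedness. *)
Lemma fmod_Rplus (V : lmodType k) (x : fmod R V) : exists w, Rplus (x - ftens 1 w).
Proof.
move: x; apply: fmod_ind => [|x y [w hw] [z hz]|a v].
- by exists 0; rewrite (linear_fun0 (@ftens_linear _ R V 1)) subrr; exact: Rplus0.
- exists (w + z); rewrite (lin_add (@ftens_linear _ R V 1)) opprD addrACA.
  exact: RplusD.
move: a; apply: (gr_ind (cgr_sum hc)) => [|a b [w hw] [z hz]|i a ga].
- exists 0; rewrite (linear_fun0 (@ftens_linear_l _ R V v)).
  by rewrite (linear_fun0 (@ftens_linear _ R V 1)) subrr; exact: Rplus0.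
- exists (w + z); rewrite (lin_add (@ftens_linear _ R V 1)) (lin_add (@ftens_linear_l _ R V v)).
  by rewrite opprD addrACA; exact: RplusD.
case: i ga => [/(cgr_conn hc)[c ->]|i ga].
  exists (c *: v); rewrite (lin_scale _ _ (@ftens_linear _ R V 1)) ftens1.
  by rewrite [X in _ - X]restrE subrr; exact: Rplus0.
exists 0; rewrite (linear_fun0 (@ftens_linear _ R V 1)) subr0 ftens1.
exact: (Rplus_act _ (ltn0Sn i) ga).
Qed.

(** Modulo the positive part, x is some 1 ⊗ w. Applying the cover puts w both in R_+ K and in its
    complement, so w = 0. *)
Lemma cov_minimal : bounded_below gK -> forall x, cov_map x = 0 -> Rplus x.
Proof.
move=> bd x x0.
have csE : cov_set = @Rplus K by rewrite /cov_set; case: pselect.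
have [w hw] := fmod_Rplus x; have := Rplus_map cov_map_linear hw.
rewrite (lin_sub cov_map_linear) x0 sub0r cov_map_tens scale1r => /RplusN.
rewrite opprK -csE => /e0 ew; have w0 : w = 0.
  apply: (@smval_inj _ _ _ cov_fix_submod); have : cov_proj (gen_val w) - gen_val w = 0 := smvalP w.
  by rewrite ew sub0r => /eqP; rewrite oppr_eq0 => /eqP.
by move: hw; rewrite w0 (linear_fun0 (@ftens_linear _ R cov_gen 1)) subr0.
Qed.

Lemma cov_bounded : bounded_below gK -> bounded_below (@ggr _ _ _ cov).
Proof.
move=> bd n x hx n0; apply: (hx (fun x => x = 0)) => [//|y z -> ->|i j a v ga gv ijn].
  by rewrite subr0.
have v0 : v = 0.
  apply: (@smval_inj _ _ _ cov_fix_submod); apply: (bd j _ gv).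
  by apply: le_lt_trans n0; rewrite -ijn lerDr.
by rewrite v0 (linear_fun0 (@ftens_linear _ R cov_gen a)).
Qed.

Fact syz_cmp j x : [set x | cov_map x = 0] x ->
  [set x | cov_map x = 0] (cmp (@ggr _ _ _ cov) j x).
Proof. by move=> x0; exact: (ghom_ker (gprf cov) hK cov_map_graded). Qed.

Definition syz : gmod gR := Gmod (gsub (gprf cov) (submod_ker cov_map_linear) syz_cmp).
Definition syz_inc : syz -> cov := fun x => smval x.

Lemma syz_inc_graded : graded_hom (@ggr _ _ _ syz) (@ggr _ _ _ cov) 0 syz_inc.
Proof. by split=> [a x y|j x]; [reflexivity | rewrite add0r]. Qed.

Lemma syz_inc_inj : injective syz_inc. Proof. exact: smval_inj. Qed.

Lemma syz_exact : exact_at syz_inc cov_map.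
Proof.
move=> x; split=> [x0|[y <-]]; last exact: (smvalP y).
by exists (smk (submod_ker cov_map_linear) x0).
Qed.

Lemma syz_bounded : bounded_below gK -> bounded_below (@ggr _ _ _ syz).
Proof.
by move=> /cov_bounded bd j x gx j0; apply: syz_inc_inj; exact: (bd j _ gx j0).
Qed.

End Cover.

Fixpoint syzn (i : nat) (K : gmod gR) : gmod gR :=
  if i is i'.+1 then syz (syzn i' K) else K.

Lemma syznS i K : syzn i.+1 K = syzn i (syz K).
Proof. by elim: i => //= i ->. Qed.

Section Resolution.
Context (K : gmod gR).

Definition res (i : nat) : lmodType R := cov (syzn i K).
Definition res_gr (i : nat) : int -> set (res i) := @ggr _ _ _ (cov (syzn i K)).
Definition res_d (i : nat) (x : res i.+1) : res i :=
  syz_inc (cov_map (K := syzn i.+1 K) x).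
Definition res_aug : res 0 -> K := @cov_map K.

Lemma res_resolution :
  graded_projective_resolution gR (@ggr _ _ _ K) res_gr res_d res_aug.
Proof.
split.
- by move=> i; apply: (free_graded_projective hR); exact: cov_gen_space.
- move=> i; have := ghom_comp (syz_inc_graded (syzn i K)) (cov_map_graded (syzn i.+1 K)).
  by rewrite addr0.
- exact: cov_map_graded.
- exact: cov_surj.
- move=> x; split=> [/syz_exact[y <-]|[y <-]].
    by have [z <-] := cov_surj y; exists z.
  by apply/syz_exact; exists (cov_map (K := syz K) y).
move=> i x; split=> [dx|[y <-]].
  have : cov_map (K := syzn i.+1 K) x = 0.
    by apply: syz_inc_inj; rewrite [LHS]dx.
  by move=> /syz_exact[y <-]; have [z <-] := cov_surj y; exists z.
have e1 : cov_map (K := syzn i.+1 K) (res_d y) = 0 by apply/syz_exact; exists (cov_map y).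
exact: (congr1 (@syz_inc (syzn i K)) e1).
Qed.

Lemma syzn_bounded i : bounded_below (@ggr _ _ _ K) -> bounded_below (@ggr _ _ _ (syzn i K)).
Proof. by move=> bd; elim: i => //= i; exact: syz_bounded. Qed.

(* The complex of maps from the minimal resolution to a trivial module has zero
   differential. *)
Lemma syzn_vanish (T : lmodType R) (gT : int -> set T) (i : nat) (tau : T) :
  graded_module gR gT -> (forall j x, gT j x -> j != 0 -> x = 0) -> tau != 0 ->
  bounded_below (@ggr _ _ _ K) ->
  (forall e f, gcoc res_gr res_d gT i.+1 e f -> gcob res_gr res_d gT i.+1 e f) ->
  forall x : syzn i.+1 K, x = 0.
Proof.
move=> hT hT0 tau0 bd hv.
have hTact j a x : (0 < j)%N -> gR j a -> a *: (x : T) = 0 by exact: (concentrated_act hT hT0).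
have kill (M : lmodType R) (f : M -> T) x : linear f -> Rplus x -> f x = 0.
  move=> fl hx; apply: (Rplus_ind (S := fun x => f x = 0) hx) => [|y z hy hz|j a y j0 ga].
  - exact: linear_fun0.
  - by rewrite (lin_sub fl) hy hz subr0.
  - by rewrite (lin_scale _ _ fl) (hTact _ _ _ j0 ga).
have kmin l (x : cov (syzn l K)) : cov_map x = 0 -> Rplus x.
  by move=> x0; exact: (cov_minimal (syzn_bounded bd) x0).
have dR l (x : res l.+1) : Rplus (res_d x) by apply: kmin; exact: (smvalP (cov_map x)).
pose V := cov_gen (syzn i.+1 K); pose gV := @cov_gen_gr (syzn i.+1 K).
have hV : graded_space gV := cov_gen_space (syzn i.+1 K).
have V0 (v : V) : v = 0.
  move: v; apply: (gr_ind (gsp_sum hV)) => [//|x y -> ->|j v gv]; first by rewrite addr0.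
  apply/eqP; apply: contrapT => /negP/exists_functional[lam [ll lv]].
  (* A nonzero generator v of degree j gives a cochain of degree -j with value [tau] at 1 ⊗ v. It is
     a cocycle because the differential lands in R_+, and for the same reason every coboundary
     vanishes at 1 ⊗ v. *)
  pose g (x : V) : T := (lam (cmp gV j x) : k)%:A *: tau.
  have cmpl := cmp_linear (gsp_sum hV) (gsp_scale hV) j.
  have gl : linear (g : V -> kres T).
    have E (c a b : k) : (c * a + b)%:A *: tau = c%:A *: (a%:A *: tau) + b%:A *: tau.
      by rewrite !scalerDl scalerA -scalerAl mul1r scalerA.
    by move=> c x y; rewrite /g cmpl ll; exact: E.
  have hf : graded_hom (@res_gr i.+1) gT (- j) (flift g).
    apply: flift_graded => // l x gx; have [->|ne] := eqVneq l j.
      rewrite addNr; exact: (gmod_kscale hR hT _ (concentrated_gr hT hT0 tau)).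
    rewrite /g (cmp_ne (gsp_sum hV) gx) 1?eq_sym // (linear_fun0 ll) scale0r scale0r.
    exact: (gr0 (gmod_sum hT)).
  have [|g' [hg' gE]] := hv (- j) (flift g).
    by split=> // x; apply: kill (dR _ x); exact: flift_linear.
  have : flift g (ftens 1 v) = 0.
    by rewrite gE; apply: kill (dR _ _); exact: (ghom_lin hg').
  rewrite flift_tens // scale1r /g (cmp_id (gsp_sum hV) gv) lv scale1r scale1r.
  by move/eqP: tau0.
move=> x; have [y <-] := cov_surj x; suff -> : y = 0 by rewrite (linear_fun0 (@cov_map_linear _)).
move: y; apply: fmod_ind => [//|y z -> ->|a v]; first by rewrite addr0.
by rewrite [v]V0 (linear_fun0 (@ftens_linear _ R _ a)).
Qed.

End Resolution.
End MinimalResolution.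

(** * Filtered deformations of graded modules *)

Section ProjDim.
Context (R : nzRingType).

Lemma zero_projective : projective_module ('rV[R]_0 : lmodType R).
Proof.
move=> M N g f _; exists (mklin (@lin_zero R 'rV[R]_0 M)) => x.
have -> : x = 0 by apply/rowP => -[].
by rewrite !linear0.
Qed.

Lemma proj_dim_le_projective (P M : lmodType R) (q : {linear P -> M}) :
  projective_module P -> surjective_fun q -> (forall x, q x = 0 -> x = 0) ->
  proj_dim_le M 0.
Proof.
move=> pP qs qi.
pose Q (i : nat) : lmodType R := if i is 0 then P else 'rV[R]_0.
pose d i : {linear Q i.+1 -> Q i} := mklin (@lin_zero R (Q i.+1) (Q i)).
have z0 (x y : 'rV[R]_0) : x = y by apply/rowP => -[].
exists Q, d, q; split=> //.
- by case=> [//|i]; exact: zero_projective.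
- move=> x; split=> [/qi ->|[y <-]]; first by exists 0; rewrite linear0.
  by rewrite linear0.
- by move=> i x; split=> _; [exists 0; exact: z0 | by []].
- by case=> [//|i] _ x; exact: z0.
Qed.

Lemma proj_dim_le_step (P M : lmodType R) (q : {linear P -> M}) (m : nat) :
  projective_module P -> surjective_fun q ->
  proj_dim_le (smod (submod_ker (linearP q))) m -> proj_dim_le M m.+1.
Proof.
move=> pP qs [Q [d [aug [hQ hs h0 h hv]]]].
pose Q' (i : nat) : lmodType R := if i is i'.+1 then Q i' else P.
pose d' i : {linear Q' i.+1 -> Q' i} :=
  match i return {linear Q' i.+1 -> Q' i} with
  | 0 => mklin (lin_comp (@smval_linear _ _ _ (submod_ker (linearP q))) (linearP aug))
  | i'.+1 => d i'
  end.
exists Q', d', q; split=> //.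
- by case=> [|i]; [exact: pP | exact: hQ].
- move=> x; split=> [x0|[y <-]]; last exact: (smvalP (aug y)).
  have [y yE] := hs (smk (submod_ker (linearP q)) x0).
  by exists y; rewrite /= yE.
- case=> [|i]; last exact: h.
  move=> x; split=> [x0|[y <-]].
    by apply/h0; apply: smval_inj; exact: x0.
  by have -> : d' 0%N (d' 1%N y) = smval (aug (d 0%N y)) by []; have -> : aug (d 0%N y) = 0 by apply/h0; exists y.
- by case=> [//|i] im x; exact: (hv i).
Qed.

End ProjDim.

(** * The degree filtration *)

Section Below.
Context (k : fieldType) (R : algType k) (gR : nat -> set R).
Context (hR : graded_algebra gR).

Section OneModule.
Context (M : lmodType R) (gM : int -> set M) (hM : graded_module gR gM).
Let hs := gmod_sum hM.

(** The bound is strict: an element of degree n is [below (n + 1)]. A difference that is [below n]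
    thus says that two elements agree in their terms of degree n and higher. *)
Definition below (m : int) (x : M) : Prop := forall l, m <= l -> cmp gM l x = 0.

Lemma below0 m : below m 0. Proof. by move=> l _; exact: (cmp0 hs). Qed.
Lemma belowB m x y : below m x -> below m y -> below m (x - y).
Proof. by move=> hx hy l ml; rewrite (cmpB hs) hx // hy // subrr. Qed.
Lemma belowN m x : below m x -> below m (- x).
Proof. by move=> hx; rewrite -sub0r; apply: belowB => //; exact: below0. Qed.
Lemma belowD m x y : below m x -> below m y -> below m (x + y).
Proof. by move=> hx hy; rewrite -[y]opprK; apply: belowB => //; exact: belowN. Qed.
Lemma below_le m m' x : m <= m' -> below m x -> below m' x.
Proof. by move=> mm hx l ml; apply: hx; exact: le_trans ml. Qed.
Lemma below_gr n m x : gM n x -> n < m -> below m x.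
Proof.
move=> gx nm l ml; apply: (cmp_ne hs gx).
by rewrite gt_eqF // (lt_le_trans nm ml).
Qed.
Lemma below_act i a m x : gR i a -> below m x -> below (i%:Z + m) (a *: x).
Proof.
move=> ga hx l ml; rewrite (cmp_act hM _ _ ga) hx ?scaler0 //.
by rewrite lerBrDl.
Qed.
Lemma below_cmp n x : below (n + 1) x -> below n (x - cmp gM n x).
Proof.
move=> hx l nl; rewrite (cmpB hs) (cmp_idem hs).
have [->|ne] := eqVneq l n; first by rewrite subrr.
by rewrite subr0; apply: hx; rewrite lezD1 lt_neqAle eq_sym ne.
Qed.
Lemma below_neg m x : bounded_below gM -> below m x -> m <= 0 -> x = 0.
Proof.
move=> bd hx m0; apply: (cmp_ext hs) => l; rewrite (cmp0 hs).
have [l0|l0] := ltP l 0; first exact: (bd l _ (cmp_in hs l x)).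
by apply: hx; exact: le_trans l0.
Qed.
Lemma below_ex x : exists m : nat, below m%:Z x.
Proof.
move: x; apply: (gr_ind hs) => [|x y [m hm] [n hn]|j x gx].
- by exists 0%N; exact: below0.
- exists (m + n)%N; apply: belowD; [apply: below_le hm|apply: below_le hn];
    by rewrite PoszD ?lerDl ?lerDr.
case: j gx => j gx; [exists j.+1 | exists 0%N]; apply: (below_gr gx) => //.
by rewrite ltz_nat.
Qed.

End OneModule.

Section Maps.
Context (M N : lmodType R) (gM : int -> set M) (gN : int -> set N).
Context (hM : graded_module gR gM) (hN : graded_module gR gN).

Lemma below_hom f m x : graded_hom gM gN 0 f -> below gM m x -> below gN m (f x).
Proof.
move=> hf hx l ml; rewrite (ghom_cmp hM hN _ _ hf) subr0 hx //.
exact: (linear_fun0 (ghom_lin hf)).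
Qed.

Lemma below_klin f m x : linear (f : kres M -> kres N) ->
  (forall j x, gM j x -> gN j (f x)) -> below gM m x -> below gN m (f x).
Proof.
move=> fl fg hx l ml.
have := @cmp_morph _ _ M N gM gN id f l x (gmod_sum hM) (gmod_sum hN).
move=> /= -> //; last exact: (lin_add fl).
by rewrite hx // [LHS](linear_fun0 fl).
Qed.

Lemma below_lower (f : M -> N) m x : {morph f : x y / x + y} ->
  (forall n x, gM n x -> below gN n (f x)) -> below gM (m + 1) x -> below gN m (f x).
Proof.
move=> fD fg hx; have f0 : f 0 = 0 by apply: (@addrI _ (f 0)); rewrite -fD !addr0.
have [s [_ _ _ ->]] := cmp_decomp (gmod_sum hM) x.
rewrite (big_morph f fD f0); apply: big_ind => [|y z|j _].
- exact: below0.
- exact: belowD.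
have [jm|jm] := leP j m; first by apply: below_le jm _; apply/fg/(cmp_in (gmod_sum hM)).
by rewrite hx ?f0 ?lezD1 //; exact: below0.
Qed.

End Maps.

(** [th] is the identity plus a map lowering the degree, and in a bounded below module the degree
    can be lowered only finitely often. Removing leading terms one by one inverts [th] and respects
    the filtration. *)
Lemma unipotent_inverse (M : lmodType R) (gM : int -> set M) (th : M -> M) :
  graded_module gR gM -> bounded_below gM -> linear (th : kres M -> kres M) ->
  (forall n x, gM n x -> below gM n (th x - x)) ->
  exists ti : M -> M, [/\ linear (ti : kres M -> kres M), cancel ti th
    & forall m x, below gM m x -> below gM m (ti x)].
Proof.
move=> hM bd tl tb; have hs := gmod_sum hM.
have tD : {morph th : x y / x + y} := lin_add tl.
have tB : {morph th : x y / x - y} := lin_sub tl.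
have t0 : th 0 = 0 := linear_fun0 tl.
have low m x : below gM (m + 1) x -> below gM m (th x - x).
  apply: (below_lower (f := fun x => th x - x) hM hM) => [y z|]; last exact: tb.
  by rewrite tD opprD addrACA.
have inj0 x : th x = 0 -> x = 0.
  move=> tx; have [m hm] := below_ex hM x; elim: m hm => [|m ih] hm.
    exact: (below_neg hM bd hm).
  apply: ih; rewrite -[x]opprK; apply: (belowN hM); rewrite -[- x]add0r -tx; apply: low.
  by rewrite intS addrC in hm.
have inj : injective th.
  by move=> x y e; apply/eqP; rewrite -subr_eq0; apply/eqP/inj0; rewrite tB e subrr.
have surj (m : nat) y : below gM m y -> exists x, below gM m x /\ th x = y.
  elim: m y => [|m ih] y hy.
    by exists 0; split; [exact: below0|rewrite t0 (below_neg hM bd hy)].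
  rewrite intS addrC in hy; pose z := cmp gM m y.
  have gz : gM m z := cmp_in hs m y.
  have [|x [hx tx]] := ih (y - th z).
    have -> : y - th z = (y - z) - (th z - z) by rewrite opprB addrA subrK.
    by apply: (belowB hM); [exact: below_cmp|exact: tb].
  exists (z + x); split; last by rewrite tD tx addrC subrK.
  apply: (belowD hM); first by apply: (below_gr hM gz); rewrite ltz_nat.
  by apply: below_le hx; rewrite lez_nat.
have surjZ (m : int) y : below gM m y -> exists x, below gM m x /\ th x = y.
  case: m => m; first exact: surj.
  move=> hy; exists 0; split; first exact: (below0 hM).
  by rewrite t0 (below_neg hM bd hy).
have ex y : exists x, th x = y.
  by have [m hm] := below_ex hM y; have [x [_ e]] := surj _ _ hm; exists x.
have [ti tiK] := choice ex; exists ti; split=> //.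
- by apply: (lin_inv (M := kres M) (N := kres M) tl) => // x; apply: inj; rewrite tiK.
- move=> m x /surjZ[y [hy e]]; have -> : ti x = y by apply: inj; rewrite tiK e.
  exact: hy.
Qed.

End Below.

Section Deformation.
Context (k : fieldType) (R : algType k) (gR : nat -> set R).
Context (hc : connected_graded gR).
Let hR := connected_graded_algebra hc.

(* W is a filtered module whose associated graded module is V. *)
Record deformation (V : gmod gR) (W : lmodType R) (J : V -> W) (Ji : W -> V) : Prop := {
  deform_lin : linear (J : kres V -> kres W);
  deform_K : cancel J Ji;
  deform_iK : cancel Ji J;
  deform_act : forall i a n x, gR i a -> ggr n x ->
    below (@ggr _ _ _ V) (i%:Z + n) (Ji (a *: J x) - a *: x)
}.

(** The map q from the cover of V sends 1 ⊗ v to J v and agrees with J p up to lower terms, p being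
    the cover map. So q is onto like p, and an element of ker p becomes one of ker q after a
    correction by lower terms: ker q is a deformation of the syzygy. *)
Lemma deformation_step (V : gmod gR) (W : lmodType R) J Ji :
  bounded_below (@ggr _ _ _ V) -> deformation (V := V) (W := W) J Ji ->
  exists (q : {linear cov hc V -> W}), surjective_fun q /\
  exists (J' : syz hc V -> smod (submod_ker (linearP q))) Ji', deformation J' Ji'.
Proof.
move=> bd [Jl JK JiK Jact].
pose F := cov hc V; pose gF := @ggr _ _ _ F; have hF : graded_module gR gF := gprf F.
pose gV := @ggr _ _ _ V; have hV : graded_module gR gV := gprf V.
have bdF : bounded_below gF := cov_bounded bd.
have JD : {morph J : x y / x + y} := lin_add Jl.
have JB : {morph J : x y / x - y} := lin_sub Jl.
have Jil : linear (Ji : kres W -> kres V) := lin_inv (M := kres V) (N := kres W) Jl JK JiK.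
have JiB : {morph Ji : x y / x - y} := lin_sub Jil.
have JiD : {morph Ji : x y / x + y} := lin_add Jil.
have gl : linear ((fun v => J (gen_val v)) : cov_gen hc V -> kres W).
  by move=> c x y; rewrite -Jl; congr J.
pose q : {linear F -> W} := mklin (flift_linear gl).
pose p : F -> V := @cov_map _ _ _ hc V.
have hp : graded_hom gF gV 0 p := cov_map_graded hc V.
have pl : linear p := ghom_lin hp.
pose del x := Ji (q x) - p x.
have delB : {morph del : x y / x - y}.
  by move=> x y; rewrite /del linearB JiB (lin_sub pl) !opprD !opprK addrACA.
have del0 : del 0 = 0 by rewrite -[X in del X](subrr 0) delB subrr.
have delD : {morph del : x y / x + y}.
  move=> x y; rewrite -{1}[y]opprK delB; congr (_ + _).
  by rewrite -[- y]sub0r delB del0 sub0r opprK.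
have del_low n x : gF n x -> below gV n (del x).
  move=> hx; apply: (hx (fun x => below gV n (del x))) => [|y z hy hz|i j a v ga gv <-].
  - by rewrite del0; exact: (below0 hV).
  - by rewrite delB; exact: (belowB hV).
  - by rewrite /del mklinE flift_tens // /p cov_map_tens; exact: Jact.
have pg j x : gF j x -> gV j (p x) by move=> gx; rewrite -[j]add0r; exact: (ghom_gr hp).
have [s [sl sg sK]] := gmod_pinv hR hF hV (klin_restr pl) pg.
have psur x : p (s x) = x by have [y <-] := cov_surj hc x; exact: sK.
(* With [s] a graded section of p, this composite is the identity up to lower terms, hence
   invertible; surjectivity of q follows. *)
have thl : linear ((fun x => Ji (q (s x))) : kres V -> kres V).
  by apply: (lin_comp Jil); apply: (lin_comp (klin_restr (linearP q)) sl).
have [|ti [til tiK tib]] := unipotent_inverse hV bd thl.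
  by move=> n x gx; rewrite -{2}[x]psur; apply: del_low; exact: sg.
have qsur : surjective_fun q.
  move=> w; exists (s (ti (Ji w))); apply: (can_inj JiK).
  exact: (tiK (Ji w)).
exists q; split=> //.
pose W' := smod (submod_ker (linearP q)).
pose K := syz hc V; pose gK := @ggr _ _ _ K; have hK : graded_module gR gK := gprf K.
pose inc : K -> F := @syz_inc _ _ _ hc V.
have hinc : graded_hom gK gF 0 inc := syz_inc_graded hc V.
have il := ghom_lin hinc.
have iD := lin_add il; have iB := lin_sub il.
have cmpi l x : cmp gF l (inc x) = inc (cmp gK l x).
  by rewrite (ghom_cmp hK hF _ _ hinc) subr0.
have binc m x : below gF m (inc x) -> below gK m x.
  by move=> hx l ml; apply: (@syz_inc_inj _ _ _ hc V); rewrite -[LHS]cmpi hx.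
have pinc x : p (inc x) = 0 by apply/syz_exact; exists x.
(* The correction term. As p vanishes on x, [del] reduces there to Ji q, and inverting Ji q s gives
   q (rho x) = q x; moreover rho lowers the filtration. *)
pose rho (x : K) : F := s (ti (del (inc x))).
have rl : linear (rho : kres K -> kres F).
  have dl : linear (del : kres F -> kres V).
    apply: (lin_subf (M := kres F) (N := kres V)); last exact: (klin_restr pl).
    exact: (lin_comp Jil (klin_restr (linearP q))).
  exact: (lin_comp sl (lin_comp til (lin_comp dl (klin_restr il)))).
have rlow m x : below gK (m + 1) x -> below gF m (rho x).
  move=> hx; apply: (below_klin hV hF sl sg); apply: tib.
  by apply: (below_lower hF hV delD del_low); exact: (below_hom hK hF hinc).
have rlow' n x : gK n x -> below gF n (rho x).
  by move=> gx; apply: rlow; apply: (below_gr hK gx); rewrite ltrDl.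
have qr x : q (inc x - rho x) = 0.
  rewrite linearB; apply/eqP; rewrite subr_eq0; apply/eqP/(can_inj JiK).
  rewrite [RHS]tiK /del pinc subr0 //.
pose J' (x : K) : W' := smk (submod_ker (linearP q)) (qr x).
have J'E x : smval (J' x) = inc x - rho x by [].
have J'l : linear (J' : kres K -> kres W').
  move=> c x y; apply: smval_inj; rewrite J'E [rho _]rl [inc _](klin_restr il).
  by rewrite opprD addrACA -[X in _ + X]J'E; congr (_ + _); exact/esym/scalerBr.
have inj0 x : J' x = 0 -> x = 0.
  move=> /(congr1 (@smval _ _ _ _)) /= /eqP; rewrite subr_eq0 => /eqP e.
  have [m hm] := below_ex hK x; elim: m hm => [|m ih] hm.
    exact: (below_neg hK (syz_bounded bd) hm).
  by apply/ih/binc; rewrite e; apply: rlow; rewrite addrC -intS.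
have surj (m : nat) (y : F) : q y = 0 -> below gF m y ->
    exists x : K, below gK m x /\ inc x - rho x = y.
  elim: m y => [|m ih] y qy hy.
    exists 0; split; first exact: (below0 hK).
    by rewrite (below_neg hF bdF hy) // (linear_fun0 il) [rho 0](linear_fun0 rl) subr0.
  rewrite intS addrC in hy.
  (* On ker q one has p y = - del y, of lower degree than y; so the leading component of y lies in
     ker p and can be removed. *)
  have py : p (cmp gF m y) = 0.
    have := ghom_cmp hF hV m y hp; rewrite subr0 => <-.
    have -> : p y = - del y by rewrite /del qy [Ji 0](linear_fun0 Jil) sub0r opprK.
    rewrite (cmpN (gmod_sum hV)) (below_lower hF hV delD del_low hy) ?oppr0 //.
  have /syz_exact[x1 x1E] := py.
  have gx1 : gK m x1.
    have : gF m (inc x1) by rewrite [inc x1]x1E; exact: (cmp_in (gmod_sum hF)).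
    by [].
  have [||x2 [hx2 x2E]] := ih (y - (inc x1 - rho x1)).
  - by rewrite linearB qy qr subr0.
  - have -> : y - (inc x1 - rho x1) = (y - cmp gF m y) + rho x1.
      by rewrite opprB [inc x1]x1E addrA addrAC.
    by apply: (belowD hF); [exact: (below_cmp hF)|exact: rlow'].
  exists (x1 + x2); split.
    apply: (belowD hK); first by apply: (below_gr hK gx1); rewrite ltz_nat.
    by apply: below_le hx2; rewrite lez_nat.
  by rewrite iD [rho _](lin_add rl) opprD addrACA x2E addrC subrK.
have surjZ (m : int) (y : F) : q y = 0 -> below gF m y ->
    exists x : K, below gK m x /\ inc x - rho x = y.
  case: m => m; first exact: surj.
  move=> _ hy; exists 0; split; first exact: (below0 hK).
  by rewrite (below_neg hF bdF hy) // (linear_fun0 il) [rho 0](linear_fun0 rl) subr0.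
have ex (y : W') : exists x, J' x = y.
  have [m hm] := below_ex hF (smval y); have [x [_ e]] := surj _ _ (smvalP y) hm.
  by exists x; apply: smval_inj.
have inj : injective J'.
  move=> x y e; apply/eqP; rewrite -subr_eq0; apply/eqP/inj0.
  by rewrite [LHS](lin_sub J'l) e subrr.
have [Ji' Ji'K] := choice ex; exists J', Ji'; split.
- exact: J'l.
- by move=> x; apply: inj; rewrite Ji'K.
- exact: Ji'K.
move=> i a n x ga gx.
pose z := Ji' (a *: J' x).
(* The failure of J' to commute with a is the difference of two correction terms, hence of lower
   degree; the bound in [surjZ] passes this on to its preimage. *)
have zE : smval (J' (z - a *: x)) = rho (a *: x) - a *: rho x.
  have -> : J' (z - a *: x) = J' z - J' (a *: x) := lin_sub J'l _ _.
  rewrite Ji'K; have -> : smval (a *: J' x - J' (a *: x)) = a *: smval (J' x) - smval (J' (a *: x)) by [].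
  by rewrite !J'E (lin_scale _ _ il) scalerBr opprB addrC addrA subrK.
have [|x' [hx' x'E]] := surjZ (i%:Z + n) _ (smvalP (J' (z - a *: x))).
  rewrite zE; apply: (belowB hF); last by apply: (below_act hF ga); exact: rlow'.
  by apply: rlow'; exact: (gmod_act hK ga gx).
suff <- : x' = z - a *: x by [].
by apply: inj; apply: smval_inj; rewrite J'E x'E.
Qed.

(** The successive kernels are deformations of the syzygies of V, and a deformation of 0 is 0. The
    deformed covers therefore form a projective resolution of W that stops with them. *)
Lemma proj_dim_le_deformation (j : nat) : forall (V : gmod gR) (W : lmodType R) J Ji,
  bounded_below (@ggr _ _ _ V) -> deformation (V := V) (W := W) J Ji ->
  (forall x : syzn hc j.+1 V, x = 0) -> proj_dim_le W j.
Proof.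
elim: j => [|j ih] V W J Ji bd hJ hs; have [q [qs [J' [Ji' hJ']]]] := deformation_step bd hJ.
  apply: (proj_dim_le_projective _ qs); first exact: free_projective.
  move=> x qx; have /(congr1 (@smval _ _ _ _)) : smk (submod_ker (linearP q)) qx = 0.
    have e1 : Ji' (smk (submod_ker (linearP q)) qx) = 0 := hs _.
    by rewrite -[LHS](deform_iK hJ') e1 [LHS](linear_fun0 (deform_lin hJ')).
  by [].
apply: (proj_dim_le_step _ qs); first exact: free_projective.
apply: ih hJ' _; first exact: syz_bounded.
by move: hs; rewrite syznS.
Qed.

Lemma augmentation_ex : exists eps : {lrmorphism R -> k^o},
  (forall i a, (0 < i)%N -> gR i a -> eps a = 0) /\
  forall a, gR 0%N a -> a = (eps a : k)%:A.
Proof.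
have hs := cgr_sum hc.
have ex a : exists c : k, cmp gR 0%N a = c%:A by apply/(cgr_conn hc)/(cmp_in hs).
have [eps epsE] := choice ex.
have inj (c d : k) : c%:A = d%:A :> R -> c = d.
  move=> e; apply/eqP; rewrite -subr_eq0; apply: contraT => cd.
  have : (c - d) *: (1 : R) == 0 by rewrite scalerBl e subrr.
  by rewrite scaler_eq0 (negPf cd) oner_eq0.
have uni a c : cmp gR 0%N a = c%:A -> eps a = c by move=> e; apply: inj; rewrite -epsE.
have cmpZ j (c : k) a := lin_scale c a (cmp_linear hs (cgr_scale hc) j).
have el : linear (eps : R -> k^o).
  move=> c a b; apply: uni; rewrite (cmpD hs) cmpZ !epsE scalerA.
  by rewrite -[_ + _]scalerDl.
have ep i a : (0 < i)%N -> gR i a -> eps a = 0.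
  move=> i0 ga; apply: uni; rewrite (cmp_ne hs ga) ?scale0r //.
  by case: i i0 {ga}.
have e1 : eps 1 = 1 by apply: uni; rewrite (cmp_id hs (galg_one hR)) scale1r.
have eD := lin_add el; have e0 := linear_fun0 el.
have eM a b : eps (a * b) = eps a * eps b.
  move: a; apply: (gr_ind hs) => [|a a' ea ea'|i a ga].
  - by rewrite mul0r [eps 0]e0 mul0r.
  - by rewrite mulrDl [eps _]eD ea ea' -mulrDl; congr (_ * _); exact/esym/eD.
  move: b; apply: (gr_ind hs) => [|b b' eb eb'|j b gb].
  - by rewrite mulr0 [eps 0]e0 mulr0.
  - by rewrite mulrDr [eps _]eD eb eb' -mulrDr; congr (_ * _); exact/esym/eD.
  have gab := cgr_mul hc ga gb.
  case: i ga gab => [|i] ga gab; last first.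
    by rewrite (ep _ _ (ltn0Sn i) ga) mul0r; exact: (ep _ _ (ltn0Sn _) gab).
  have aE : a = (eps a)%:A by rewrite -epsE cmp_id.
  by rewrite {1}aE -scalerAl mul1r [LHS](lin_scale _ _ el).
pose f : {lrmorphism R -> k^o} := HB.pack (eps : R -> k^o)
  (GRing.isLinear.Build k R k^o _ _ el)
  (GRing.isMonoidMorphism.Build R k^o _ (e1, eM)).
exists f; split=> // a ga; rewrite -epsE cmp_id //.
Qed.

Definition augm : {lrmorphism R -> k^o} := sval (cid augmentation_ex).

Lemma augm_pos i a : (0 < i)%N -> gR i a -> augm a = 0.
Proof. by have [h _] := svalP (cid augmentation_ex); exact: h. Qed.

Lemma augm0 a : gR 0%N a -> a = (augm a : k)%:A.
Proof. by have [_ h] := svalP (cid augmentation_ex); exact: h. Qed.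

Definition augmk : {rmorphism R -> k} := augm.
End Deformation.

(** * Vanishing of Ext and injective dimension *)

Section Schanuel.
Context (k : fieldType) (R : algType k).

Lemma lin_factor (P1 P0 N X : lmodType R) (d : P1 -> P0) (f : P1 -> X) (h : N -> P0) :
  linear d -> linear f -> linear h -> (forall x, d x = 0 -> f x = 0) ->
  (forall y, range d (h y)) ->
  exists g : N -> X, linear g /\ forall y x, d x = h y -> g y = f x.
Proof.
move=> dl fl hl df hd.
have ex y : exists x, d x = h y by have [x _ e] := hd y; exists x.
have [c cE] := choice ex.
have uni y x : d x = h y -> f (c y) = f x.
  move=> e; apply/eqP; rewrite -subr_eq0 -(lin_sub fl); apply/eqP/df.
  by rewrite (lin_sub dl) cE e subrr.
exists (fun y => f (c y)); split=> // a x y.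
by rewrite -fl; apply: uni; rewrite dl !cE hl.
Qed.

(* A projective resolution of the submodule S of Z. *)
Record pres (Z : lmodType R) (S : set Z) (P : nat -> lmodType R)
    (d : forall i, P i.+1 -> P i) (aug : P 0%N -> Z) : Prop := {
  pres_proj : forall i, projective_module (P i);
  pres_d : forall i, linear (d i);
  pres_aug : linear aug;
  pres_img : forall z, S z <-> range aug z;
  pres_exact0 : exact_at (d 0%N) aug;
  pres_exact : forall i, exact_at (d i.+1) (d i)
}.

Lemma projective_prod (P Q : lmodType R) :
  projective_module P -> projective_module Q -> projective_module (P * Q)%type.
Proof.
move=> pP pQ M N g f gs.
have f1l : linear (fun p : P => f (p, 0)).
  by move=> a x y; rewrite -linearP; congr (f _); congr pair; rewrite /= scaler0 addr0.
have f2l : linear (fun q : Q => f (0, q)).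
  by move=> a x y; rewrite -linearP; congr (f _); congr pair; rewrite /= scaler0 addr0.
have [h1 h1E] := pP M N g (mklin f1l) gs; have [h2 h2E] := pQ M N g (mklin f2l) gs.
have hl : linear (fun z : P * Q => h1 z.1 + h2 z.2).
  by move=> a x y /=; rewrite !linearP scalerDr addrACA.
exists (mklin hl) => -[x y]; rewrite /= linearD h1E h2E /= -linearD; congr (f _).
by congr pair; rewrite /= ?addr0 ?add0r.
Qed.

(** The fibre product of P_0 and P'_0 over S is an extension of P'_0 by ker aug, split by
    projectivity; so it is resolved by P_1 × P'_0, P_2, P_3, and so on. *)
Definition pull_mod (P P' : nat -> lmodType R) (i : nat) : lmodType R :=
  if i is i'.+1 then P i'.+2 else (P 1%N * P' 0%N)%type.

Definition pull_d (P P' : nat -> lmodType R) (d : forall i, P i.+1 -> P i) (i : nat) :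
    pull_mod P P' i.+1 -> pull_mod P P' i :=
  match i return pull_mod P P' i.+1 -> pull_mod P P' i with
  | 0 => fun y => (d 1%N y, 0)
  | i'.+1 => d i'.+2
  end.

Lemma pres_pull (Z : lmodType R) (S : set Z) P d aug P' d' aug' :
  pres S d aug -> pres (P := P') S d' aug' ->
  exists aug2 : pull_mod P P' 0 -> (P 0%N * P' 0%N)%type,
    pres [set z | aug z.1 = aug' z.2] (pull_d (P := P) (P' := P') d) aug2.
Proof.
move=> [pP dl al im e0 ex] [pP' dl' al' im' e0' ex'].
(* The splitting sends p' to (t p', p'). *)
have [|t [tl tE]] := projective_lift (pP' 0%N) al al'.
  by move=> x; apply/im/im'; exists x.
exists (fun z => (t z.2 + d 0%N z.1, z.2)); split.
- by case=> [|i]; [exact: projective_prod|exact: pP].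
- case=> [a x y|i]; last exact: dl.
  by congr pair; rewrite ?dl //= scaler0 addr0.
- move=> a x y; congr pair => //=.
  by rewrite tl dl scalerDr addrACA.
- move=> [p p'] /=; split=> [e|[[x q] _ [<- <-]]]; last first.
    rewrite (lin_add al) tE; have -> : aug (d 0%N x) = 0 by apply/e0; exists x.
    by rewrite addr0.
  have /e0[x xE] : aug (p - t p') = 0 by rewrite (lin_sub al) tE e subrr.
  by exists (x, p') => //=; rewrite xE addrC subrK.
- move=> [x q] /=; split=> [[e1 e2]|[y [<- <-]]].
    move: e1; rewrite e2 (linear_fun0 tl) add0r => /ex[y <-].
    by exists y.
  rewrite (linear_fun0 tl) add0r; have -> : d 0%N (d 1%N y) = 0 by apply/ex; exists y.
  by [].
case=> [|i]; last exact: ex.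
move=> y /=; split=> [[/ex]//|/ex e]; by rewrite e.
Qed.

Lemma pres_swap (Z Z' : lmodType R) (S : set (Z * Z')) P d aug :
  pres (P := P) S d aug ->
  pres [set z : Z' * Z | S (z.2, z.1)] d (fun x => ((aug x).2, (aug x).1)).
Proof.
move=> [pP dl al im e0 ex]; split=> //.
- by move=> a x y; rewrite al.
- move=> [z' z] /=; rewrite im; split=> -[x _]; first by move=> e; exists x => //; rewrite e.
  by case=> <- <-; exists x => //; exact: surjective_pairing.
- move=> x; rewrite -e0; split=> [[e1 e2]|->//].
  by rewrite [aug x]surjective_pairing e1 e2.
Qed.

(** Ext^(m+1) vanishes if some projective resolution of S has length m. Both resolutions, shifted by
    one, resolve the fibre product of P_0 and P'_0 up to exchange of the factors; passing to it
    lowers m by one. *)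
Lemma schanuel (m : nat) : forall (Z X : lmodType R) (S : set Z)
    (P' : nat -> lmodType R) d' aug' (P : nat -> lmodType R) d aug (f : P m.+1 -> X),
  pres (P := P') S d' aug' -> pres (P := P) S d aug ->
  (forall i, (m < i)%N -> forall x : P' i, x = 0) ->
  linear f -> (forall x, f (d m.+1 x) = 0) ->
  exists g : P m -> X, linear g /\ forall x, f x = g (d m x).
Proof.
elim: m => [|m ih] Z X S P' d' aug' P d aug f h' h P'0 fl fd.
  have [pP dl al im e0 ex] := h; have [pP' dl' al' im' e0' ex'] := h'.
  have [|s [sl sE]] := projective_lift (pP 0%N) al' al.
    by move=> x; apply/im'/im; exists x.
  have [|t [tl tE]] := projective_lift (pP' 0%N) al al'.
    by move=> x; apply/im/im'; exists x.
  (* As P'_1 = 0, aug' is injective, so s vanishes on the image of d_0. Hence p - t (s p) retracts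
     P_0 onto ker aug, and f extends along this retraction. *)
  have ul : linear (fun p => p - t (s p)) := lin_subf (@lin_id _ _) (lin_comp tl sl).
  have [||g [gl gE]] := lin_factor (dl 0%N) fl ul.
  - by move=> x /ex[y <-].
  - move=> y; have /e0[x xE] : aug (y - t (s y)) = 0 by rewrite (lin_sub al) tE sE subrr.
    by exists x.
  exists g; split=> // x; apply/esym/gE.
  have /e0'[y yE] : aug' (s (d 0%N x)) = 0 by rewrite sE; apply/e0; exists x.
  by rewrite -yE (P'0 1%N isT y) (linear_fun0 (dl' 0%N)) (linear_fun0 tl) subr0.
have [aug2 h2] := pres_pull h h'; have [aug2' h2'] := pres_pull h' h.
have h3 := pres_swap h2'.
have eS : [set z : P 0%N * P' 0%N | [set z | aug' z.1 = aug z.2] (z.2, z.1)] =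
    [set z | aug z.1 = aug' z.2].
  by apply/seteqP; split=> z /=.
rewrite eS in h3.
have [|g [gl gE]] := ih _ X _ _ _ _ _ _ _ f h3 h2 _ fl fd.
  by case=> [//|i] mi x; exact: (P'0 i.+2).
(* For m = 0 the map obtained lives on P_1 × P'_0 and is restricted to the first factor. *)
case: m f fl fd {ih P'0} g gl gE => [|m] f fl fd g gl gE; last by exists g.
exists (fun y => g (y, 0)); split=> // a x y.
by rewrite -gl; congr (g _); congr pair; rewrite /= scaler0 addr0.
Qed.

End Schanuel.

Section Vanishing.
Context (k : fieldType) (R : algType k) (gR : nat -> set R).
Context (hR : graded_algebra gR).

(** The bound on the projective dimension is ungraded: Schanuel's lemma gives an ungraded map g,
    whose part of degree e still has coboundary f because f and the differential are homogeneous. *)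
Lemma ext_vanishing (n : nat) (M X : lmodType R) (gM : int -> set M) (gX : int -> set X)
    (P : nat -> lmodType R) (gP : forall i, int -> set (P i))
    (d : forall i, P i.+1 -> P i) (aug : P 0%N -> M) (i : nat) e f :
  proj_dim_le M n -> graded_module gR gX ->
  graded_projective_resolution gR gM gP d aug -> (n <= i)%N ->
  gcoc gP d gX i.+1 e f -> gcob gP d gX i.+1 e f.
Proof.
move=> [P' [d' [aug' [pP' as' e0' ex' v']]]] hX [pP hd ha asur e0 ex] ni [hf fd].
have h' : pres [set: M] (fun i => d' i) aug'.
  split=> //; [by move=> j; exact: linearP|exact: linearP|].
  by move=> z; split=> // _; have [x <-] := as' z; exists x.
have h : pres [set: M] d aug.
  split=> //.
  - by move=> j; apply: (graded_projective_projective hR (pP j)).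
  - by move=> j; exact: ghom_lin (hd j).
  - exact: ghom_lin ha.
  - by move=> z; split=> // _; have [x <-] := asur z; exists x.
have [|g [gl gE]] := schanuel h' h _ (ghom_lin hf) fd.
  by move=> j ij; apply: v'; exact: leq_ltn_trans ij.
have hPi := proj1 (pP i); have hPi1 := proj1 (pP i.+1).
have [g' [hg' g'E]] := ghom_part hR hPi hX e gl.
exists g'; split=> // x; apply: (cmp_ext (gmod_sum hX)) => l.
have := ghom_cmp hPi1 hPi (l - e) x (hd i); rewrite subr0 => dE.
rewrite g'E dE -gE -(ghom_cmp hPi1 hX _ _ hf) (cmp_idem (gmod_sum hX)) eqxx //.
Qed.

End Vanishing.

Section Trivial.
Context (k : fieldType) (R : algType k) (gR : nat -> set R).

Definition conc_gr (V : zmodType) (j : int) : set V := [set x | j = 0 \/ x = 0].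

Lemma conc_sum (V : zmodType) : direct_sum (@conc_gr V).
Proof.
split.
- by move=> i; right.
- move=> i x y [->|->]; first by left.
  by case=> [->|->]; [left|right; rewrite subr0].
- move=> x; exists [:: 0], (fun j => if j == 0 then x else 0); split.
    by move=> j; case: eqP => [->|_]; [left|right].
  by rewrite big_seq1 eqxx.
move=> s c us gc sc0 i si; have [i0|c0] := gc i; last exact: c0.
rewrite i0 in si *.
move: sc0; rewrite (bigD1_seq 0) //= big1 ?addr0 // => j j0.
by have [e|//] := gc j; rewrite e eqxx in j0.
Qed.

Lemma conc_gmod (M : lmodType R) :
  (forall i a (x : M), (0 < i)%N -> gR i a -> a *: x = 0) ->
  graded_module gR (@conc_gr M).
Proof.
move=> h; split; first exact: conc_sum.
move=> i j a x ga [->|->]; last by right; rewrite scaler0.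
case: i ga => [|i] ga; first by left; rewrite addr0.
by right; exact: (h i.+1).
Qed.

Lemma conc_gr0 (V : zmodType) j (x : V) : conc_gr j x -> j != 0 -> x = 0.
Proof. by case=> [->|//]; rewrite eqxx. Qed.

Lemma conc_bounded (V : zmodType) : bounded_below (@conc_gr V).
Proof. by move=> j x [->|//]; rewrite ltxx. Qed.

Context (hc : connected_graded gR).
Let hR := connected_graded_algebra hc.

Lemma trivG_act (U : lmodType k) i a (x : restr (augmk hc) U) :
  (0 < i)%N -> gR i a -> a *: x = 0.
Proof.
move=> i0 ga; have e : augmk hc a = 0 := augm_pos hc i0 ga.
by rewrite restrE e scale0r.
Qed.

Definition trivG (U : lmodType k) : gmod gR :=
  Gmod (conc_gmod (@trivG_act U)).

Lemma augm_scalar (c : k) : augm hc c%:A = c.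
Proof. by rewrite linearZ /= rmorph1; exact: mulr1. Qed.

(** All of W sits in degree 0. An element of degree i > 0 may act on W in any way, because its
    values in degree 0 lie below the bound i; in degree 0 both actions are by scalars. *)
Lemma trivG_deformation (W : lmodType R) :
  deformation (V := trivG (kres W)) (W := W) id id.
Proof.
split=> //.
  move=> c x y; rewrite /=; congr (_ + _).
  have e : augmk hc c%:A = c := augm_scalar c.
  by rewrite [LHS]restrE [LHS]restrE e.
move=> i a n x ga gx l il.
have [n0|ne] := eqVneq n 0; last first.
  have -> : x = 0 := conc_gr0 gx ne.
  rewrite [X in X - _](_ : _ = 0) ?[X in _ - X](_ : _ = 0); last 2 first.
  - exact: scaler0.
  - exact: scaler0.
  by rewrite subr0 cmp0 //; exact: conc_sum.
case: i ga il => [|i] ga il.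
  rewrite [X in cmp _ _ X](_ : _ = 0) ?cmp0 //; first exact: conc_sum.
  rewrite {1}(augm0 hc ga); apply/eqP; rewrite subr_eq0; apply/eqP.
  by [].
apply: (cmp_ne (conc_sum _) (i := 0)); first by left.
by apply/eqP => l0; move: il; rewrite n0 addr0 l0.
Qed.

Lemma proj_dim_le_trivial (n : nat) (W : lmodType R) :
  (forall x : syzn hc n.+1 (trivG (kres W)), x = 0) -> proj_dim_le W n.
Proof.
move=> h; apply: (@proj_dim_le_deformation _ _ _ hc n (trivG (kres W)) W id id _ _ h).
- exact: conc_bounded.
- exact: trivG_deformation.
Qed.

End Trivial.

Section InjectiveDimension.
Context (k : fieldType) (R : algType k) (gR : nat -> set R).
Context (hc : connected_graded gR).
Let hR := connected_graded_algebra hc.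

(** Dimension shifting along an injective resolution of X; this gives the lower bound for the
    injective dimension. *)
Lemma inj_vanishing (m : nat) : forall (X : lmodType R) (gX : int -> set X)
    (M : lmodType R) (gM : int -> set M)
    (P : nat -> lmodType R) (gP : forall i, int -> set (P i))
    (d : forall i, P i.+1 -> P i) (aug : P 0%N -> M) (i : nat) e f,
  graded_module gR gX -> graded_inj_dim_le gR gX m ->
  graded_projective_resolution gR gM gP d aug -> (m <= i)%N ->
  gcoc gP d gX i.+1 e f -> gcob gP d gX i.+1 e f.
Proof.
elim: m => [|m ih] X gX M gM P gP d aug i e f hX
    [E [gE [dE [coaug [[Einj Ed Eco Emono Eex0 Eex] Ev]]]]] hres mi [hf fd].
  have hP j := proj1 (gpr_proj hres j); have hE j := proj1 (Einj j).
  have hcf : graded_hom (@gP i.+1) (gE 0%N) e (fun x => coaug (f x)).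
    by have := ghom_comp Eco hf; rewrite add0r.
  have [|h [hh hhE]] := graded_injective_ginj hR (Einj 0%N) (hP i.+1) (hP i) (gpr_d hres i) hcf.
    by move=> x /(gpr_exact hres (i := i))[y <-]; rewrite fd (linear_fun0 (ghom_lin Eco)).
  have [|f' [hf' fE']] := ghom_factor hX (hE 0%N) Eco Emono hh.
    by move=> x; have /Eex0[y <-] : dE 0%N (h x) = 0 by exact: Ev.
  by exists f'; split=> // x; apply: Emono; rewrite fE' hhE.
case: i mi f hf fd => [//|i] mi f hf fd.
have hP j := proj1 (gpr_proj hres j); have hE j := proj1 (Einj j).
have pP j := graded_projective_gproj hR (gpr_proj hres j).
have ksub := submod_ker (ghom_lin (Ed 1%N)).
(* The kernel of E_1 -> E_2 is E_0 / X, and the shifted resolution resolves it. *)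
pose Y : lmodType R := smod ksub.
pose gY : int -> set Y := fun j => [set x | gE 1%N j (smval x)].
have hY : graded_module gR gY.
  by apply: (gsub (hE 1%N)) => j x /=; exact: (ghom_ker (hE 1%N) (hE 2%N) (Ed 1%N)).
have [pi [pil piE]] := smod_lift ksub (ghom_lin (Ed 0%N)) (fun x =>
  (proj2 (Eex 0%N (dE 0%N x))) (ex_intro _ x erefl)).
have hpi : graded_hom (gE 0%N) gY 0 pi.
  by split=> // j x gx; rewrite /gY /= piE; exact: (ghom_gr (Ed 0%N)).
have psurj : surjective_fun pi.
  move=> y; have /(Eex 0%N)[x xE] := smvalP y.
  by exists x; apply: smval_inj; rewrite piE.
have ipex : exact_at coaug pi.
  move=> x; rewrite -Eex0; split=> [/(congr1 (@smval _ _ _ _))|e0]; first by rewrite piE.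
  by apply: smval_inj; rewrite piE.
have hYinj : graded_inj_dim_le gR gY m.
  exists (fun j => E j.+1), (fun j => gE j.+1), (fun j => dE j.+1), (fun x => smval x).
  split; last by move=> j mj; exact: (Ev j.+1).
  split=> //.
  - by split=> [|j x]; [exact: smval_linear|rewrite add0r].
  - exact: smval_inj.
  - move=> x; split=> [x0|[y <-]]; last exact: (smvalP y).
    by exists (smk ksub x0).
have jI := graded_injective_ginj hR (Einj 0%N).
have := dimension_shift hR hX (hE 0%N) hY Eco hpi Emono psurj ipex (hP i.+2) (hP i.+1)
  (gpr_d hres i.+1) (gpr_exact hres (i := i.+1)) (pP i.+1) jI e.
rewrite (lifted_coboundaries (hE 0%N) hY hpi psurj (hP i.+1) jI (hP i) (gpr_d hres i)
  (gpr_exact hres (i := i)) (pP i)).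
move=> /sqcorr_sym/sqcorr_vanish; apply; last by split.
by move=> g; exact: (ih Y gY M gM P gP d aug i e g).
Qed.

(* H^1 = Ext^1(N / M, X) is the obstruction to extending maps M -> X to N. *)
Lemma ext1_injective (X : gmod gR) :
  (forall (C : gmod gR) e f, gcoc (@res_gr _ _ _ hc C) (@res_d _ _ _ hc C) (@ggr _ _ _ X) 1 e f ->
    gcob (@res_gr _ _ _ hc C) (@res_d _ _ _ hc C) (@ggr _ _ _ X) 1 e f) ->
  graded_injective gR (@ggr _ _ _ X).
Proof.
move=> hv; split; first exact: gprf.
move=> M N gM gN g f hM hN hg gi hf.
have gl := ghom_lin hg; have rsub := submod_im gl.
have [||||q [ql q0 qs qg]] := @graded_proj _ k (kres N) gN (range g).
- exact: gmod_sum hN.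
- by move=> j c x; exact: (gmod_kscale hR hN).
- by split=> [|c x y hx hy]; [case: rsub | case: rsub => _; apply].
- by move=> j x; exact: (ghom_range hM hN hg).
have qq : @quotient_proj R N q.
  split; first exact: (lin_add ql).
  - move=> x; apply/eqP; rewrite -subr_eq0 -[_ - _](lin_sub ql); apply/eqP/q0.
    by rewrite -opprB; apply: (submod_opp rsub); exact: qs.
  - by move=> a x /q0 hx; apply/q0; exact: (submod_scale rsub).
pose C : gmod gR := Gmod (gquot hN qq qg).
have hres := res_resolution hc C.
have hp : graded_hom gN (@ggr _ _ _ C) 0 (qpi qq).
  by split=> [|j x gx]; [exact: qpi_linear|rewrite add0r; exact: (qg j x gx)].
have hP j := proj1 (gpr_proj hres j).
have [|t [ht tE]] := graded_projective_gproj hR (gpr_proj hres 0%N) hN (gprf C) hp (gpr_aug hres).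
  by move=> x; exists (qval (res_aug x)) => //; exact: qvalK.
have tl := ghom_lin ht.
have htd : graded_hom (@res_gr _ _ _ hc C 1) gN 0 (fun x => t (res_d x)).
  by have := ghom_comp ht (gpr_d hres 0%N); rewrite addr0.
(* C is N / M, and t lifts its augmentation to N. So t d lands in M, and f w is the cocycle that
   obstructs the extension of f. *)
have [|w [hw wE]] := ghom_factor hM hN hg gi htd.
  move=> x; apply/q0/(qpi_eq0 qq); rewrite tE; apply/(gpr_exact0 hres); by exists x.
have [|h [hh hE]] := hv C 0 (fun x => f (w x)).
  split; first by have := ghom_comp hf hw; rewrite addr0.
  move=> x; have -> : w (res_d x) = 0.
    apply: gi; rewrite wE (linear_fun0 gl).
    have -> : res_d (res_d x) = 0 by apply/(gpr_exact hres (i := 0%N)); exists x.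
    exact: (linear_fun0 tl).
  exact: (linear_fun0 (ghom_lin hf)).
have fl := ghom_lin hf; have hl := ghom_lin hh.
(* N is the quotient of M × P_0 by the pairs (- w x, d x). Since f w = h d, the map f + h vanishes
   on them and descends to N. *)
pose MP : lmodType R := (M * res hc C 0)%type.
have dl : linear (fun z : MP => g z.1 + t z.2).
  by move=> a x y /=; rewrite gl tl scalerDr addrACA.
have fhl : linear (fun z : MP => f z.1 + h z.2).
  by move=> a x y /=; rewrite fl hl scalerDr addrACA.
have dec y : exists m p, y = g m + t p.
  have [p pE] := gpr_surj hres (qpi qq y).
  have [m _ mE] : range g (y - t p).
    by apply/q0/(qpi_eq0 qq); rewrite (lin_sub (@qpi_linear _ _ _ qq)) tE pE subrr.
  by exists m, p; rewrite mE subrK.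
have [||E [El EE]] := lin_factor dl fhl (@lin_id _ N).
- move=> [m p] /= e.
  have : range g (t p) by exists (- m) => //; rewrite (lin_opp gl); apply/eqP; rewrite eq_sym -addr_eq0 addrC e.
  move=> /q0/(qpi_eq0 qq); rewrite tE => /(gpr_exact0 hres)[x xE].
  have mE : m = - w x.
    apply: gi; rewrite (lin_opp gl) wE xE; apply/eqP; rewrite -addr_eq0; exact/eqP.
  by rewrite mE (lin_opp fl) -xE -hE addNr.
- by move=> y; have [m [p ->]] := dec y; exists (m, p).
exists E; split; last first.
  move=> x; rewrite (EE _ (x, 0)) /= ?(linear_fun0 hl) ?addr0 //.
  by rewrite (linear_fun0 tl) addr0.
split=> // j y gy; rewrite add0r; have [m [p yE]] := dec y.
have hsN := gmod_sum hN; have hsX := gmod_sum (gprf X).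
have e1 : y = g (cmp gM j m) + t (cmp (@res_gr _ _ _ hc C 0) j p).
  rewrite -(cmp_id hsN gy) {1}yE cmpD // (ghom_cmp hM hN _ _ hg).
  by rewrite (ghom_cmp (hP 0%N) hN _ _ ht) subr0.
rewrite (EE y (cmp gM j m, cmp (@res_gr _ _ _ hc C 0) j p)) //=.
apply: (grD hsX).
- by rewrite -[j in ggr j]add0r; apply: (ghom_gr hf); exact: (cmp_in (gmod_sum hM)).
- by rewrite -[j in ggr j]add0r; apply: (ghom_gr hh); exact: (cmp_in (gmod_sum (hP 0%N))).
Qed.

(** Each coinduced cosyzygy lowers the degree of vanishing by one, until [ext1_injective] applies to
    the last one, which closes the resolution. *)
Lemma graded_inj_dim_le_vanishing (m : nat) : forall X : gmod gR,
  (forall (C : gmod gR) e f, gcoc (@res_gr _ _ _ hc C) (@res_d _ _ _ hc C) (@ggr _ _ _ X) m.+1 e f ->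
    gcob (@res_gr _ _ _ hc C) (@res_d _ _ _ hc C) (@ggr _ _ _ X) m.+1 e f) ->
  graded_inj_dim_le gR (@ggr _ _ _ X) m.
Proof.
have hid (X : gmod gR) : graded_hom (@ggr _ _ _ X) (@ggr _ _ _ X) 0 id.
  by split=> // j x; rewrite add0r.
elim: m => [|m ih] X hv.
  pose E (i : nat) : lmodType R := if i is 0 then X else 'rV[R]_0.
  pose gE i : int -> set (E i) := match i return int -> set (E i) with
    | 0 => @ggr _ _ _ X | _ => @zmod_gr _ R end.
  have z0 (x y : 'rV[R]_0) : x = y := rV0_eq x y.
  have zinj : graded_injective gR (@zmod_gr _ R).
    split; first exact: gzero.
    move=> M N gM gN g f hM hN _ _ _; exists (fun=> 0); split=> [|x]; last exact: z0.
    exact: (ghom_zero _ (gzero gR)).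
  exists E, gE, (fun i => fun=> 0), id; split; last by case=> [//|i] _ x; exact: z0.
  split=> //.
  - by case=> [|i]; [exact: ext1_injective|exact: zinj].
  - by move=> i; exact: (ghom_zero _ (gzero gR)).
  - by move=> x; split=> _ //; exists x.
  - by move=> i x; split=> _ //; exists 0; exact: z0.
have [|E [gE [dE [coaug [[Einj Ed Eco Emono Eex0 Eex] Ev]]]]] := ih (cosyz hR X).
  move=> C e f; have hres := res_resolution hc C.
  have hP j := proj1 (gpr_proj hres j).
  have pP j := graded_projective_gproj hR (gpr_proj hres j).
  have jI := @coind_ginj_id _ _ _ hR X.
  have := dimension_shift hR (gprf X) (gprf (coindG hR X)) (gprf (cosyz hR X)) (coemb_graded hR X)
    (coquo_graded hR X) (@coemb_inj _ _ _ hR X) (@coquo_surj _ _ _ hR X)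
    (@coquo_exact _ _ _ hR X) (hP m.+2) (hP m.+1)
    (gpr_d hres m.+1) (gpr_exact hres (i := m.+1)) (pP m.+1) jI e.
  rewrite (lifted_coboundaries (gprf (coindG hR X)) (gprf (cosyz hR X)) (coquo_graded hR X)
    (@coquo_surj _ _ _ hR X) (hP m.+1) jI (hP m) (gpr_d hres m)
    (gpr_exact hres (i := m)) (pP m)).
  move=> /sqcorr_vanish; apply; exact: (hv C e).
pose E' (i : nat) : lmodType R := if i is i'.+1 then E i' else coindG hR X.
pose gE' i : int -> set (E' i) := match i return int -> set (E' i) with
  | 0 => @ggr _ _ _ (coindG hR X) | i'.+1 => gE i' end.
pose dE' i : E' i -> E' i.+1 := match i return E' i -> E' i.+1 with
  | 0 => fun x => coaug (coquo x) | i'.+1 => dE i' end.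
exists E', gE', dE', (@coemb _ _ _ hR X); split; last by case=> [//|i] im x; exact: (Ev i).
split.
- case=> [|i]; last exact: Einj.
  by apply: (ginj_graded_injective (gprf _)); exact: coind_ginj_id.
- case=> [|i]; last exact: Ed.
  by have := ghom_comp Eco (coquo_graded hR X); rewrite add0r.
- exact: coemb_graded.
- exact: coemb_inj.
- move=> x; rewrite -coquo_exact; split=> [e0|/= ->].
    by apply: Emono; rewrite (linear_fun0 (ghom_lin Eco)).
  exact: (linear_fun0 (ghom_lin Eco)).
- case=> [|i]; last exact: Eex.
  move=> x; rewrite -[dE' 1%N x = 0]/(dE 0%N x = 0) Eex0; split=> [[y <-]|[y <-]].
    by have [z <-] := coquo_surj y; exists z.
  by exists (coquo y).
Qed.

End InjectiveDimension.

(** * Transfer along free extensions *)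

Section Converse.
Context (k : fieldType).

Definition conv_map (A B : algType k) (f : {lrmorphism A -> B}) : A^c -> B^c := f.

Section ConvMap.
Context (A B : algType k) (f : {lrmorphism A -> B}).

Fact conv_map_linear : linear (conv_map f).
Proof. by move=> c x y; exact: (linearP f c x y). Qed.

Fact conv_map_multiplicative : monoid_morphism (conv_map f).
Proof. by split=> [|x y]; [exact: (rmorph1 f) | exact: (rmorphM f y x)]. Qed.

HB.instance Definition _ := GRing.isLinear.Build k A^c B^c _ (conv_map f) conv_map_linear.
HB.instance Definition _ :=
  GRing.isMonoidMorphism.Build A^c B^c (conv_map f) conv_map_multiplicative.

End ConvMap.

Definition conv (A B : algType k) (f : {lrmorphism A -> B}) : {lrmorphism A^c -> B^c} :=
  conv_map f.

Lemma graded_algebra_conv (A : algType k) (gr : nat -> set A) :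
  graded_algebra gr -> graded_algebra (A := A^c) gr.
Proof.
by case=> h1 h2 h3 h4; split=> // i j a b ga gb; rewrite addnC; exact: h3.
Qed.

Lemma connected_graded_conv (A : algType k) (gr : nat -> set A) :
  connected_graded gr -> connected_graded (A := A^c) gr.
Proof.
by case=> h1 h2 h3 h4; split=> // i j a b ga gb; rewrite addnC; exact: h3.
Qed.

End Converse.

Section LeftFree.
Context (k : fieldType) (R B : algType k) (gR : nat -> set R) (gB : nat -> set B).
Context (beta : {lrmorphism R -> B}).

(** Freeness on the left is freeness on the right for the converse algebras, so all properties of
    coordinates are inherited. *)
Definition left_free (n : nat) (t : 'I_n -> B) (r : 'I_n -> B -> R) : Prop :=
  right_free (R := R^c) (B := B^c) gB (conv beta) t r.

Context (hR : graded_algebra gR) (hB : graded_algebra gB).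
Context (hb : forall i a, gR i a -> gB i (beta a)).
Context (n : nat) (t : 'I_n -> B) (r : 'I_n -> B -> R) (hf : left_free t r).

Lemma lfree_dec b : b = \sum_j beta (r j b) * t j.
Proof. exact: (rfree_dec hf b). Qed.

Lemma lfree_coord (c : 'I_n -> R) j : r j (\sum_i beta (c i) * t i) = c j.
Proof. exact: (rfree_coord hf c j). Qed.

Lemma lfree_lin j : linear (r j).
Proof. exact: (rfree_lin hf j). Qed.

Lemma lfree_mul j a b : r j (beta a * b) = a * r j b.
Proof. exact: (rfree_mul hf j b a). Qed.

Lemma lfree_gr j i b : gB i b -> gR i (r j b).
Proof.
exact: (rfree_gr (graded_algebra_conv hR) (graded_algebra_conv hB) (beta := conv beta) hb hf j).
Qed.

Section Complex.
Context (hc : connected_graded gR).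
Context (P : nat -> lmodType R) (gP : forall i, int -> set (P i)).
Context (d : forall i, P i.+1 -> P i).
Context (hd : forall i, graded_hom (@gP i.+1) (@gP i) 0 (@d i)).
Context (hP : forall i, graded_module gR (@gP i)).
Context (i : nat) (e : int).

Notation gRr := (regular_gr gR : int -> set R^o).
Notation gBr := (regular_gr gB : int -> set (restr beta B^o)).
Notation ZR := (gcoc gP d gRr i e).
Notation BR := (gcob gP d gRr i e).
Notation ZB := (gcoc gP d gBr i e).
Notation BB := (gcob gP d gBr i e).

Definition lcoord (S : Type) (j : 'I_n) (f : S -> restr beta B^o) : S -> R^o := fun x => r j (f x).
Definition lcomb (S : Type) (f : 'I_n -> S -> R^o) : S -> restr beta B^o :=
  fun x => \sum_j beta (f j x) * t j.

Lemma lcoord_comb S (f : 'I_n -> S -> R^o) j : lcoord j (lcomb f) = f j.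
Proof. by apply: funext => x; exact: lfree_coord. Qed.

Lemma lcomb_coord S (f : S -> restr beta B^o) : lcomb (fun j => lcoord j f) = f.
Proof. by apply: funext => x; exact/esym/lfree_dec. Qed.

Lemma lcoord_ghom (M : lmodType R) (gM : int -> set M) e' j f :
  graded_hom gM gBr e' f -> graded_hom gM gRr e' (lcoord j f).
Proof.
move=> [fl fg]; split=> [a x y|l x /fg].
  rewrite /lcoord fl; have -> : r j (a *: f x + f y) = r j (a *: f x) + r j (f y).
    exact: (lin_add (lfree_lin j)).
  by rewrite [r j (a *: f x)]lfree_mul.
rewrite /lcoord; case: (e' + l) => m /=; first exact: lfree_gr.
move=> ->; exact: (linear_fun0 (lfree_lin j)).
Qed.

Lemma lcomb_ghom (M : lmodType R) (gM : int -> set M) e' f :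
  (forall j, graded_hom gM gRr e' (f j)) -> graded_hom gM gBr e' (lcomb f).
Proof.
move=> hff; split=> [a x y|l x gx].
  rewrite /lcomb scaler_sumr -big_split /=; apply: eq_bigr => j _.
  have [fl _] := hff j; rewrite fl rmorphD mulrDl; congr (_ + _).
  transitivity (beta a * (beta (f j x) * t j)); last by [].
  by rewrite mulrA -rmorphM.
have hB' := regular_sum hB.
apply: (gr_sum hB') => j _; have [_ /(_ l x gx)] := hff j.
case: (e' + l) => m /=; last by move=> ->; rewrite rmorph0 mul0r.
by move=> /hb gm; rewrite -[m]addn0; apply: (galg_mul hB) => //; exact: (rfree_deg hf).
Qed.

Lemma lcoord_coc f : ZB f -> forall j, ZR (lcoord j f).
Proof.
move=> [hff fd] j; split; first exact: lcoord_ghom.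
by move=> x; rewrite /lcoord fd; exact: (linear_fun0 (lfree_lin j)).
Qed.

Lemma lcomb_coc f : (forall j, ZR (f j)) -> ZB (lcomb f).
Proof.
move=> hff; split; first by apply: lcomb_ghom => j; case: (hff j).
by move=> x; rewrite /lcomb big1 // => j _; have [_ ->] := hff j; rewrite rmorph0 mul0r.
Qed.

Lemma lcoord_cob f : BB f -> forall j, BR (lcoord j f).
Proof.
case: i f => [|i'] f /=.
  by move=> -> j; apply: funext => x; exact: (linear_fun0 (lfree_lin j)).
move=> [g [hg gE]] j; exists (lcoord j g); split; first exact: lcoord_ghom.
by move=> x; rewrite /lcoord gE.
Qed.

Lemma lcomb_cob f : (forall j, BR (f j)) -> BB (lcomb f).
Proof.
case: i f => [|i'] f /= hff.
  by apply: funext => x; rewrite /lcomb big1 // => j _; rewrite hff rmorph0 mul0r.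
have [g gP'] := choice hff; exists (lcomb g); split.
  by apply: lcomb_ghom => j; case: (gP' j).
by move=> x; apply: eq_bigr => j _; have [_ ->] := gP' j.
Qed.

Lemma lcoord_flc c (f g : P i -> restr beta B^o) j :
  lcoord j (flc c f g) = flc c (lcoord j f) (lcoord j g).
Proof.
apply: funext => x; rewrite /lcoord /flc.
have -> : r j (c%:A *: f x + g x) = r j (c%:A *: f x) + r j (g x).
  exact: (lin_add (lfree_lin j)).
by rewrite [r j (c%:A *: f x)]lfree_mul.
Qed.

(** As a left R-module B is the sum of the β(R) t_j, so cochains with values in B are n-tuples of
    cochains with values in R. Row j of the matrix is the class of the coordinate j. *)
Lemma lfree_cohomology (b : nat) : subquotient_onto (@flc k R (P i) R^o) 'rV[k]_b ZR BR ->
  subquotient_onto (@flc k R (P i) (restr beta B^o)) 'M[k]_(n, b) ZB BB.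
Proof.
move=> [phi [pl ps pk]].
exists (fun f => \matrix_(j, c) phi (lcoord j f) 0 c); split.
- move=> c f g hff hg; apply/matrixP => j l.
  by rewrite !mxE lcoord_flc pl ?mxE //; exact: lcoord_coc.
- move=> w; have ex j : exists f, ZR f /\ phi f = row j w by exact: ps.
  have [f fE] := choice ex; exists (lcomb f); split.
    by apply: lcomb_coc => j; case: (fE j).
  by apply/matrixP => j l; rewrite mxE lcoord_comb; have [_ ->] := fE j; rewrite mxE.
- move=> f hff; split=> [e0|hb'].
    rewrite -[f]lcomb_coord; apply: lcomb_cob => j; apply/pk; first exact: lcoord_coc.
    by apply/rowP => c; have /matrixP/(_ j c) := e0; rewrite !mxE.
  apply/matrixP => j c; rewrite !mxE.
  have -> : phi (lcoord j f) = 0 by apply/pk; [exact: lcoord_coc|exact: lcoord_cob].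
  by rewrite mxE.
Qed.

Let smul (a : k) (f : P i -> R^o) : P i -> R^o := fun x => a%:A * f x.

Let smul_flc a f : smul a f = flc a f (fun=> 0 : R^o).
Proof. by apply: funext => x; rewrite /flc addr0. Qed.

Let ZR_flc c f g : ZR f -> ZR g -> ZR (flc c f g).
Proof.
move=> [hff fd] [hg gd]; split; first exact: (flc_ghom hR _ (regular_gmod hR)).
by move=> x; rewrite /flc fd gd scaler0 addr0.
Qed.

Let ZR0 : ZR (fun=> 0).
Proof. by split=> //; exact: (ghom_zero _ (regular_gmod hR)). Qed.

Let ZR_smul a f : ZR f -> ZR (smul a f).
Proof. by move=> hff; rewrite smul_flc; exact: ZR_flc. Qed.

Let BR_smul a f : BR f -> BR (smul a f).
Proof.
case: i f @smul smul_flc ZR_flc ZR0 ZR_smul => [|i'] f smul' _ _ _ _ /=.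
  by move=> f0; apply: funext => x; rewrite [f]f0; exact: mulr0.
move=> [g [hg gE]]; exists (flc a g (fun=> 0 : R^o)); split.
  apply: (flc_ghom hR _ (regular_gmod hR)) => //.
  exact: (ghom_zero _ (regular_gmod hR)).
by move=> x; rewrite /smul' /flc gE addr0.
Qed.

(* The k-dimension of H^i(P, B) is n times that of H^i(P, R). *)
Lemma lfree_cohomology_inv (b : bool) : (0 < n)%N ->
  subquotient_onto (@flc k R (P i) (restr beta B^o)) 'M[k]_(n, b) ZB BB ->
  subquotient_onto (@flc k R (P i) R^o) 'rV[k]_b ZR BR.
Proof.
move=> n0 [phi [pl ps pk]].
(* [sc c f] is the cochain with coordinates c_j f. In particular [sc v f] is f placed on the basis
   element of index j0, and its coordinate there gives f back. *)
pose j0 : 'I_n := Ordinal n0; pose v : 'rV[k]_n := delta_mx 0 j0.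
pose sc (c : 'rV[k]_n) f := lcomb (fun j => smul (c 0 j) f).
have scZ c f : ZR f -> ZB (sc c f) by move=> hff; apply: lcomb_coc => j; exact: ZR_smul.
have scB c f : BR f -> BB (sc c f) by move=> hff; apply: lcomb_cob => j; exact: BR_smul.
have scE c f j : lcoord j (sc c f) = smul (c 0 j) f by exact: lcoord_comb.
have lcomb_flc a f g : lcomb (fun j => flc a (f j) (g j)) = flc a (lcomb f) (lcomb g).
  apply: funext => x; rewrite /flc /lcomb scaler_sumr -big_split; apply: eq_bigr => j _ /=.
  rewrite rmorphD mulrDl; congr (_ + _).
  transitivity (beta a%:A * (beta (f j x) * t j)); last by [].
  by rewrite mulrA -rmorphM.
have smulD a c c' f : smul (a * c + c') f = flc a (smul c f) (smul c' f).
  apply: funext => x; rewrite /flc /smul scalerDl mulrDl; congr (_ + _).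
  by rewrite -scalerA -!scalerAl !mul1r [RHS]mulr_algl.
have scL a c c' f : sc (a *: c + c') f = flc a (sc c f) (sc c' f).
  rewrite /sc -lcomb_flc; congr lcomb; apply: funext => j.
  by rewrite !mxE smulD.
have scR a c f g : sc c (flc a f g) = flc a (sc c f) (sc c g).
  rewrite /sc -lcomb_flc; congr lcomb; apply: funext => j; apply: funext => x.
  rewrite /smul /flc mulrDr; congr (_ + _).
  by rewrite mulr_algl [_ *: f x]mulr_algl mulr_algl [RHS]mulr_algl scalerA mulrC -scalerA.
have vE f : lcoord j0 (sc v f) = f.
  by rewrite scE mxE !eqxx; apply: funext => x; rewrite /smul scale1r mul1r.
case: b phi pl ps pk => phi pl ps pk; last first.
  have allB f : ZR f -> BR f.
    move=> hff; rewrite -[f]vE; apply: lcoord_cob; apply/pk; first exact: scZ.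
    by apply/matrixP => ? [].
  exists (fun=> 0); split.
  - by move=> c x y _ _; rewrite scaler0 addr0.
  - by move=> w; exists (fun=> 0); split; [exact: ZR0|apply/rowP => -[]].
  - by move=> f hff; split=> // _; exact: allB.
have [f0 [Zf0 Bf0]] : exists f0, ZR f0 /\ ~ BR f0.
  apply: contrapT => hno.
  have [F [ZF FE]] := ps (const_mx 1).
  have : phi F = 0.
    apply/pk => //; rewrite -[F]lcomb_coord; apply: lcomb_cob => j.
    by apply: contrapT => nb; apply: hno; exists (lcoord j F); split=> //; exact: lcoord_coc.
  rewrite FE => /matrixP/(_ j0 ord0); rewrite !mxE => /eqP; apply/negP; exact: oner_neq0.
have Phi_lin f : ZR f -> linear (fun c => (phi (sc c f))^T : 'rV[k]_n).
  by move=> Zf a c c'; rewrite scL pl ?linearP //; exact: scZ.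
(* Sending c to the class of [sc c f0] is injective because f0 is no coboundary; it maps k^n to k^n,
   so it is bijective. *)
pose U : 'M[k]_n := lin1_mx (mklin (Phi_lin f0 Zf0)).
have UE c : c *m U = (phi (sc c f0))^T by rewrite /U mul_rV_lin1.
have Uu : U \in unitmx.
  rewrite -row_free_unit; apply: inj_row_free => c; rewrite UE => /(congr1 trmx).
  rewrite trmxK trmx0 => /pk-/(_ (scZ _ _ Zf0)) hB'; apply/rowP => j; rewrite mxE.
  apply/eqP; apply: contrapT => /negP cj; apply: Bf0.
  have := BR_smul (c 0 j)^-1 (lcoord_cob hB' j); rewrite scE.
  suff -> : smul (c 0 j)^-1 (smul (c 0 j) f0) = f0 by [].
  apply: funext => x.
  by rewrite /smul mulrA -scalerAl mul1r scalerA mulVf // scale1r mul1r.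
(* [sc v g] and [sc (co g) f0] have the same class. Comparing coordinates at j0, g equals the scalar
   [co g 0 j0] times f0 up to a coboundary, and this scalar is the class of g. *)
pose co g := (phi (sc v g))^T *m invmx U.
have coE g : ZR g -> phi (sc (co g) f0) = phi (sc v g).
  by move=> Zg; apply: trmx_inj; rewrite -UE mulmxKV.
have coB g : ZR g -> BR (flc (-1) (smul (co g 0 j0) f0) g).
  move=> Zg; have : BB (flc (-1) (sc (co g) f0) (sc v g)).
    apply/pk; last by rewrite pl ?coE ?scaleN1r ?addNr //; exact: scZ.
    rewrite -[flc _ _ _]lcomb_coord; apply: lcomb_coc => j; rewrite lcoord_flc !scE.
    by apply: ZR_flc; exact: ZR_smul.
  by move=> /lcoord_cob/(_ j0); rewrite lcoord_flc vE scE.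
exists (fun g => (co g 0 j0)%:M); split.
- move=> c g h Zg Zh; rewrite /co scR pl; try exact: scZ.
  by rewrite linearP /= mulmxDl -scalemxAl; apply/rowP => l; rewrite !ord1 !mxE eqxx !mulr1n.
- move=> w; exists (smul (w 0 0) f0); split; first exact: ZR_smul.
  apply/rowP => l; rewrite ord1 mxE eqxx mulr1n.
  have -> : co (smul (w 0 0) f0) = w 0 0 *: v.
    apply: (can_inj (mulmxK Uu)); rewrite /co mulmxKV //.
    rewrite UE smul_flc scR; congr (phi _)^T.
    have -> : w 0 0 *: v = w 0 0 *: v + 0 by rewrite addr0.
    rewrite scL; congr flc; apply: funext => x; rewrite /sc /lcomb; apply: eq_bigr => j _.
    by rewrite /smul mulr0 mxE scale0r mul0r.
  by rewrite !mxE !eqxx mulr1.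
- move=> g Zg; split=> [/rowP/(_ 0)|Bg].
    rewrite mxE [in RHS]mxE eqxx mulr1n => c0; have := coB _ Zg; rewrite c0.
    suff -> : flc (-1) (smul 0 f0) g = g by [].
    by apply: funext => x; rewrite /flc /smul scale0r mul0r scaler0 add0r.
  have e0 : phi (sc v g) = 0 by apply/pk; [exact: scZ|exact: scB].
  by rewrite /co e0 trmx0 mul0mx mxE; apply/rowP => l; rewrite !mxE mul0rn.
Qed.

End Complex.
End LeftFree.

Section DegreeZero.
Context (k : fieldType) (B : algType k) (gB : nat -> set B) (hB : graded_algebra gB).

Let hreg := regular_gmod hB.

Definition deg0 (x : B^o) : B^o := cmp (regular_gr gB : int -> set B^o) 0 x.

(** The kernel is a submodule because B has no negative degrees: an element of degree i > 0 could
    reach degree 0 only from degree -i. *)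
Lemma deg0_proj : quotient_proj deg0.
Proof.
have hs := gmod_sum hreg; split.
- exact: (cmpD hs).
- by move=> x; rewrite /deg0 (cmp_idem hs) eqxx.
move=> b x x0; move: b; apply: (gr_ind (galg_sum hB)) => [|b c eb ec|i b gb].
- by rewrite scale0r; exact: (cmp0 hs).
- by rewrite scalerDl /deg0 (cmpD hs) -/(deg0 _) -/(deg0 _) eb ec addr0.
rewrite /deg0 (cmp_act hreg _ _ gb); case: i gb => [|i] gb.
  by rewrite subr0 -/(deg0 x) x0 scaler0.
have : regular_gr gB (0 - i.+1%:Z) (cmp (regular_gr gB : int -> set B^o) (0 - i.+1%:Z) x).
  exact: (cmp_in hs).
by rewrite sub0r => /= ->; rewrite scaler0.
Qed.

Lemma deg0_gr j x : regular_gr gB j x -> regular_gr gB j (deg0 x).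
Proof.
have hs := gmod_sum hreg; move=> gx; rewrite /deg0 (cmp_gr hs _ gx).
by case: eqP => // _; exact: (gr0 hs).
Qed.

(* B / B_+ *)
Definition degree0 : gmod gB := Gmod (gquot hreg deg0_proj deg0_gr).

Lemma degree0_conc j (x : degree0) : ggr j x -> j != 0 -> x = 0.
Proof.
move=> gx j0; apply: qval_inj; rewrite -[LHS]qvalE.
by apply: (cmp_ne (gmod_sum hreg) gx); rewrite eq_sym.
Qed.

Definition degree0_one : degree0 := qpi deg0_proj 1.

Lemma degree0_neq0 : degree0_one != 0.
Proof.
apply/eqP => /(congr1 (@qval _ _ _ _)); rewrite [LHS](cmp_id (gmod_sum hreg)).
  by apply/eqP; exact: oner_neq0.
exact: (galg_one hB).
Qed.

End DegreeZero.

Section Link.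
Context (k : fieldType) (A R B : algType k).
Context (gA : nat -> set A) (gR : nat -> set R) (gB : nat -> set B).
Context (alpha : {lrmorphism A -> B}) (beta : {lrmorphism R -> B}).
Context (hB : graded_algebra gB).
Context (fA : rel_free gB gA alpha) (fR : rel_free gB gR beta).

Let hcA := rfe_conn fA.
Let hcR := rfe_conn fR.
Let hA := connected_graded_algebra hcA.
Let hR := connected_graded_algebra hcR.

(** Both complexes are balanced against the same maps from U to the cosyzygies of X over B. *)
Lemma ext_transfer (U : lmodType k) (X : gmod gB) (i : nat) (e : int)
    (MA : lmodType A) (gMA : int -> set MA) (PA : nat -> lmodType A) gPA dA augA
    (MR : lmodType R) (gMR : int -> set MR) (PR : nat -> lmodType R) gPR dR augR
    (uA : U -> MA) vA (uR : U -> MR) vR :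
  graded_module gA gMA -> (forall j x, gMA j x -> j != 0 -> x = 0) ->
  graded_projective_resolution gA gMA (P := PA) gPA dA augA ->
  linear (uA : U -> kres MA) -> cancel uA vA -> cancel vA uA ->
  graded_module gR gMR -> (forall j x, gMR j x -> j != 0 -> x = 0) ->
  graded_projective_resolution gR gMR (P := PR) gPR dR augR ->
  linear (uR : U -> kres MR) -> cancel uR vR -> cancel vR uR ->
  sqcorr (@flc k A (PA i) (restr alpha X)) (@flc k R (PR i) (restr beta X))
    (gcoc gPA dA (@rgr _ _ gB _ alpha X) i e) (gcob gPA dA (@rgr _ _ gB _ alpha X) i e)
    (gcoc gPR dR (@rgr _ _ gB _ beta X) i e) (gcob gPR dR (@rgr _ _ gB _ beta X) i e).
Proof.
move=> hMA cA rA lA kA kA' hMR cR rR lR kR kR'.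
exact: (sqcorr_trans (balance hB fA hMA cA rA lA kA kA' i X e)
  (sqcorr_sym (balance hB fR hMR cR rR lR kR kR' i X e))).
Qed.

Lemma trivG_id_linear (S : algType k) (gS : nat -> set S) (hc : connected_graded gS)
  (U : lmodType k) : linear (id : U -> kres (trivG hc U)).
Proof.
move=> c x y; congr (_ + _); have e : augmk hc c%:A = c := augm_scalar hc c.
by rewrite [RHS]restrE [RHS]restrE e.
Qed.

Lemma proj_dim_transfer (d : nat) : (forall M : lmodType A, proj_dim_le M d) ->
  forall M : lmodType R, proj_dim_le M d.
Proof.
(* U forgets the action of R on W. The trivial modules over A and over R on this one space are
   compared, and the resolution over R is deformed back to W. *)
move=> gld W; apply: (proj_dim_le_trivial (hc := hcR)); pose U : lmodType k := kres W.
pose X := degree0 hB.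
apply: (syzn_vanish (T := restr beta X) (gT := @rgr _ _ gB _ beta X) (tau := degree0_one hB)).
- exact: (rgr_gmod fR).
- exact: degree0_conc.
- exact: degree0_neq0.
- exact: conc_bounded.
move=> e; have rA := res_resolution hcA (trivG hcA U).
have rR := res_resolution hcR (trivG hcR U).
have := @ext_transfer U X d.+1 e _ _ _ _ _ _ _ _ _ _ _ _ (id : U -> trivG hcA U)
  (id : trivG hcA U -> U) (id : U -> trivG hcR U) (id : trivG hcR U -> U) (gprf (trivG hcA U))
  (@conc_gr0 U) rA (@trivG_id_linear _ _ hcA U) (fun _ => erefl) (fun _ => erefl)
  (gprf (trivG hcR U)) (@conc_gr0 U) rR (@trivG_id_linear _ _ hcR U) (fun _ => erefl) (fun _ => erefl).
move=> /sqcorr_vanish; apply => f.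
exact: (ext_vanishing hA (gld _) (rgr_gmod fA X) rA (leqnn d)).
Qed.

Context (n : nat) (t : 'I_n -> B) (rA : 'I_n -> B -> A) (rR : 'I_n -> B -> R).
Context (n0 : (0 < n)%N) (lA : left_free gB alpha t rA) (lR : left_free gB beta t rR).

Lemma flc_regular (S : algType k) (T : Type) c (f g : T -> S^o) :
  @flc k S T S^o c f g = c *: (f : T -> S) + g.
Proof. by apply: funext => x; rewrite /flc /= [LHS](_ : _ = c%:A * f x + g x) // mulr_algl. Qed.

Lemma triv_linear (S : algType k) (eps : {lrmorphism S -> k^o}) :
  linear (id : k^o -> kres (triv_mod eps)).
Proof.
move=> c x y; congr (_ + _).
have e : eps c%:A = c by rewrite linearZ /= rmorph1; exact: mulr1.
by rewrite [RHS](_ : _ = (eps c%:A : k) * x) // e.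
Qed.

Lemma triv_gmod (S : algType k) (gS : nat -> set S) (eps : {lrmorphism S -> k^o}) :
  (forall i a, (0 < i)%N -> gS i a -> eps a = 0) ->
  graded_module gS (@triv_gr k S eps).
Proof.
move=> h; apply: conc_gmod => i a x i0 ga.
by rewrite [LHS](_ : _ = (eps a : k) * (x : k)) // (h _ _ i0 ga) mul0r.
Qed.

(** No internal degree is shifted, because the basis of B lies in degree 0; so the same l serves for
    both algebras. *)
Lemma ext_concentrated_transfer (d : nat) (l : int) :
  Ext_k_A_concentrated gA d l -> Ext_k_A_concentrated gR d l.
Proof.
move=> [epsA [epsA0 [PA [gPA [dA [augA [resA isoA]]]]]]].
exists (augm hcR); split; first exact: augm_pos.
pose K : gmod gR := Gmod (triv_gmod (augm_pos hcR)).
have resR := res_resolution hcR K.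
exists (res hcR K), (@res_gr _ _ _ hcR K), (@res_d _ _ _ hcR K), (@res_aug _ _ _ hcR K).
split; first exact: resR.
move=> i e; pose b := (i == d) && (e + l == 0).
have sA : subquotient_onto (@flc k A (PA i) A^o) 'rV[k]_b
    (gcoc gPA dA (regular_gr gA : int -> set A^o) i e)
    (gcob gPA dA (regular_gr gA : int -> set A^o) i e).
  have [phi [p1 p2 p3]] := isoA i e; exists phi; split=> // c x y Zx Zy.
  by rewrite flc_regular; exact: p1.
pose X : gmod gB := Gmod (regular_gmod hB).
have hPA j := proj1 (gpr_proj resA j); have hPR j := proj1 (gpr_proj resR j).
have sB := lfree_cohomology hA hB (rfe_gr fA) lA (e := e) sA.
have := @ext_transfer k^o X i e _ _ _ _ _ _ _ _ _ _ _ _ (id : k -> triv_mod epsA)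
  (id : triv_mod epsA -> k) (id : k -> K) (id : K -> k) (triv_gmod epsA0)
  (@conc_gr0 k) resA (@triv_linear _ epsA) (fun _ => erefl) (fun _ => erefl)
  (gprf K) (@conc_gr0 k) resR (@triv_linear _ (augm hcR)) (fun _ => erefl) (fun _ => erefl).
move=> /sqcorr_iso/(_ _ sB) sB'.
have [|phi [p1 p2 p3]] := lfree_cohomology_inv hR hB (rfe_gr fR) lR n0 (b := b) (sB' _).
  by move=> f Zf; exact: (gcob_sub (rgr_gmod fR X) Zf).
exists phi; split=> // c x y Zx Zy.
by have := p1 c x y Zx Zy; rewrite flc_regular.
Qed.

End Link.

Section Dimensions.
Context (k : fieldType) (R : algType k) (gR : nat -> set R) (hc : connected_graded gR).
Let hR := connected_graded_algebra hc.
Context (d : nat) (l : int).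

(* Ext^d(k, R) is not zero. *)
Lemma ext_neq0 : Ext_k_A_concentrated gR d l -> exists (M : lmodType R) (gM : int -> set M)
    (P : nat -> lmodType R) gP dP aug e f,
  [/\ graded_projective_resolution gR gM (P := P) gP dP aug,
    gcoc gP dP (regular_gr gR : int -> set R^o) d e f
  & ~ gcob gP dP (regular_gr gR : int -> set R^o) d e f].
Proof.
move=> [eps [_ [P [gP [dP [aug [hres iso]]]]]]].
(* The nonzero class sits in internal degree -l. *)
exists (triv_mod eps), (@triv_gr k R eps), P, gP, dP, aug, (- l).
have [phi [_ ps pk]] := iso d (- l).
rewrite !eqxx addNr /= in phi ps pk *.
have [f [Zf fE]] := ps (const_mx 1); exists f; split=> // Bf.
have := proj2 (pk f Zf) Bf; rewrite fE => /rowP/(_ ord0).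
by rewrite !mxE => /eqP; apply/negP; exact: oner_neq0.
Qed.

Lemma left_global_dim_of_ext : Ext_k_A_concentrated gR d l ->
  (forall M : lmodType R, proj_dim_le M d) -> left_global_dim R d.
Proof.
move=> /ext_neq0[M [gM [P [gP [dP [aug [e [f [hres Zf Bf]]]]]]]]] hd; split=> // m hm.
rewrite leqNgt; apply/negP => md; case: d md f Zf Bf {hd} => [//|d'] md f Zf Bf.
by apply: Bf; apply: (ext_vanishing hR (hm M) (regular_gmod hR) hres _ Zf).
Qed.

Lemma graded_inj_dim_of_ext : Ext_k_A_concentrated gR d l ->
  (forall M : lmodType R, proj_dim_le M d) ->
  graded_inj_dim gR (@regular_gr k R gR) d.
Proof.
move=> /ext_neq0[M [gM [P [gP [dP [aug [e [f [hres Zf Bf]]]]]]]]] hd; split.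
  apply: (@graded_inj_dim_le_vanishing _ _ _ hc d (Gmod (regular_gmod hR))) => C e' f'.
  exact: (ext_vanishing hR (hd C) (regular_gmod hR) (res_resolution hc C) (leqnn d)).
move=> m hm; rewrite leqNgt; apply/negP => md; case: d md f Zf Bf {hd} => [//|d'] md f Zf Bf.
by apply: Bf; apply: (inj_vanishing hc (regular_gmod hR) hm hres _ Zf).
Qed.

End Dimensions.

(** * Torsors and cotensor products *)

Section StructureMaps.
Context (k : fieldType).
Implicit Types U V W X : lmodType k.

Lemma lin_scalef U V (f : U -> V) (a : k) : linear f -> linear (fun x => a *: f x).
Proof. by move=> fl b x y; rewrite fl scalerDr !scalerA mulrC. Qed.

Lemma lunit_bilin V : is_bilin (fun (c : k^o) (v : V) => c *: v).
Proof.
split=> [v a b c|c a v w]; first by rewrite scalerDl scalerA.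
by rewrite scalerDr !scalerA mulrC.
Qed.

Lemma lunit_linear V : linear (@lunit k V). Proof. exact: (tlift_linear (lunit_bilin V)). Qed.

Lemma lunit_tens V c (v : V) : lunit ((c : k^o) ⊗t v) = c *: v.
Proof. exact: (tlift_tens (lunit_bilin V)). Qed.

Lemma runit_bilin V : is_bilin (fun (v : V) (c : k^o) => c *: v).
Proof. by have [h1 h2] := lunit_bilin V; split. Qed.

Lemma runit_linear V : linear (@runit k V). Proof. exact: (tlift_linear (runit_bilin V)). Qed.

Lemma runit_tens V c (v : V) : runit (v ⊗t (c : k^o)) = c *: v.
Proof. exact: (tlift_tens (runit_bilin V)). Qed.

Lemma mulT_bilin (A : algType k) : is_bilin (fun a b : A => a * b).
Proof. by split=> [b|a]; [exact: mull_linear|exact: mulr_linear]. Qed.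

Lemma mulT_linear (A : algType k) : linear (@mulT k A).
Proof. exact: (tlift_linear (mulT_bilin A)). Qed.

Lemma mulT_tens (A : algType k) (a b : A) : mulT (a ⊗t b) = a * b.
Proof. exact: (tlift_tens (mulT_bilin A)). Qed.

End StructureMaps.

Ltac linearity := first
  [ exact: lin_id | exact: linearP | exact: tens_linl | exact: tens_linr
  | exact: mull_linear | exact: mulr_linear | exact: lunit_linear | exact: runit_linear | exact: mulT_linear
  | exact: (lin_scalef _ (@lin_id _ _)) | eassumption
  | match goal with h : is_bilin _ |- _ =>
      first [exact: (proj1 h) | exact: (proj2 h) | exact: (tlift_linear h)] end
  | match goal with
    | |- GRing.linear_for _ (fun x => ?f (@?g x)) =>
        refine (@lin_comp _ _ _ _ f g _ _); linearity
    | |- GRing.linear_for _ (fun x => @?f x + @?g x) =>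
        refine (@lin_addf _ _ _ f g _ _); linearity
    | |- GRing.linear_for _ (fun x => @tens _ _ _ (@?g x) ?w) =>
        refine (@lin_comp _ _ _ _ (fun v => v ⊗t w) g _ _); linearity
    | |- GRing.linear_for _ (fun x => @GRing.mul _ (@?g x) ?w) =>
        refine (@lin_comp _ _ _ _ (fun v => v * w) g _ _); linearity
    end ].

Section TensorCalculus.
Context (k : fieldType).
Implicit Types U V W X : lmodType k.

Lemma tmap_comp U V W U' V' W' (f : {linear V -> W}) (g : {linear U -> V})
    (f' : {linear V' -> W'}) (g' : {linear U' -> V'}) (h : {linear U -> W})
    (h' : {linear U' -> W'}) (x : U ⊗ U') :
  (forall y, h y = f (g y)) -> (forall y, h' y = f' (g' y)) ->
  tmap f f' (tmap g g' x) = tmap h h' x.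
Proof.
move=> e e'; move: x; apply: tens_ext => [||u u']; [linearity|linearity|].
by rewrite !tmap_tens e e'.
Qed.

Lemma tmap_id U V (x : U ⊗ V) : tmap idfun idfun x = x.
Proof.
move: x; apply: tens_ext => [||u v]; [linearity|linearity|].
exact: tmap_tens.
Qed.

Lemma tmap_can U V U' V' (f : {linear U -> V}) (fi : {linear V -> U})
    (f' : {linear U' -> V'}) (fi' : {linear V' -> U'}) :
  cancel f fi -> cancel f' fi' -> cancel (tmap f f') (tmap fi fi').
Proof.
move=> fK f'K x; rewrite (tmap_comp (h := idfun) (h' := idfun)) => [|y|y] //.
exact: tmap_id.
Qed.

Lemma tassoc_natural U U' V V' W W' (f : {linear U -> U'}) (g : {linear V -> V'})
    (h : {linear W -> W'}) (x : U ⊗ V ⊗ W) :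
  tassoc (tmap (tmap f g) h x) = tmap f (tmap g h) (tassoc x).
Proof.
move: x; apply: tens_ext => [||y w]; [linearity|linearity|].
rewrite tmap_tens; move: y; apply: tens_ext => [||u v]; [linearity|linearity|].
by rewrite /= tmap_tens !tassoc_tens !tmap_tens /= tmap_tens.
Qed.

Lemma tens_injr V W (w : W) (v : V) : w != 0 -> w ⊗t v = 0 -> v = 0.
Proof.
move=> w0 e; apply/eqP; apply: contraT => v0.
by have := tens_neq0 w0 v0; rewrite e eqxx.
Qed.

End TensorCalculus.

Section Coordinates.
Context (k : fieldType) (T : lmodType k) (n : nat) (t : 'I_n -> T) (c : 'I_n -> T -> k^o).

Record is_basis : Prop := {
  basis_lin : forall j, linear (c j);
  basis_dec : forall x, x = \sum_j c j x *: t j;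
  basis_coord : forall i j, c j (t i) = (i == j)%:R
}.

Context (hb : is_basis) (V : lmodType k).

Definition tcoord (j : 'I_n) : V ⊗ T -> V := tlift (fun v x => (c j x : k) *: v).

Lemma tcoord_bilin j : is_bilin (fun (v : V) (x : T) => (c j x : k) *: v).
Proof.
split=> [x a v w|v a x y]; first by rewrite scalerDr !scalerA mulrC.
by rewrite (basis_lin hb) scalerDl scalerA.
Qed.

Lemma tcoord_linear j : linear (tcoord j).
Proof. exact: (tlift_linear (tcoord_bilin j)). Qed.

Lemma tcoord_tens j v x : tcoord j (v ⊗t x) = (c j x : k) *: v.
Proof. exact: (tlift_tens (tcoord_bilin j)). Qed.

Lemma tcoord_dec z : z = \sum_j tcoord j z ⊗t t j.
Proof.
move: z; apply: tens_ext => [||v x].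
- exact: lin_id.
- move=> a y z; rewrite scaler_sumr -big_split; apply: eq_bigr => j _ /=.
  by rewrite (tcoord_linear j) (tens_linl (t j)).
rewrite {1}(basis_dec hb x) (lin_sum _ _ _ (tens_linr v)); apply: eq_bigr => j _.
by rewrite tcoord_tens (lin_scale _ _ (tens_linr v)) (lin_scale _ _ (tens_linl (t j))).
Qed.

Lemma tcoord_coord (v : 'I_n -> V) j : tcoord j (\sum_i v i ⊗t t i) = v j.
Proof.
rewrite (lin_sum _ _ _ (tcoord_linear j)) (bigD1 j) //= big1 ?addr0.
  by rewrite tcoord_tens (basis_coord hb) eqxx scale1r.
by move=> i ij; rewrite tcoord_tens (basis_coord hb) (negPf ij) scale0r.
Qed.

Lemma tens_subP (X : set V) x : submod X -> tens_sub X x <-> forall j, X (tcoord j x).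
Proof.
move=> hX; split=> [[s [sX ->]] j|h].
  rewrite (lin_sum _ _ _ (tcoord_linear j)) big_seq; apply: (big_ind X).
  - by case: hX.
  - by move=> y z; exact: submod_add.
  - by move=> p ps; rewrite tcoord_tens; apply: (submod_scale hX); exact: sX.
exists [seq (tcoord j x, t j) | j <- enum 'I_n]; split; last first.
  by rewrite big_map big_enum /=; exact: tcoord_dec.
by move=> p /mapP[j _ ->]; exact: h.
Qed.

End Coordinates.

(** * Freeness of A ⊗ T over Ã from a bijective Galois map *)

Section Cotensor.
Context (k : fieldType) (H : falgType k) (HH : hopf H).
Context (T : algType k) (rhoT : {lrmorphism T -> H ⊗ T}) (hT : left_comodule_algebra HH rhoT).
Context (A : algType k) (rhoA : {lrmorphism A -> A ⊗ H}) (hA : right_comodule_algebra HH rhoA).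
Context (n : nat) (t : 'I_n -> T) (c : 'I_n -> T -> k^o) (hb : is_basis t c).
Context (r : T -> T -> T) (hr : is_bilin r).

(** [r x] stands for multiplication by x on either side, so that one argument gives freeness on both
    sides. *)
Definition rmap (x : T) : {linear T -> T} := mklin (proj2 hr x).

Lemma rmap_lin (U : lmodType k) (y : U ⊗ T) : linear (fun x => tmap idfun (rmap x) y).
Proof.
move=> a x x'; move: y; apply: tens_ext => [||u v]; [linearity|linearity|].
by rewrite !tmap_tens /= (proj1 hr v) (tens_linr u).
Qed.

Lemma galois_bilin : is_bilin (fun s x : T => tmap idfun (rmap x) (rhoT s)).
Proof.
split=> [x|s]; last exact: rmap_lin.
exact: (lin_comp (linearP (tmap idfun (rmap x))) (linearP rhoT)).
Qed.

(* s ⊗ x |-> s_(-1) ⊗ r x s_(0) *)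
Definition galois : {linear T ⊗ T -> H ⊗ T} := mklin (tlift_linear galois_bilin).

Lemma galois_tens s x : galois (s ⊗t x) = tmap idfun (rmap x) (rhoT s).
Proof. exact: (tlift_tens galois_bilin). Qed.

Definition rho2 : {linear T ⊗ T -> H ⊗ (T ⊗ T)} :=
  mklin (lin_comp (linearP (@tassoc k H T T)) (linearP (tmap rhoT idfun))).

Definition del2 : {linear H ⊗ T -> H ⊗ (H ⊗ T)} :=
  mklin (lin_comp (linearP (@tassoc k H H T)) (linearP (tmap (comul HH) idfun))).

Definition eps2 : {linear H ⊗ T -> T} :=
  mklin (lin_comp (@lunit_linear k T) (linearP (tmap (counit HH) idfun))).

Lemma galois_slice (x : T) (y : H ⊗ T) :
  tmap idfun galois (tassoc (y ⊗t x)) = tmap idfun (tmap idfun (rmap x)) (tmap idfun rhoT y).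
Proof.
move: y; apply: tens_ext => [||h s]; [linearity|linearity|].
by rewrite tassoc_tens !tmap_tens galois_tens.
Qed.

(** Coassociativity of the coaction: the Galois map is a comodule map, from T ⊗ T with the coaction
    of the first factor to H ⊗ T with the comultiplication of H. *)
Lemma galois_colinear (y : T ⊗ T) : del2 (galois y) = tmap idfun galois (rho2 y).
Proof.
move: y; apply: tens_ext => [||s x]; [linearity|linearity|].
rewrite galois_tens [in RHS]/= tmap_tens galois_slice -(proj1 hT s) -tassoc_natural.
congr tassoc; transitivity (tmap (comul HH) (rmap x) (rhoT s)); first exact: tmap_comp.
by symmetry; apply: tmap_comp => // z /=; rewrite tmap_id.
Qed.

Lemma galois_counit (y : T ⊗ T) : eps2 (galois y) = tlift (fun s x => r x s) y.
Proof.
have hr' : is_bilin (fun s x => r x s) by case: hr => h1 h2; split.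
move: y; apply: tens_ext => [||s x]; [linearity|linearity|].
rewrite galois_tens (tlift_tens hr').
transitivity (lunit (tmap (counit HH) (rmap x) (rhoT s))); first by congr lunit; exact: tmap_comp.
rewrite -{2}(proj2 hT s); move: (rhoT s); apply: tens_ext => [||h z]; [linearity|linearity|].
by rewrite !tmap_tens !lunit_tens /= (lin_scale _ _ (proj2 hr x)).
Qed.

Context (galois_bij : bijective galois).

Let kapi := sval (cid (let: Bijective g gK Kg := galois_bij in ex_intro (fun g => cancel galois g /\ cancel g galois) g (conj gK Kg))).
Let kapK : cancel galois kapi. Proof. by rewrite /kapi; case: cid => g []. Qed.
Let kapiK : cancel kapi galois. Proof. by rewrite /kapi; case: cid => g []. Qed.
Let kapil : {linear H ⊗ T -> T ⊗ T} := mklin (lin_inv (linearP galois) kapK kapiK).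

Let coeqA : {linear A ⊗ T -> A ⊗ (H ⊗ T)} :=
  mklin (lin_comp (linearP (@tassoc k A H T)) (linearP (tmap rhoA idfun))).

Let coeqAE x : coeqA x = tassoc (tmap rhoA idfun x). Proof. by []. Qed.
Let coeqA_tens a x : coeqA (a ⊗t x) = tassoc (rhoA a ⊗t x).
Proof. by rewrite coeqAE tmap_tens. Qed.

Let intil (x : A ⊗ T) : Prop := coeqA x = tmap idfun rhoT x.

Let act (x : T) : {linear A ⊗ T -> A ⊗ T} := tmap idfun (rmap x).

(** The defining equation of Ã lets the coaction of T, which occurs in the Galois map, be traded for
    that of A. *)
Let psi_act (x : T) (z : A ⊗ T) : intil z ->
  tmap idfun galois (tassoc (z ⊗t x)) = coeqA (act x z).
Proof.
have E1 : tmap idfun galois (tassoc (z ⊗t x)) = tmap idfun (tmap idfun (rmap x)) (tmap idfun rhoT z).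
  move: z; apply: tens_ext => [||a s]; [linearity|linearity|].
  by rewrite tassoc_tens !tmap_tens galois_tens.
move=> hz; rewrite E1 -hz coeqAE -tassoc_natural coeqAE; congr tassoc.
transitivity (tmap rhoA (rmap x) z); last by symmetry; exact: tmap_comp.
by apply: tmap_comp => // y /=; rewrite tmap_id.
Qed.

Let slice (j : 'I_n) : {linear A ⊗ (T ⊗ T) -> A ⊗ T} :=
  tmap idfun (mklin (tcoord_linear hb (V := T) j)).

Let sliceE j a w : slice j (a ⊗t w) = a ⊗t tcoord c j w. Proof. exact: tmap_tens. Qed.
Let actE x a s : act x (a ⊗t s) = a ⊗t r x s. Proof. exact: tmap_tens. Qed.

Let slice_tens (z : 'I_n -> A ⊗ T) j : slice j (\sum_i tassoc (z i ⊗t t i)) = z j.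
Proof.
have E x i : slice j (tassoc (x ⊗t t i)) = (i == j)%:R *: x.
  move: x; apply: tens_ext => [||a s]; [linearity|linearity|].
  rewrite tassoc_tens sliceE (tcoord_tens hb) (basis_coord hb).
  exact: (lin_scale _ _ (tens_linr a)).
rewrite linear_sum (bigD1 j) //= big1 ?addr0; first by rewrite E eqxx scale1r.
by move=> i ij; rewrite E (negPf ij) scale0r.
Qed.

Let slice_dec (z : A ⊗ (T ⊗ T)) : z = \sum_j tassoc (slice j z ⊗t t j).
Proof.
move: z; apply: tens_ext => [||a w].
- exact: lin_id.
- move=> b y z; rewrite scaler_sumr -big_split; apply: eq_bigr => j _ /=.
  by rewrite (linearP (slice j)) (tens_linl (t j)) (linearP (@tassoc k A T T)).
rewrite {1}(tcoord_dec hb w) (lin_sum _ _ _ (tens_linr a)); apply: eq_bigr => j _.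
by rewrite sliceE tassoc_tens.
Qed.

(** By [psi_act], ρ_A applied to the relation is the Galois map applied to the sum of the z_j ⊗ t_j;
    the latter is therefore 0, and so are its slices z_j. *)
Let cotensor_free (z : 'I_n -> A ⊗ T) :
  (forall j, intil (z j)) -> \sum_j act (t j) (z j) = 0 -> forall j, z j = 0.
Proof.
move=> hz e j; rewrite -[LHS]slice_tens.
have -> : \sum_i tassoc (z i ⊗t t i) = 0; last by rewrite linear0.
have kc : cancel galois kapil by exact: kapK.
have ic : cancel (idfun : A -> A) idfun by [].
apply: (can_inj (tmap_can ic kc)); rewrite linear0 linear_sum.
rewrite (eq_bigr (fun i => coeqA (act (t i) (z i)))) => [|i _]; last exact: psi_act.
by rewrite -linear_sum e linear0.
Qed.

Let coeqA_coassoc (b : A ⊗ T) :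
  tassoc (tmap rhoA idfun (coeqA b)) = tmap idfun del2 (coeqA b).
Proof.
move: b; apply: tens_ext => [||a s]; [linearity|linearity|].
rewrite coeqA_tens.
pose sg : {linear H ⊗ H -> H ⊗ (H ⊗ T)} :=
  mklin (lin_comp (linearP (@tassoc k H H T)) (tens_linl s)).
have sgE w : sg w = tassoc (w ⊗t s) by [].
transitivity (tmap idfun sg (tassoc (tmap rhoA idfun (rhoA a)))); last first.
  rewrite (proj1 hA); move: (rhoA a); apply: tens_ext => [||a' h]; [linearity|linearity|].
  by rewrite tassoc_tens !tmap_tens sgE [del2 _]/= tmap_tens.
move: (rhoA a); apply: tens_ext => [||a' h]; [linearity|linearity|].
rewrite tassoc_tens !tmap_tens; change (tassoc (rhoA a' ⊗t (h ⊗t s)) = tmap idfun sg (tassoc (rhoA a' ⊗t h))).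
move: (rhoA a'); apply: tens_ext => [||u v]; [linearity|linearity|].
by rewrite !tassoc_tens tmap_tens sgE tassoc_tens.
Qed.

Let coeqA_counit (b : A ⊗ T) : tmap idfun eps2 (coeqA b) = b.
Proof.
move: b; apply: tens_ext => [||a s]; [linearity|linearity|].
rewrite coeqA_tens -{2}(proj2 hA a).
move: (rhoA a); apply: tens_ext => [||a' h]; [linearity|linearity|].
rewrite tassoc_tens !tmap_tens [eps2 _]/= tmap_tens lunit_tens runit_tens /=.
by rewrite (lin_scale _ _ (tens_linr a')) (lin_scale _ _ (tens_linl s)).
Qed.

Let tcoord2 (j : 'I_n) : {linear T ⊗ T -> T} := mklin (tcoord_linear hb (V := T) j).

Let tcoord_colinear j (w : T ⊗ T) : tmap idfun (tcoord2 j) (rho2 w) = rhoT (tcoord2 j w).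
Proof.
move: w; apply: tens_ext => [||s x]; [linearity|linearity|].
have -> : rho2 (s ⊗t x) = tassoc (rhoT s ⊗t x) by rewrite /= tmap_tens.
have -> : rhoT (tcoord2 j (s ⊗t x)) = (c j x : k) *: rhoT s.
  by rewrite /= (tcoord_tens hb) linearZ.
move: (rhoT s); apply: tens_ext => [||h z]; [linearity|linearity|].
by rewrite tassoc_tens tmap_tens /= (tcoord_tens hb) (lin_scale _ _ (tens_linr h)).
Qed.

(** Apply ρ_A to b and then the inverse Galois map. Coassociativity and colinearity show that the
    slices of the resulting element of A ⊗ T ⊗ T lie in Ã, and the counit recovers b from them. *)
Let cotensor_span (b : A ⊗ T) : exists z : 'I_n -> A ⊗ T,
  (forall j, intil (z j)) /\ b = \sum_j act (t j) (z j).
Proof.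
have kiK : cancel (kapil : H ⊗ T -> T ⊗ T) galois by exact: kapiK.
have kK : cancel galois (kapil : H ⊗ T -> T ⊗ T) by exact: kapK.
have ic : cancel (idfun : A -> A) idfun by [].
have icH : cancel (idfun : H -> H) idfun by [].
pose z := tmap idfun kapil (coeqA b).
have zE : tmap idfun galois z = coeqA b by exact: (tmap_can ic kiK).
have LR : tassoc (tmap rhoA idfun z) = tmap idfun rho2 z.
  have := can_inj (tmap_can ic (tmap_can icH kK)); apply.
  rewrite -tassoc_natural.
  transitivity (tassoc (tmap rhoA idfun (coeqA b))).
    congr tassoc; rewrite -zE; transitivity (tmap rhoA galois z).
      by apply: tmap_comp => // y /=; rewrite tmap_id.
    by symmetry; exact: tmap_comp.
  rewrite coeqA_coassoc -zE; pose dk := mklin (lin_comp (linearP del2) (linearP galois)).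
  transitivity (tmap idfun dk z); first exact: tmap_comp.
  by symmetry; apply: tmap_comp => // y; exact: galois_colinear.
exists (fun j => slice j z); split=> [j|].
  rewrite /intil coeqAE.
  transitivity (tmap idfun (tmap idfun (tcoord2 j)) (tassoc (tmap rhoA idfun z))).
    rewrite -tassoc_natural; congr tassoc; transitivity (tmap rhoA (tcoord2 j) z).
      exact: tmap_comp.
    by symmetry; apply: tmap_comp => // y /=; rewrite tmap_id.
  pose rt := mklin (lin_comp (linearP rhoT) (linearP (tcoord2 j))).
  rewrite LR; transitivity (tmap idfun rt z); last by symmetry; exact: tmap_comp.
  by apply: tmap_comp => // w; rewrite -[LHS]/(rhoT (tcoord2 j w)) -tcoord_colinear.
pose Q := mklin (lin_comp (linearP eps2) (linearP galois)).
transitivity (tmap idfun Q z).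
  by rewrite -[LHS]coeqA_counit -zE; exact: tmap_comp.
rewrite {1}[z]slice_dec linear_sum; apply: eq_bigr => j _.
move: (slice j z); apply: tens_ext => [||a s]; [linearity|linearity|].
have hr' : is_bilin (fun s x => r x s) by case: hr => h1 h2; split.
rewrite tassoc_tens actE; transitivity (a ⊗t Q (s ⊗t t j)); first exact: tmap_tens.
by rewrite -[Q _]/(eps2 (galois _)) galois_counit (tlift_tens hr').
Qed.

Lemma cotensor_coordinates : exists q : 'I_n -> A ⊗ T -> tilde rhoA rhoT,
  (forall b, b = \sum_j tmap idfun (rmap (t j)) (tilde_val (q j b))) /\
  (forall z j, q j (\sum_i tmap idfun (rmap (t i)) (tilde_val (z i))) = z j).
Proof.
have ex b : exists z : 'I_n -> tilde rhoA rhoT,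
    b = \sum_j tmap idfun (rmap (t j)) (tilde_val (z j)).
  have [z [hz ->]] := cotensor_span b.
  have zt j : z j \in in_tilde rhoA rhoT by apply/eqP; exact: hz.
  by exists (fun j => Tilde (zt j)).
have [q qE] := choice ex; exists (fun j b => q b j); split=> // z j.
have tv (y : tilde rhoA rhoT) : intil (tilde_val y) by case: y => y /= /eqP.
apply/val_inj/eqP; rewrite -subr_eq0; apply/eqP.
set b := \sum_i _; pose w i := tilde_val (q b i) - tilde_val (z i).
apply: (cotensor_free (z := w)) => [i|].
  by rewrite /intil /w !linearB; congr (_ - _); exact: tv.
under eq_bigr => i _ do rewrite /w linearB.
by rewrite sumrB; apply/eqP; rewrite subr_eq0; apply/eqP; rewrite -[RHS]/b [in RHS](qE b).
Qed.

End Cotensor.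

(** * The two Galois maps of a torsor *)

Section TorsorBijections.
Context (k : fieldType) (H : falgType k) (HH : hopf H) (T : algType k).
Context (rhoT : {lrmorphism T -> H ⊗ T}).

Definition rmulT (x s : T) : T := s * x.
Definition lmulT (x s : T) : T := x * s.

Lemma rmulT_bilin : is_bilin rmulT.
Proof. by split=> [s|x]; [exact: mulr_linear|exact: mull_linear]. Qed.

Lemma lmulT_bilin : is_bilin lmulT.
Proof. by split=> [s|x]; [exact: mull_linear|exact: mulr_linear]. Qed.

Lemma tmap_rmulT (U : algType k) x (z : U ⊗ T) :
  tmap idfun (rmap rmulT_bilin x) z = z * (1 ⊗t x).
Proof.
move: z; apply: tens_ext => [||u s]; [linearity|linearity|].
by rewrite tmap_tens tens_mulE mulr1.
Qed.

Lemma tmap_lmulT (U : algType k) x (z : U ⊗ T) :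
  tmap idfun (rmap lmulT_bilin x) z = (1 ⊗t x) * z.
Proof.
move: z; apply: tens_ext => [||u s]; [linearity|linearity|].
by rewrite tmap_tens tens_mulE mul1r.
Qed.

Context (hT : left_torsor HH rhoT).

Let can (x : T ⊗ T) : H ⊗ T := tmap idfun (mklin (@mulT_linear k T)) (tassoc (tmap rhoT idfun x)).

Let can_linear : linear can.
Proof. exact: (lin_comp (linearP (tmap _ _)) (lin_comp (linearP (@tassoc k H T T)) (linearP (tmap _ _)))). Qed.

Let can_tens s x : can (s ⊗t x) = rhoT s * (1 ⊗t x).
Proof.
have -> : can (s ⊗t x) = tmap idfun (mklin (@mulT_linear k T)) (tassoc (rhoT s ⊗t x)).
  by rewrite /can tmap_tens.
move: (rhoT s); apply: tens_ext => [||h u]; [linearity|linearity|].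
by rewrite tassoc_tens tmap_tens /= mulT_tens tens_mulE mulr1.
Qed.

Let can_bij : bijective can. Proof. exact: (torsor_can hT). Qed.

Lemma galois_rmulT_bij : bijective (galois rhoT rmulT_bilin).
Proof.
apply: (eq_bij can_bij); apply: tens_ext => [||s x]; [linearity|linearity|].
by rewrite galois_tens can_tens tmap_rmulT.
Qed.

Section Twist.
Context (f g : {linear H -> H}).

Let tw_bilin : is_bilin (fun h u => (f h ⊗t 1) * tmap g idfun (rhoT u)).
Proof.
split=> [u|h].
  exact: (lin_comp (mull_linear _) (lin_comp (tens_linl (1 : T)) (linearP f))).
exact: (lin_comp (mulr_linear _) (lin_comp (linearP (tmap _ _)) (linearP rhoT))).
Qed.

(* h ⊗ u |-> f h g(u_(-1)) ⊗ u_(0) *)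
Definition tw : {linear H ⊗ T -> H ⊗ T} := mklin (tlift_linear tw_bilin).

Lemma tw_tens h u : tw (h ⊗t u) = (f h ⊗t 1) * tmap g idfun (rhoT u).
Proof. exact: (tlift_tens tw_bilin). Qed.

(** The image is f(u_(-2)) g(u_(-1)) ⊗ u_(0), and the convolution product of f and g is the
    counit. *)
Lemma tw_rho u : (forall h, mulT (tmap f g (comul HH h)) = (counit HH h)%:A) ->
  tw (rhoT u) = 1 ⊗t u.
Proof.
move=> fg.
have Wb : is_bilin (fun h (y : H ⊗ T) => (f h ⊗t 1) * tmap g idfun y).
  split=> [y|h].
    exact: (lin_comp (mull_linear _) (lin_comp (tens_linl (1 : T)) (linearP f))).
  exact: (lin_comp (mulr_linear _) (linearP (tmap _ _))).
pose W := mklin (tlift_linear Wb).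
have WE h y : W (h ⊗t y) = (f h ⊗t 1) * tmap g idfun y by exact: (tlift_tens Wb).
have [c1 c2] := torsor_comodule hT.
transitivity (W (tmap idfun rhoT (rhoT u))).
  move: (rhoT u); apply: tens_ext => [||h v]; [linearity|linearity|].
  by rewrite tw_tens tmap_tens WE.
rewrite -c1 -{2}(c2 u); move: (rhoT u); apply: tens_ext => [||h v]; [linearity|linearity|].
rewrite !tmap_tens lunit_tens (lin_scale _ _ (tens_linr 1)) -(lin_scale _ _ (tens_linl _)).
rewrite -fg; change (W (tassoc (comul HH h ⊗t v)) = mulT (tmap f g (comul HH h)) ⊗t v).
move: (comul HH h); apply: tens_ext => [||h1 h2]; [linearity|linearity|].
by rewrite tassoc_tens WE !tmap_tens mulT_tens tens_mulE mul1r.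
Qed.

End Twist.

Let id_mul (g : {linear H -> H}) h y : tw idfun g ((h ⊗t 1) * y) = (h ⊗t 1) * tw idfun g y.
Proof.
move: y; apply: tens_ext => [||h' u]; [linearity|linearity|].
by rewrite tens_mulE !tw_tens mul1r mulrA tens_mulE mul1r.
Qed.

Let S := antipode HH.

(** The inverse sends h ⊗ u to h S(u_(-1)) ⊗ u_(0). *)
Let tw_id_bij : bijective (tw idfun idfun).
Proof.
exists (tw idfun S); apply: tens_ext => [||h u]; [linearity|linearity| |linearity|linearity|].
- rewrite tw_tens tmap_id id_mul tw_rho; last by move=> ?; exact: antipoder.
  by rewrite tens_mulE mulr1 mul1r.
rewrite tw_tens id_mul.
have -> : tw idfun idfun (tmap S idfun (rhoT u)) = tw S idfun (rhoT u).
  move: (rhoT u); apply: tens_ext => [||h' v]; [linearity|linearity|].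
  by rewrite tmap_tens !tw_tens.
rewrite tw_rho; last by move=> ?; exact: antipodel.
by rewrite tens_mulE mulr1 mul1r.
Qed.

Let flip_bilin : is_bilin (fun x s : T => s ⊗t x).
Proof. by split=> [s|x]; [exact: tens_linr|exact: tens_linl]. Qed.

Let flip : {linear T ⊗ T -> T ⊗ T} := mklin (tlift_linear flip_bilin).
Let flip_tens x s : flip (x ⊗t s) = s ⊗t x. Proof. exact: (tlift_tens flip_bilin). Qed.

Let flipK : involutive flip.
Proof.
apply: tens_ext => [||x s]; [linearity|linearity|].
by rewrite !flip_tens.
Qed.

(** A composite of four bijections. The flip, the torsor map and S ⊗ id send x ⊗ s to S(s_(-1)) ⊗
    s_(0) x. Multiplying the first factor by the coaction of the second gives S(s_(-2)) s_(-1)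
    x_(-1) ⊗ s_(0) x_(0), which is x_(-1) ⊗ s x_(0). *)
Lemma galois_lmulT_bij : bijective S -> bijective (galois rhoT lmulT_bilin).
Proof.
case=> S' SK S'K; pose S'l := mklin (lin_inv (linearP S) SK S'K).
have ic : cancel (idfun : T -> T) idfun by [].
have K1 : cancel S S'l by []. have K2 : cancel S'l S by [].
have b1 : bijective (tmap S (idfun : {linear T -> T})).
  by exists (tmap S'l idfun); [exact: (tmap_can K1 ic)|exact: (tmap_can K2 ic)].
have bf : bijective flip by exists flip; exact: flipK.
have b : bijective (fun y => tw idfun idfun (tmap S idfun (can (flip y)))).
  exact: (bij_comp tw_id_bij (bij_comp b1 (bij_comp can_bij bf))).
apply: (eq_bij b).
apply: tens_ext => [||x s]; [linearity|linearity|].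
rewrite galois_tens tmap_lmulT -[1 ⊗t s](@tw_rho S idfun); last by move=> ?; exact: antipodel.
rewrite flip_tens can_tens.
move: (rhoT s); apply: tens_ext => [||h u]; [linearity|linearity|].
by rewrite tens_mulE tmap_tens !tw_tens !tmap_id mulr1 rmorphM mulrA.
Qed.

End TorsorBijections.

(** * Gradings and bases of A ⊗ T and of Ã *)

Section TensorGrading.
Context (k : fieldType) (A : algType k) (gr : nat -> set A) (hA : graded_algebra gr).

Let hs := galg_sum hA.

Lemma gr_submod i : submod (M := A) (gr i).
Proof.
split; first exact: gr0.
by move=> a x y gx gy; apply: (grD hs) => //; exact: galg_scale.
Qed.

Definition cmpl i : {linear A -> A} := mklin (cmp_linear hs (galg_scale hA) i).

Lemma cmpl_tens_sub (V : lmodType k) i j (x : A ⊗ V) :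
  tens_sub (gr j) x -> tmap (cmpl i) idfun x = if i == j then x else 0.
Proof.
case=> s [sg ->]; have E p : p \in s ->
    tmap (cmpl i) idfun (p.1 ⊗t p.2) = if i == j then p.1 ⊗t p.2 else 0.
  move=> ps; rewrite tmap_tens /= (cmp_gr hs _ (sg _ ps)).
  by case: ifP => // _; exact: linear_fun0 (tens_linl _).
rewrite linear_sum (eq_big_seq _ E).
by case: ifP => // _; rewrite big1.
Qed.

Context (T : algType k) (n : nat) (t : 'I_n -> T) (c : 'I_n -> T -> k^o) (hb : is_basis t c).

Definition tens_gr (i : nat) : set (A ⊗ T) := tens_sub (gr i).

Lemma tens_grP i x : tens_gr i x <-> forall j, gr i (tcoord c j x).
Proof. exact/(tens_subP hb)/gr_submod. Qed.

Lemma tens_gr_tens i a x : gr i a -> tens_gr i (a ⊗t x).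
Proof. by move=> ga; exists [:: (a, x)]; rewrite big_seq1; split=> // p; rewrite inE => /eqP->. Qed.

Lemma tens_gr_sum : direct_sum tens_gr.
Proof.
have tl j := tcoord_linear hb (V := A) j.
apply: (@direct_sum_intro _ _ _ ('I_n * nat)%type snd (fun=> A)
  (fun p x => cmp gr p.2 (tcoord c p.1 x))).
- by move=> i; apply/tens_grP => j; rewrite (linear_fun0 (tl j)); exact: gr0.
- move=> i x y /tens_grP gx /tens_grP gy; apply/tens_grP => j.
  by rewrite (lin_sub (tl j)); exact: (grB hs).
- move=> P P0 PD Ph x; rewrite (tcoord_dec hb x); apply: big_ind => // j _.
  apply: (gr_ind hs (P := fun a => P (a ⊗t t j))).
  + by rewrite (linear_fun0 (tens_linl (t j))).
  + by move=> u v Pu Pv; rewrite (lin_add (tens_linl (t j))); exact: PD.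
  + by move=> i a ga; apply: (Ph i); exact: tens_gr_tens.
- by move=> [j i] x y /=; rewrite (lin_add (tl j)) cmpD.
- by move=> [j i] i' x /tens_grP gx /= ne; exact: (cmp_ne hs (gx j)).
move=> x x0; rewrite (tcoord_dec hb x) big1 // => j _.
rewrite [tcoord c j x](_ : _ = 0) ?(linear_fun0 (tens_linl (t j))) //.
by apply: (cmp_ext hs) => i; rewrite cmp0 //; exact: (x0 (j, i)).
Qed.

Lemma tens_gr_graded : graded_algebra tens_gr.
Proof.
split; first exact: tens_gr_sum.
- move=> i a x /tens_grP gx; apply/tens_grP => j.
  by rewrite (lin_scale _ _ (tcoord_linear hb j)); exact: galg_scale.
- move=> i j _ _ [s [sg ->]] [s' [sg' ->]]; rewrite big_distrl big_seq.
  apply: (gr_sum tens_gr_sum) => p ps; rewrite big_distrr big_seq.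
  apply: (gr_sum tens_gr_sum) => q qs; rewrite /= tens_mulE; apply: tens_gr_tens.
  by apply: galg_mul => //; [exact: sg|exact: sg'].
by apply: tens_gr_tens; exact: galg_one.
Qed.

Lemma cmp_tens_gr i x : cmp tens_gr i x = tmap (cmpl i) idfun x.
Proof.
move: x; apply: (gr_ind tens_gr_sum).
- by rewrite cmp0 ?linear0 //; exact: tens_gr_sum.
- by move=> x y ex ey; rewrite cmpD ?ex ?ey ?linearD //; exact: tens_gr_sum.
by move=> j x gx; rewrite (cmpl_tens_sub _ gx) (cmp_gr tens_gr_sum _ gx).
Qed.

End TensorGrading.

Section TensorFree.
Context (k : fieldType) (A T : algType k).

Definition tens_inl (a : A) : A ⊗ T := a ⊗t 1.

Fact tens_inl_linear : linear tens_inl. Proof. exact: tens_linl. Qed.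
Fact tens_inl_multiplicative : monoid_morphism tens_inl.
Proof. by split=> // a b; rewrite /tens_inl tens_mulE mulr1. Qed.
HB.instance Definition _ := GRing.isLinear.Build k A (A ⊗ T) _ tens_inl tens_inl_linear.
HB.instance Definition _ :=
  GRing.isMonoidMorphism.Build A (A ⊗ T) tens_inl tens_inl_multiplicative.

Context (gr : nat -> set A) (hA : graded_algebra gr).
Context (n : nat) (t : 'I_n -> T) (c : 'I_n -> T -> k^o) (hb : is_basis t c).

Let tens_basis (b : A ⊗ T) : b = \sum_j tcoord c j b ⊗t t j := tcoord_dec hb b.

Lemma tens_inl_right_free :
  right_free (tens_gr gr (T := T)) (tens_inl : {lrmorphism A -> A ⊗ T})
    (fun j => 1 ⊗t t j) (tcoord c (V := A)).
Proof.
have E (z : 'I_n -> A) : \sum_j (1 ⊗t t j) * tens_inl (z j) = \sum_j z j ⊗t t j.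
  by apply: eq_bigr => j _; rewrite tens_mulE mul1r mulr1.
split=> [b|z j|j]; rewrite ?E //; first exact: tcoord_coord.
by apply: tens_gr_tens; exact: galg_one.
Qed.

Lemma tens_inl_left_free :
  left_free (tens_gr gr (T := T)) (tens_inl : {lrmorphism A -> A ⊗ T})
    (fun j => 1 ⊗t t j) (tcoord c (V := A)).
Proof.
have E (z : 'I_n -> A) : \sum_j tens_inl (z j) * (1 ⊗t t j) = \sum_j z j ⊗t t j.
  by apply: eq_bigr => j _; rewrite tens_mulE mul1r mulr1.
split=> [b|z j|j].
- by rewrite [LHS]tens_basis -E.
- by transitivity (tcoord c j (\sum_j z j ⊗t t j)); [rewrite -E|exact: tcoord_coord].
by apply: tens_gr_tens; exact: galg_one.
Qed.

End TensorFree.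

Section TildeStructure.
Context (k : fieldType) (H : falgType k) (HH : hopf H).
Context (T : algType k) (rhoT : {lrmorphism T -> H ⊗ T}) (hT : left_torsor HH rhoT).
Context (A : algType k) (gr : nat -> set A) (rhoA : {lrmorphism A -> A ⊗ H}).
Context (hA : connected_graded_comodule_algebra HH gr rhoA).

(** A basis of H carried over by the comodule isomorphism; it is not empty because 1 is not 0 in
    T. *)
Lemma torsor_basis : exists n (t : 'I_n -> T) c, (0 < n)%N /\ is_basis t c.
Proof.
have [f [[g fK gK] _]] := torsor_iso hT.
pose X := vbasis {:H}; pose t j := g (tnth X j).
pose c j (x : T) : k^o := coord X j (f x).
have hb : is_basis t c.
  split=> [j|x|i j].
  - by move=> a x y; rewrite /c linearP linearP.
  - have gl := lin_inv (linearP f) fK gK.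
    rewrite -[LHS]fK {1}(coord_vbasis (memvf (f x))) (lin_sum _ _ _ gl).
    by apply: eq_bigr => j _; rewrite (lin_scale _ _ gl) /t (tnth_nth 0).
  by rewrite /c /t gK (tnth_nth 0) coord_free // (basis_free (vbasisP _)).
exists (\dim {:H}), t, c; split=> //; rewrite lt0n; apply/eqP => d0.
have /eqP := oner_neq0 T; apply; rewrite (basis_dec hb 1) big1 // => j.
by have := ltn_ord j; rewrite {2}d0.
Qed.

Let B := (A ⊗ T)%type.
Let gB : nat -> set B := tens_gr gr (T := T).
Let hcA := cgca_graded hA.
Let hgA := connected_graded_algebra hcA.

Definition tilde_incl : tilde rhoA rhoT -> A ⊗ T := @tilde_val k H A T rhoA rhoT.

Fact tilde_incl_linear : linear tilde_incl. Proof. by move=> a x y. Qed.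
Fact tilde_incl_multiplicative : monoid_morphism tilde_incl. Proof. by split. Qed.
HB.instance Definition _ :=
  GRing.isLinear.Build k (tilde rhoA rhoT) (A ⊗ T) _ tilde_incl tilde_incl_linear.
HB.instance Definition _ :=
  GRing.isMonoidMorphism.Build (tilde rhoA rhoT) (A ⊗ T) tilde_incl tilde_incl_multiplicative.

Lemma tildeE (x : tilde rhoA rhoT) :
  tassoc (tmap rhoA idfun (tilde_val x)) = tmap idfun rhoT (tilde_val x).
Proof. by case: x => x /= /eqP. Qed.

Lemma cmp_coaction i a : tmap (cmpl hgA i) idfun (rhoA a) = rhoA (cmp gr i a).
Proof.
have LD x y : tmap (cmpl hgA i) idfun (rhoA (x + y)) =
    tmap (cmpl hgA i) idfun (rhoA x) + tmap (cmpl hgA i) idfun (rhoA y) by rewrite !linearD.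
move: a; apply: (gr_ind (galg_sum hgA)).
- by rewrite cmp0 ?linear0 ?linear0 //; exact: galg_sum hgA.
- by move=> x y ex ey; rewrite (cmpD (galg_sum hgA)) LD ex ey linearD.
move=> j x gx; rewrite (cmpl_tens_sub _ _ (cgca_subcomodule hA gx)).
by rewrite (cmp_gr (galg_sum hgA) _ gx); case: ifP => // _; rewrite linear0.
Qed.

(** Since the A_j are subcomodules, the projection to degree i commutes with ρ_A; it does not touch
    T. Hence it preserves the equation defining Ã. *)
Lemma tilde_stable i (x : tilde rhoA rhoT) :
  tmap (cmpl hgA i) idfun (tilde_val x) \in in_tilde rhoA rhoT.
Proof.
apply/eqP; pose f := mklin (lin_comp (linearP rhoA) (linearP (cmpl hgA i))).
transitivity (tassoc (tmap (tmap (cmpl hgA i) idfun) idfun (tmap rhoA idfun (tilde_val x)))).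
  congr tassoc; transitivity (tmap f idfun (tilde_val x)); first exact: tmap_comp.
  by symmetry; apply: tmap_comp => // a; rewrite -[RHS]/(tmap (cmpl hgA i) idfun (rhoA a)) cmp_coaction.
rewrite tassoc_natural tildeE.
transitivity (tmap (cmpl hgA i) rhoT (tilde_val x)); last by symmetry; exact: tmap_comp.
by apply: tmap_comp => // y /=; rewrite tmap_id.
Qed.

Lemma tilde_connected : connected_graded (tilde_gr rhoA rhoT gr).
Proof.
have [n [t [c [_ hb]]]] := torsor_basis.
have hB : graded_algebra gB := tens_gr_graded hgA hb.
split.
- apply: (direct_sum_sub (f := tilde_incl) (galg_sum hB)).
  + by move=> x y; rewrite linearB.
  + exact: val_inj.
  by move=> x j; exists (Tilde (tilde_stable j x)); rewrite (cmp_tens_gr hgA hb).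
- by move=> i a x; exact: (galg_scale hB).
- by move=> i j a b; exact: (galg_mul hB).
move=> x; split=> [|[a ->]]; last first.
  exact: (galg_scale hB a (galg_one hB)).
case=> s [sg xE].
have [u uE] : exists u, tilde_val x = 1 ⊗t u.
  have {}sg p : p \in s -> exists a : k, p.1 = a%:A by move=> /sg/(cgr_conn hcA).
  (* In degree 0 each first factor is a scalar and moves across the tensor sign; the default 0 of
     [xget] never occurs. *)
  exists (\sum_(p <- s) xget 0 [set v | p.1 ⊗t p.2 = 1 ⊗t v]).
  rewrite (lin_sum _ _ _ (tens_linr 1)) xE; apply: eq_big_seq => p ps.
  case: xgetP => [v -> //|/(_ _) h]; have [a pa] := sg p ps.
  by case: (h (a *: p.2)); rewrite /= pa (lin_scale _ _ (tens_linr 1)) (lin_scale _ _ (tens_linl _)).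
(* For x = 1 ⊗ u the equation of Ã reads 1 ⊗ (1 ⊗ u) = 1 ⊗ ρ(u): u is coinvariant, hence a
   scalar. *)
have /(torsor_coinv hT) : rhoT u = 1 ⊗t u.
  apply/eqP; rewrite -subr_eq0; apply/eqP/(tens_injr (oner_neq0 A)).
  rewrite (lin_sub (tens_linr 1)); have := tildeE x; rewrite uE.
  by rewrite !tmap_tens rmorph1 tassoc_tens => ->; rewrite subrr.
case=> a ua; exists a; apply: val_inj; rewrite /= uE ua.
exact: (lin_scale _ _ (tens_linr 1)).
Qed.

(** Here the basis multiplies from the left, so the Galois map concerned is the one sending s ⊗ x to
    s_(-1) ⊗ x s_(0). *)
Lemma tilde_right_free n (t : 'I_n -> T) c : is_basis t c -> bijective (antipode HH) ->
  exists q, right_free gB (tilde_incl : {lrmorphism tilde rhoA rhoT -> A ⊗ T})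
    (fun j => 1 ⊗t t j) q.
Proof.
move=> hb Sb.
have [q [q1 q2]] := cotensor_coordinates (torsor_comodule hT) (cgca_comodule hA) hb (galois_lmulT_bij hT Sb).
exists q; split=> [b|z j|j].
- by rewrite [LHS]q1; apply: eq_bigr => j _; exact: tmap_lmulT.
- by rewrite -[RHS]q2; congr (q j _); apply: eq_bigr => i _; rewrite tmap_lmulT.
by apply: tens_gr_tens; exact: galg_one hgA.
Qed.

Lemma tilde_left_free n (t : 'I_n -> T) c : is_basis t c ->
  exists q, left_free gB (tilde_incl : {lrmorphism tilde rhoA rhoT -> A ⊗ T})
    (fun j => 1 ⊗t t j) q.
Proof.
move=> hb.
have [q [q1 q2]] := cotensor_coordinates (torsor_comodule hT) (cgca_comodule hA) hb (galois_rmulT_bij hT).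
exists q; split=> [b|z j|j].
- by rewrite [LHS]q1; apply: eq_bigr => j _; exact: tmap_rmulT.
- by rewrite -[RHS]q2; congr (q j _); apply: eq_bigr => i _; rewrite tmap_rmulT.
by apply: tens_gr_tens; exact: galg_one hgA.
Qed.

End TildeStructure.

(** * Passage from A to Ã on one side, then on both *)

Section Transfer.
Context (k : fieldType) (A R B : algType k).
Context (gA : nat -> set A) (gR : nat -> set R) (gB : nat -> set B).
Context (alpha : {lrmorphism A -> B}) (beta : {lrmorphism R -> B}).
Context (hB : graded_algebra gB) (hcA : connected_graded gA) (hcR : connected_graded gR).
Context (alpha_gr : forall i a, gA i a -> gB i (alpha a)).
Context (beta_gr : forall i a, gR i a -> gB i (beta a)).
Context (n : nat) (n0 : (0 < n)%N) (t : 'I_n -> B).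
Context (rA : 'I_n -> B -> A) (rA' : 'I_n -> B -> A) (rR : 'I_n -> B -> R) (rR' : 'I_n -> B -> R).
Context (fA : right_free gB alpha t rA) (lA : left_free gB alpha t rA').
Context (fR : right_free gB beta t rR) (lR : left_free gB beta t rR').

Lemma AS_transfer d l : Ext_k_A_concentrated gA d l -> (forall M : lmodType A, proj_dim_le M d) ->
  [/\ Ext_k_A_concentrated gR d l, left_global_dim R d & graded_inj_dim gR (@regular_gr k R gR) d].
Proof.
move=> ext gld.
have relA : rel_free gB gA alpha by split=> //; exists n, t, rA.
have relR : rel_free gB gR beta by split=> //; exists n, t, rR.
have extR := ext_concentrated_transfer hB relA relR n0 lA lR ext.
have gldR := proj_dim_transfer hB relA relR gld.
by split=> //; [exact: (left_global_dim_of_ext hcR extR)|exact: (graded_inj_dim_of_ext hcR extR)].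
Qed.

End Transfer.

Theorem theorem4p8 (k : fieldType) (H : falgType k) (HH : hopf H)
    (antipode_bij : bijective (antipode HH))
    (T : algType k) (rhoT : {lrmorphism T -> H ⊗ T})
    (T_torsor : left_torsor HH rhoT)
    (A : algType k) (gr : nat -> set A) (rhoA : {lrmorphism A -> A ⊗ H})
    (A_graded : connected_graded_comodule_algebra HH gr rhoA)
    (A_noetherian : noetherian A) (d : nat) :
  AS_regular gr d -> AS_regular (tilde_gr rhoA rhoT gr) d.
Proof.
move=> [[hcA _ _ [l [extl extr]]] [gldl _] [gldr _]].
have [n [t [c [n0 hb]]]] := torsor_basis T_torsor.
have hcR := tilde_connected T_torsor A_graded.
have hA := connected_graded_algebra hcA.
have hB := tens_gr_graded hA hb.
have fA := tens_inl_right_free hA hb; have lA := tens_inl_left_free hA hb.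
have [rR fR] := tilde_right_free T_torsor A_graded hb antipode_bij.
have [rR' lR] := tilde_left_free T_torsor A_graded hb.
have agr i (a : A) : gr i a -> tens_gr gr i (tens_inl T a) by exact: tens_gr_tens.
have bgr i (x : tilde rhoA rhoT) : tilde_gr rhoA rhoT gr i x -> tens_gr gr i (tilde_incl x) by [].
have [extlR gldlR injlR] := AS_transfer hB hcA hcR agr bgr n0 fA lA fR lR extl gldl.
(* Passing to converse algebras exchanges left and right bases; taking the converse twice gives back
   the original algebra by conversion. *)
have fA' : left_free (R := A^c) (B := (A ⊗ T)^c) (tens_gr gr (T := T)) (conv (tens_inl T)) (fun j => 1 ⊗t t j) (tcoord c (V := A)).
  by case: fA.
have fR' : left_free (R := (tilde rhoA rhoT)^c) (B := (A ⊗ T)^c) (tens_gr gr (T := T)) (conv (@tilde_incl k H T rhoT A rhoA)) (fun j => 1 ⊗t t j) rR.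
  by case: fR.
have [extrR gldrR injrR] := AS_transfer (alpha := conv (tens_inl T)) (beta := conv (@tilde_incl k H T rhoT A rhoA))
  (graded_algebra_conv hB)   (connected_graded_conv hcA) (connected_graded_conv hcR) agr bgr n0 lA fA' lR fR' extr gldr.
by split=> //; split=> //; exists l.
Qed.
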